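(* There are absolute constants $C_5\ge5$, $C_6>0$, $c_7\in(0,1)$ (and an absolute constant $K>0$) with the following property. Let $X^{(1)},\ldots,X^{(N)}\in(\mathbb{R}\cup\{*\})^d$ be an incomplete dataset with a completed dataset $X^{(1,0)},\ldots,X^{(N,0)}$ that is $(\varepsilon,g_*,\eta,\beta)$-good with respect to some $\mu$, where $\varepsilon\in(0,1)$, $C_5\varepsilon\le g_*\le1$, $\eta\ge0$ and $\beta^2\ge K\eta^2\varepsilon\log(1/\varepsilon)$; let $G$ be a set witnessing this goodness and $g_j=|G\cap\Gamma_j|/|G|$. The quantities $\mu,G,g_1,\ldots,g_d$ are unknown. Given the dataset, the parameters $\varepsilon,g_*,\eta,\beta$, a current guess $\nu\in\mathbb{R}^d$, a number $\rho$ with $\rho\ge\|\nu-\mu\|_g:=\big(\sum_j g_j(\nu_j-\mu_j)^2\big)^{1/2}$, and $\delta\in(0,1/2)$, there is an algorithm running in time $\widetilde O(Nd\log(1/\delta))$ that outputs $\nu'\in\mathbb{R}^d$ such that with probability at least $1-\delta$, $$\|\nu'-\mu\|_g^2\le C_6\beta^2\varepsilon+(1-c_7g_* )\rho^2.$$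
   Context: For $G\subseteq\{1,\ldots,N\}$, $\Delta_G$ is the set of weight vectors $w=(w^{(1)},\ldots,w^{(N)})$ with $w^{(i)}\ge0$, $\sum_i w^{(i)}=1$, $w^{(i)}=0$ for $i\notin G$; for $p\in(0,|G|]$, $\Delta_{G,p}=\{w\in\Delta_G: w^{(i)}\le 1/p\ \forall i\}$. $\|\cdot\|_{\mathrm{op}}$ is the spectral norm. For an incomplete dataset $X^{(1)},\ldots,X^{(N)}\in(\mathbb{R}\cup\{*\})^d$ ($*$ marks a missing entry), let $\Gamma_j=\{i:X^{(i)}_j\neq*\}$. A completed dataset is any $X^{(1,0)},\ldots,X^{(N,0)}\in\mathbb{R}^d$ agreeing with $X^{(i)}$ on non-missing entries. For $\nu\in\mathbb{R}^d$, the adjusted dataset is $X^{(i,\nu)}_j=X^{(i,0)}_j$ if $X^{(i)}_j\neq*$ and $X^{(i,\nu)}_j=X^{(i,0)}_j+\nu_j$ otherwise. The completed dataset is $(\varepsilon,g_*,\eta,\beta)$-good with respect to $\mu$ if there exists $G\subseteq\{1,\ldots,N\}$ with: $|G|\ge(1-\varepsilon)N$; $|G\cap\Gamma_j|/|G|\ge g_*$ for all $j$; and for all $w\in\Delta_{G,(1-3\varepsilon)N}$: $\|\sum_{i\in G}w^{(i)}(X^{(i,\mu)}-\mu)\|_2\le\beta\sqrt\varepsilon$, $\|\sum_{i\in G}w^{(i)}(X^{(i,\mu)}-\mu)(X^{(i,\mu)}-\mu)^\top-\eta^2I\|_{\mathrm{op}}\le\beta^2$, and $\|\sum_{i\in G\cap\Gamma_j}w^{(i)}(X^{(i,\mu)}-\mu)\|_2\le\beta\sqrt\varepsilon$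 for all $j$. Such a $G$ witnesses the goodness. $\widetilde O$ hides absolute constants and polylogarithmic factors. *)

(* Defs.v *)
From HB Require Import structures.
From mathcomp Require Import all_boot all_order all_algebra.
From mathcomp Require Import boolp classical_sets reals exp.

Set Implicit Arguments.
Unset Strict Implicit.
Unset Printing Implicit Defensive.

Import Order.TTheory GRing.Theory Num.Theory.
Local Open Scope ring_scope.

(** * Norms (points of R^d are row vectors) *)

Definition l2norm (R : realType) (d : nat) (v : 'rV[R]_d) : R :=
  Num.sqrt (\sum_(j < d) v 0 j ^+ 2).

(* Spectral norm, i.e. the norm of x |-> x *m A induced by [l2norm]; the
   supremum is over a nonempty bounded set. *)
Definition opnorm (R : realType) (d : nat) (A : 'M[R]_d) : R :=
  sup [set l2norm (x *m A) | x in [set x : 'rV[R]_d | l2norm x <= 1]]%classic.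

(** * Incomplete data *)

(* Row i of [X] is the i-th data point; [None] marks a missing entry. *)
Definition observed (R : realType) (N d : nat) (X : 'M[option R]_(N, d))
    (j : 'I_d) : {set 'I_N} :=
  [set i | isSome (X i j)].

Definition completes (R : realType) (N d : nat) (X : 'M[option R]_(N, d))
    (X0 : 'M[R]_(N, d)) : Prop :=
  forall i j x, X i j = Some x -> X0 i j = x.

Definition adjusted (R : realType) (N d : nat) (X : 'M[option R]_(N, d))
    (X0 : 'M[R]_(N, d)) (nu : 'rV[R]_d) : 'M[R]_(N, d) :=
  \matrix_(i, j) (if isSome (X i j) then X0 i j else X0 i j + nu 0 j).

Definition obs_frac (R : realType) (N d : nat) (X : 'M[option R]_(N, d))
    (G : {set 'I_N}) (j : 'I_d) : R :=
  #|G :&: observed X j|%:R / #|G|%:R.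

Definition wnorm (R : realType) (d : nat) (g : 'I_d -> R) (v : 'rV[R]_d) : R :=
  Num.sqrt (\sum_(j < d) g j * v 0 j ^+ 2).

Definition simplex (R : realType) (N : nat) (G : {set 'I_N})
    (w : 'I_N -> R) : Prop :=
  [/\ forall i, 0 <= w i, \sum_(i < N) w i = 1
    & forall i, i \notin G -> w i = 0].

Definition capped_simplex (R : realType) (N : nat) (G : {set 'I_N}) (p : R)
    (w : 'I_N -> R) : Prop :=
  simplex G w /\ forall i, w i <= 1 / p.

(* [G] witnesses that the completed dataset [X0] of [X] is
   (eps, gs, eta, beta)-good with respect to [mu]. *)
Definition good_witness (R : realType) (N d : nat) (X : 'M[option R]_(N, d))
    (X0 : 'M[R]_(N, d)) (eps gs eta beta : R) (mu : 'rV[R]_d)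
    (G : {set 'I_N}) : Prop :=
  let dev i : 'rV[R]_d := row i (adjusted X X0 mu) - mu in
  [/\ (1 - eps) * N%:R <= #|G|%:R,
      forall j, gs <= obs_frac X G j
    & forall w : 'I_N -> R, capped_simplex G ((1 - 3 * eps) * N%:R) w ->
      [/\ l2norm (\sum_(i in G) w i *: dev i) <= beta * Num.sqrt eps,
          opnorm (\sum_(i in G) w i *: ((dev i)^T *m dev i) - (eta ^+ 2)%:M)
            <= beta ^+ 2
        & forall j, l2norm (\sum_(i in G :&: observed X j) w i *: dev i)
            <= beta * Num.sqrt eps]].

(** * Randomized algorithms

   The model is the real RAM with fair coin tosses, presented as a small
   imperative language.  Memory consists of zero-initialized arrays, each named
   by a literal occurring in the program and indexed by nat: arrays of naturals
   (indices, counters, flags) and arrays of reals.  Reals support exact field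
   operations and comparisons.  To keep unit cost honest, naturals have only
   addition and truncated subtraction, there is no rounding of reals to
   naturals, and the only literals are natural numbers. *)

Inductive nexpr : Type :=
| NConst of nat
| NGet of nat & nexpr
| NAdd of nexpr & nexpr
| NSub of nexpr & nexpr.

Inductive rexpr : Type :=
| RNat of nexpr
| RGet of nat & nexpr
| RAdd of rexpr & rexpr
| RSub of rexpr & rexpr
| RMul of rexpr & rexpr
| RDiv of rexpr & rexpr.

Inductive bexpr : Type :=
| NLe of nexpr & nexpr
| RLe of rexpr & rexpr
| BNot of bexpr.

Inductive cmd : Type :=
| Skip
| NSet of nat & nexpr & nexpr
| RSet of nat & nexpr & rexpr
| Flip of nat & nexpr
| Seq of cmd & cmd
| If of bexpr & cmd & cmd
| While of bexpr & cmd.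

Record state (R : Type) : Type := State {
  nmem : nat -> nat -> nat;  (* array name, index *)
  rmem : nat -> nat -> R;
  coins : nat -> bool        (* the coin tosses still to come *)
}.

Definition upd (T : Type) (m : nat -> nat -> T) (a k : nat) (v : T) :
    nat -> nat -> T :=
  fun b l => if (b == a) && (l == k) then v else m b l.

Fixpoint neval (R : realType) (s : state R) (e : nexpr) : nat :=
  match e with
  | NConst n => n
  | NGet a i => nmem s a (neval s i)
  | NAdd e1 e2 => (neval s e1 + neval s e2)%N
  | NSub e1 e2 => (neval s e1 - neval s e2)%N
  end.

Fixpoint reval (R : realType) (s : state R) (e : rexpr) : R :=
  match e with
  | RNat n => (neval s n)%:R
  | RGet a i => rmem s a (neval s i)
  | RAdd e1 e2 => reval s e1 + reval s e2
  | RSub e1 e2 => reval s e1 - reval s e2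
  | RMul e1 e2 => reval s e1 * reval s e2
  | RDiv e1 e2 => reval s e1 / reval s e2
  end.

Fixpoint beval (R : realType) (s : state R) (b : bexpr) : bool :=
  match b with
  | NLe e1 e2 => (neval s e1 <= neval s e2)%N
  | RLe e1 e2 => reval s e1 <= reval s e2
  | BNot b1 => ~~ beval s b1
  end.

Fixpoint ncost (e : nexpr) : nat :=
  match e with
  | NConst _ => 1
  | NGet _ i => (ncost i).+1
  | NAdd e1 e2 | NSub e1 e2 => (ncost e1 + ncost e2).+1
  end.

Fixpoint rcost (e : rexpr) : nat :=
  match e with
  | RNat n => (ncost n).+1
  | RGet _ i => (ncost i).+1
  | RAdd e1 e2 | RSub e1 e2 | RMul e1 e2 | RDiv e1 e2 =>
      (rcost e1 + rcost e2).+1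
  end.

Fixpoint bcost (b : bexpr) : nat :=
  match b with
  | NLe e1 e2 => (ncost e1 + ncost e2).+1
  | RLe e1 e2 => (rcost e1 + rcost e2).+1
  | BNot b1 => (bcost b1).+1
  end.

(* [exec c s t s']: started in state [s], [c] halts in state [s'] after exactly
   [t] elementary operations. *)
Inductive exec (R : realType) : cmd -> state R -> nat -> state R -> Prop :=
| ExSkip s : exec Skip s 1 s
| ExNSet a i e s :
    exec (NSet a i e) s (ncost i + ncost e).+1
      (State (upd (nmem s) a (neval s i) (neval s e)) (rmem s) (coins s))
| ExRSet a i e s :
    exec (RSet a i e) s (ncost i + rcost e).+1
      (State (nmem s) (upd (rmem s) a (neval s i) (reval s e)) (coins s))
| ExFlip a i s :
    exec (Flip a i) s (ncost i).+1
      (State (upd (nmem s) a (neval s i) (nat_of_bool (coins s 0%N))) (rmem s)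
         (fun k => coins s k.+1))
| ExSeq c1 c2 s t1 s1 t2 s2 :
    exec c1 s t1 s1 -> exec c2 s1 t2 s2 -> exec (Seq c1 c2) s (t1 + t2) s2
| ExIf b c1 c2 s t s' :
    exec (if beval s b then c1 else c2) s t s' ->
    exec (If b c1 c2) s (bcost b + t).+1 s'
| ExWhileDone b c s :
    beval s b = false -> exec (While b c) s (bcost b).+1 s
| ExWhileStep b c s t1 s1 t2 s2 :
    beval s b = true -> exec c s t1 s1 -> exec (While b c) s1 t2 s2 ->
    exec (While b c) s (bcost b + t1 + t2).+1 s2.

Lemma exec_det (R : realType) (c : cmd) (s : state R) (t1 t2 : nat)
    (s1 s2 : state R) :
  exec c s t1 s1 -> exec c s t2 s2 -> t1 = t2 /\ s1 = s2.
Proof.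
move=> H; elim: H t2 s2 => {c s t1 s1}.
- by move=> s t2 s2 H; inversion H.
- by move=> a i e s t2 s2 H; inversion H.
- by move=> a i e s t2 s2 H; inversion H.
- by move=> a i s t2 s2 H; inversion H.
- move=> c1 c2 s t1 s1 t2 s2 _ IH1 _ IH2 t s' H; inversion H; subst.
  match goal with
  | H1 : exec c1 s _ _, H2 : exec c2 _ _ s' |- _ =>
      by have [? ?] := IH1 _ _ H1; subst; have [-> ->] := IH2 _ _ H2
  end.
- move=> b c1 c2 s t s' _ IH t2 s2 H; inversion H; subst.
  match goal with
  | H1 : exec (if _ then _ else _) _ _ _ |- _ => by have [-> ->] := IH _ _ H1
  end.
- by move=> b c s Hb t2 s2 H; inversion H; subst=> //; congruence.
- move=> b c s t1 s1 t2 s2 Hb _ IH1 _ IH2 t s' H; inversion H; subst.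
    by congruence.
  match goal with
  | H1 : exec c s _ _, H2 : exec (While b c) _ _ s' |- _ =>
      by have [? ?] := IH1 _ _ H1; subst; have [-> ->] := IH2 _ _ H2
  end.
Qed.

Definition halts_within (R : realType) (P : cmd) (init : (nat -> bool) -> state R)
    (T : nat) : Prop :=
  forall omega, exists t s, exec P (init omega) t s /\ (t <= T)%N.

(* Probability that the final state of [P] satisfies [E].  Every toss costs at
   least one operation, so when [halts_within P init T] only the first [T]
   tosses matter, and they are uniform in {0,1}^T. *)
Definition prob_output (R : realType) (P : cmd) (init : (nat -> bool) -> state R)
    (T : nat) (E : state R -> Prop) : R :=
  #|[set omega : T.-tuple bool |
      `[< exists t s, exec P (init (nth false omega)) t s /\ E s >]]|%:R
  / 2 ^+ T.

(* Row-major listing: entry (i, j) has index i * d + j. *)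
Definition row_major (T : Type) (N d : nat) (A : 'M[T]_(N, d)) : seq T :=
  [seq A i j | i <- enum 'I_N, j <- enum 'I_d].

(* The input: the shape of the dataset, which entries are observed, the
   completed dataset, the guess [nu], and the real parameters. *)
Definition input (R : realType) (N d : nat) (X : 'M[option R]_(N, d))
    (X0 : 'M[R]_(N, d)) (nu : 'rV[R]_d) (params : seq R)
    (omega : nat -> bool) : state R :=
  State
    (fun a k => match a with
       | 0 => nth 0%N [:: N; d] k
       | 1 => nth 0%N (row_major (map_mx (nat_of_bool \o isSome) X)) k
       | _ => 0%N
       end)
    (fun a k => match a with
       | 0 => nth 0 params k
       | 1 => nth 0 (row_major X0) k
       | 2 => nth 0 (row_major nu) k
       | _ => 0
       end)
    omega.

Definition output (R : realType) (d : nat) (s : state R) : 'rV[R]_d :=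
  \row_j rmem s 3 j.

(* O~(m): m up to the constant [A] and [k]-th power logarithmic factors. *)
Definition softO (R : realType) (A : R) (k : nat) (m : R) : R :=
  A * m * (1 + ln (1 + m)) ^+ k.

(* Main.v *)
Require Import Defs.
From mathcomp Require Import all_boot all_order all_algebra.
From mathcomp Require Import boolp classical_sets reals exp.
From mathcomp Require Import ring lra zify.

Set Implicit Arguments.
Unset Strict Implicit.
Unset Printing Implicit Defensive.

Import Order.TTheory GRing.Theory Num.Theory.
Local Open Scope ring_scope.

(* Put [v = nu - mu] and [y_i = X^(i,nu) - nu].  On good points, [y_i] is the
   deviation of [X^(i,mu)] from [mu] minus the restriction of [v] to the observed
   coordinates; so its mean is about [- g v], its second moment about the origin
   is [eta^2 I] up to [B^2 = 3 (beta^2 + rho^2)] (this is where the g-norm is the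
   right one), and adding a robust mean of the [y_i] to [nu] turns [v] into
   [(1 - g) v + e] with [|e|^2 = O(eps B^2)], which gives the contraction because
   [eps] is at most a small multiple of [g_*].

   The robust mean is a weighted average, the weights being filtered until the
   shifted second-moment matrix [A = M_w - (eta^2 - 2 B^2) I >= 0] has norm
   [O(B^2)].  Each round draws a single random sign vector [s], sets [u = A^p s]
   with [4^p > 2 d], and damps the weights of the points with a huge score
   [<u, y_i>^2] just enough for them to carry little score; as good points carry
   even less of it, more bad than good weight is lost.  The potential is
   [tr A^(2p+1)].  Since [A' <= A] implies [tr A'^(2p+1) <= tr (A' A^(2p))], and
   since [E <u, y_i>^2 = |A^p y_i|^2] while the fourth moment is at most three
   times the square of this, the potential above its target value decreases in
   expectation by a factor [5/6] per round; it never increases, so Markov's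
   inequality after logarithmically many rounds gives the success probability. *)


(** * Positive semidefinite matrices *)

(** The shift is forced by the regime: about [eta] one only knows [2 eps eta^2 <= B^2], so [eta^2]
    may exceed [B^2] by a factor of order [1 / eps], and powers of the unshifted matrix would be
    dominated by the harmless part [eta^2 I]. After the shift the good points contribute a matrix
    between [0] and [3 B^2 I]. One sign vector does not estimate all scores accurately. No
    concentration or union bound is attempted: a point missed by the sketch is charged to the
    expectation of the potential. Exponents are powers of two for two reasons: Cauchy-Schwarz for
    traces doubles exponents, and the machine, whose naturals have no product and whose reals have
    no logarithm, can reach them by doubling and squaring. For the same reason the number of rounds
    is never computed. A real clock starts at a bound for the initial potential over its target,
    divided by [delta], and is multiplied by [5 / 6] until it is at most 1. Two degenerate cases
    bypass the filter, their clock being zero: [eps N < 1], where no point is bad, and [B^2 = 0],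
    where good residuals vanish. *)

Section Psd.
Variables (R : realType) (d : nat).
Implicit Types (x y z : 'rV[R]_d) (A B P : 'M[R]_d) (c : R).

Definition dot x y : R := \sum_(j < d) x 0 j * y 0 j.

Lemma dotE x y : dot x y = (x *m y^T) 0 0.
Proof. by rewrite mxE; apply: eq_bigr => j _; rewrite mxE. Qed.

Lemma dotC x y : dot x y = dot y x.
Proof. by apply: eq_bigr => j _; rewrite mulrC. Qed.

Lemma dotDl x y z : dot (x + y) z = dot x z + dot y z.
Proof. by rewrite -big_split; apply: eq_bigr => j _; rewrite mxE mulrDl. Qed.

Lemma dotZl c x y : dot (c *: x) y = c * dot x y.
Proof. by rewrite /dot mulr_sumr; apply: eq_bigr => j _; rewrite mxE mulrA. Qed.

Lemma dotDr x y z : dot x (y + z) = dot x y + dot x z.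
Proof. by rewrite dotC dotDl !(dotC x). Qed.

Lemma dotZr c x y : dot x (c *: y) = c * dot x y.
Proof. by rewrite dotC dotZl dotC. Qed.

Lemma dotNl x y : dot (- x) y = - dot x y.
Proof. by rewrite -scaleN1r dotZl mulN1r. Qed.

Lemma dotNr x y : dot x (- y) = - dot x y.
Proof. by rewrite dotC dotNl dotC. Qed.

Lemma dot_suml (I : Type) (r : seq I) (Q : pred I) (F : I -> 'rV[R]_d) y :
  dot (\sum_(i <- r | Q i) F i) y = \sum_(i <- r | Q i) dot (F i) y.
Proof.
elim/big_rec2: _ => [|i s z _ <-]; last by rewrite dotDl.
by apply: big1 => j _; rewrite mxE mul0r.
Qed.

Lemma dotxx_ge0 x : 0 <= dot x x.
Proof. by apply: sumr_ge0 => j _; rewrite -expr2 sqr_ge0. Qed.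

Lemma dot_mulmxr x y A : dot x (y *m A) = dot (x *m A^T) y.
Proof. by rewrite !dotE trmx_mul mulmxA. Qed.

(** The common source of the three Cauchy-Schwarz inequalities below: for the trace form, the dot
    product and weighted sums. *)
Lemma discriminant_le (a b c : R) : 0 <= c ->
  (forall s, 0 <= a + 2 * s * b + s ^+ 2 * c) -> b ^+ 2 <= a * c.
Proof.
rewrite le_eqVlt => /orP[/eqP <-|c0] h; last first.
  have := h (- b / c); have -> : a + 2 * (- b / c) * b + (- b / c) ^+ 2 * c =
     (a * c - b ^+ 2) / c by field; lra.
  by rewrite pmulr_lge0 ?invr_gt0 // subr_ge0.
rewrite mulr0; have [->|b0] := eqVneq b 0; first by rewrite expr0n.
(* With [c = 0] the expression is affine in [s]; a nonzero slope would take it to [-1] at this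
   point. *)
have := h (- (a + 1) / (2 * b)); rewrite mulr0 addr0.
have -> : a + 2 * (- (a + 1) / (2 * b)) * b = -1 by field.
by rewrite ler0N1.
Qed.

Definition psd A := A^T = A /\ forall x, 0 <= dot (x *m A) x.

Lemma dot_sym A x y : A^T = A -> dot x (y *m A) = dot (x *m A) y.
Proof. by move=> sA; rewrite dot_mulmxr sA. Qed.

Lemma trmx_exp A k : (A ^+ k)^T = A^T ^+ k.
Proof.
elim: k => [|k IH]; first by rewrite !expr0 trmx1.
by rewrite exprS -mulmxE trmx_mul IH exprSr mulmxE.
Qed.

(** Moving half of the exponent to each side turns the form of [A ^+ k] at [x] into that of [1] or
    [A] at [x *m A ^+ k./2], according to the parity of [k]. *)
Lemma psd_exp A k : psd A -> psd (A ^+ k).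
Proof.
move=> [sA pA]; split=> [|x]; first by rewrite trmx_exp sA.
have sk h : (A ^+ h)^T = A ^+ h by rewrite trmx_exp sA.
rewrite -(odd_double_half k) -addnn; case: (odd k) => /=.
  by rewrite add1n exprS exprD mulrA -exprS exprSr -!mulmxE !mulmxA -dot_sym ?sk //.
by rewrite add0n exprD -mulmxE mulmxA -dot_sym ?sk //; apply: dotxx_ge0.
Qed.

Lemma psd_scalar c : 0 <= c -> psd c%:M.
Proof.
move=> c0; split=> [|x]; first by rewrite tr_scalar_mx.
by rewrite mul_mx_scalar dotZl mulr_ge0 // dotxx_ge0.
Qed.

Lemma trace_congr A M : \tr (M * A * M^T) = \sum_i dot (row i M *m A) (row i M).
Proof.
rewrite /mxtrace; apply: eq_bigr => i _.
rewrite -!mulmxE mxE; apply: eq_bigr => j _.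
by rewrite -row_mul !mxE.
Qed.

Lemma trace_congr_ge0 A M : psd A -> 0 <= \tr (M * A * M^T).
Proof. by move=> [_ pA]; rewrite trace_congr; apply: sumr_ge0. Qed.

Lemma psd_trace_ge0 A : psd A -> 0 <= \tr A.
Proof. by move/trace_congr_ge0=> /(_ 1%:M); rewrite trmx1 -mulmxE mul1mx mulmx1. Qed.

Lemma mxtraceC A B : \tr (A * B) = \tr (B * A).
Proof. by rewrite -mulmxE mxtrace_mulC. Qed.

(** The even exponent makes this the trace of the congruence [A ^+ k * P * A ^+ k], so no square
    root of a matrix is taken. *)
Lemma trace_sqr_ge0 A P k : psd A -> psd P -> 0 <= \tr (P * A ^+ (k + k)).
Proof.
move=> pA pP; rewrite exprD mulrA mxtraceC mulrA.
have -> : A ^+ k * P * A ^+ k = A ^+ k * P * (A ^+ k)^T.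
  by rewrite (psd_exp k pA).1.
exact: trace_congr_ge0.
Qed.

Lemma trace_CS P X Y : psd P ->
  \tr (X * P * Y^T) ^+ 2 <= \tr (X * P * X^T) * \tr (Y * P * Y^T).
Proof.
move=> pP; apply: discriminant_le => [|s]; first exact: trace_congr_ge0.
have := trace_congr_ge0 (X + s *: Y) pP; congr (_ <= _).
have sw : \tr (Y * P * X^T) = \tr (X * P * Y^T).
  rewrite -[LHS]mxtrace_tr -!mulmxE !trmx_mul trmxK pP.1.
  by rewrite mulmxA.
rewrite linearD linearZ /= !mulrDl !mulrDr !linearD /=.
rewrite -!mulmxE -?scalemxAl -?scalemxAr -?scalemxAl !linearZ /= !mulmxE sw; ring.
Qed.

(* The exponent [2 ^ k] is doubled by Cauchy-Schwarz for the form
   [tr (X A^r Y^T)], so that no spectral decomposition is needed. *)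
Lemma trace_exp_mono A B k r : psd A -> psd B -> psd (B - A) ->
  ~~ odd (r + 2 ^ k).-1 ->
  \tr (A ^+ (r + 2 ^ k)) <= \tr (A ^+ r * B ^+ (2 ^ k)).
Proof.
move=> pA pB pD; elim: k r => [|k IH] r.
  (* The sum [r + 2 ^ k] is the same at every level of the recursion, so the parity hypothesis says
     here that [r] itself is even, as [trace_sqr_ge0] requires. *)
  rewrite expn0 addn1 /= => /even_halfK; rewrite -addnn => <-.
  rewrite exprSr expr1 -subr_ge0 -raddfB /= -mulrBr mxtraceC.
  exact: trace_sqr_ge0.
have -> : (2 ^ k.+1 = 2 ^ k + 2 ^ k)%N by rewrite expnS mul2n addnn.
rewrite addnA => /IH{}IH.
have pr := psd_exp r pA.
have := trace_CS (B ^+ (2 ^ k)) (A ^+ (2 ^ k)) pr.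
rewrite (psd_exp _ pA).1 (psd_exp _ pB).1.
have -> : \tr (B ^+ (2 ^ k) * A ^+ r * A ^+ (2 ^ k)) =
          \tr (A ^+ (r + 2 ^ k) * B ^+ (2 ^ k)).
  by rewrite -mulrA -exprD mxtraceC.
have -> : \tr (B ^+ (2 ^ k) * A ^+ r * B ^+ (2 ^ k)) =
          \tr (A ^+ r * B ^+ (2 ^ k + 2 ^ k)).
  by rewrite exprD mulrA -[RHS]mxtraceC mulrA.
rewrite -!exprD (addnC _ r).
have t0 : 0 <= \tr (A ^+ (r + 2 ^ k + 2 ^ k)).
  exact: psd_trace_ge0 (psd_exp _ pA).
have c0 : 0 <= \tr (A ^+ r * B ^+ (2 ^ k + 2 ^ k)) by apply: trace_sqr_ge0.
set c := \tr (A ^+ r * _); set t := \tr (A ^+ (_ + _)); set b := \tr (A ^+ _ * _).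
(* Now [t <= b] by induction and [b ^ 2 <= c * t]; if [c < t], then
   [t ^ 2 <= b ^ 2 <= c * t < t ^ 2]. *)
move: c0 t0 IH; rewrite -/c -/t -/b; move: c t b => c t b c0 t0 tb h; rewrite leNgt; apply/negP => ct.
have tp : 0 < t by apply: le_lt_trans ct.
have : c * t < t * t by rewrite ltr_pM2r.
have : t * t <= b * b by rewrite ler_pM.
by rewrite -expr2; lra.
Qed.

(** For each eigenvalue [l] this is [th l^k <= l^(k+1) + th^(k+1)]. Eigenvalues are avoided: the
    trace of [(A - th) A^k (A - th)] gives [tr A^(k+2) - 2 th tr A^(k+1) + th^2 tr A^k >= 0], which
    carries the bound from [k] to [k + 1]. *)
Lemma trace_exp_threshold A (th : R) k : psd A -> 0 <= th ->
  th * \tr (A ^+ k) <= \tr (A ^+ k.+1) + d%:R * th ^+ k.+1.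
Proof.
move=> pA th0; elim: k => [|k IH].
  have -> : A ^+ 0 = 1%:M by [].
  rewrite mxtrace_scalar expr1.
  by have := psd_trace_ge0 pA; rewrite expr1; lra.
have := trace_congr_ge0 (A - th%:M) (psd_exp k pA).
have -> : (A - th%:M)^T = A - th%:M by rewrite linearB /= pA.1 tr_scalar_mx.
have -> : (A - th%:M) * A ^+ k * (A - th%:M) =
    A ^+ k.+2 - (2 * th) *: A ^+ k.+1 + th ^+ 2 *: A ^+ k.
  rewrite mulrBr !mulrBl -exprS -exprSr -!mulmxE !mul_scalar_mx !mul_mx_scalar.
  rewrite -scalemxAl mulmxE -exprSr.
  by apply/matrixP => i j; rewrite !mxE; ring.
rewrite mxtraceD linearB /= !mxtraceZ (exprS th k.+1).
set a := \tr (A ^+ k.+2); set b := \tr (A ^+ k.+1) in IH *.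
set c := \tr (A ^+ k) in IH *.
set e := th ^+ k.+1 in IH *.
move: a b c e IH => a b c e /(ler_wpM2l th0) IH H. nra.
Qed.

(** Jensen's inequality for the spectral measure of [x]. Positivity of [A ^+ m] at [x A - th x]
    shows that the ratio of consecutive moments, once at least [th], stays so. *)
Lemma dot_exp_ge A (th : R) x k : psd A -> 0 <= th ->
  th * dot x x <= dot (x *m A) x ->
  th ^+ k * dot x x <= dot (x *m A ^+ k) x.
Proof.
move=> pA th0 h.
have E0 : A ^+ 0 = 1%:M by [].
have step m : th * dot (x *m A ^+ m) x <= dot (x *m A ^+ m.+1) x.
  elim: m => [|m IH]; first by rewrite E0 mulmx1 expr1.
  have := (psd_exp m pA).2 (x *m A - th *: x).
  have e1 : x *m A *m A ^+ m = x *m A ^+ m.+1 by rewrite -mulmxA exprS.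
  have e2 l : x *m A ^+ l *m A = x *m A ^+ l.+1 by rewrite -mulmxA exprSr.
  rewrite mulmxBl -scalemxAl e1.
  rewrite !(dotDl, dotDr, dotNl, dotNr, dotZl, dotZr) !dot_sym ?pA.1 // !e2.
  by nra.
elim: k => [|k IH]; first by rewrite E0 mulmx1 mul1r.
by rewrite exprS -mulrA (le_trans _ (step k)) // ler_wpM2l.
Qed.

Lemma dot_CS (x z : 'rV[R]_d) : dot x z ^+ 2 <= dot x x * dot z z.
Proof.
apply: discriminant_le => [|s]; first exact: dotxx_ge0.
have := dotxx_ge0 (x + s *: z); congr (_ <= _).
by rewrite !(dotDl, dotDr, dotZl, dotZr) (dotC z x); ring.
Qed.

Lemma dot_mulmxE (y : 'rV[R]_d) (M : 'M[R]_d) :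
  dot (y *m M) (y *m M) = \sum_j dot y (row j M^T) ^+ 2.
Proof.
rewrite [LHS]/dot; apply: eq_bigr => j _; rewrite -expr2.
by congr (_ ^+ 2); rewrite mxE; apply: eq_bigr => k _; rewrite !mxE.
Qed.

(** The Frobenius norm bounds the operator norm. Applied to [A ^+ p], this bounds the form of
    [A ^+ (2 p)] by its trace; it also shows that the set defining [opnorm] is bounded. *)
Lemma dot_mulmx_le x A : dot (x *m A) (x *m A) <= dot x x * \tr (A * A^T).
Proof.
rewrite mxtraceC dot_mulmxE.
have -> : A^T * A = A^T * 1%:M * A^T^T by rewrite -!mulmxE mulmx1 trmxK.
rewrite trace_congr mulr_sumr; apply: ler_sum => j _.
by rewrite mulmx1 dot_CS.
Qed.

End Psd.


(** * Averages over coin tosses *)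

Definition scons (T : Type) (b : T) (om : nat -> T) : nat -> T :=
  fun k => if k is k'.+1 then om k' else b.

Definition sdrop (T : Type) (n : nat) (om : nat -> T) : nat -> T :=
  fun k => om (n + k)%N.

Section Avg.
Variable R : realType.
Implicit Types (f : (nat -> bool) -> R) (om : nat -> bool).

(** Tosses after the first [n] read [false], as they do in [prob_output]. *)
Fixpoint avg (n : nat) f : R :=
  if n is n'.+1 then
    (avg n' (fun om => f (scons true om)) + avg n' (fun om => f (scons false om))) / 2
  else f (fun=> false).

Lemma eq_avg n f1 f2 : f1 =1 f2 -> avg n f1 = avg n f2.
Proof.
elim: n f1 f2 => [|n IH] f1 f2 e /=; first exact: e.
by congr ((_ + _) / 2); apply: IH => om.
Qed.

Lemma ler_avg n f1 f2 : (forall om, f1 om <= f2 om) -> avg n f1 <= avg n f2.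
Proof.
elim: n f1 f2 => [|n IH] f1 f2 e /=; first exact: e.
by rewrite ler_pM2r ?invr_gt0 // lerD // IH.
Qed.

Lemma avg_cst n c : avg n (fun=> c) = c.
Proof. by elim: n => //= n ->; field. Qed.

Lemma avgD n f1 f2 : avg n (fun om => f1 om + f2 om) = avg n f1 + avg n f2.
Proof. by elim: n f1 f2 => //= n IH f1 f2; rewrite !IH; field. Qed.

Lemma avgZ n c f : avg n (fun om => c * f om) = c * avg n f.
Proof. by elim: n f => //= n IH f; rewrite !IH; field. Qed.

Lemma avg_sum n (I : Type) (r : seq I) (Q : pred I) (F : I -> (nat -> bool) -> R) :
  avg n (fun om => \sum_(i <- r | Q i) F i om) = \sum_(i <- r | Q i) avg n (F i).
Proof.
elim: r => [|i r IH].
  by rewrite big_nil -[RHS](avg_cst n); apply: eq_avg => om; rewrite big_nil.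
rewrite big_cons -IH; case: ifP => Qi; last first.
  by apply: eq_avg => om; rewrite big_cons Qi.
by rewrite -avgD; apply: eq_avg => om; rewrite big_cons Qi.
Qed.

(** Fubini for the first [d] tosses and the rest. Locality reconciles the two sides: the first
    argument of [f] is the whole stream on the left, and is padded with [false] after [d] tosses on
    the right. *)
Lemma avg_split d m (f : (nat -> bool) -> (nat -> bool) -> R) :
  (forall om1 om2 om, (forall k, (k < d)%N -> om1 k = om2 k) ->
     f om1 om = f om2 om) ->
  avg (d + m) (fun om => f om (sdrop d om)) = avg d (fun om => avg m (f om)).
Proof.
elim: d f => [|d IH] f loc /=.
  by apply: eq_avg => om; rewrite (loc om (fun=> false)) //; congr (f _ _).
have locb b om1 om2 om : (forall k, (k < d)%N -> om1 k = om2 k) ->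
    f (scons b om1) om = f (scons b om2) om.
  by move=> h; apply: loc => -[|k] //= kd; apply: h.
by congr ((_ + _) / 2); [exact: (IH _ (locb true))|exact: (IH _ (locb false))].
Qed.

Lemma avg_tuple n f :
  avg n f = (\sum_(t : n.-tuple bool) f (nth false t)) / 2 ^+ n.
Proof.
elim: n f => [|n IH] f /=.
  rewrite expr0 divr1 (big_pred1 [tuple]) => [|t]; last by apply/esym/eqP; rewrite (tuple0 t).
  by congr f; apply: funext => k; rewrite nth_nil.
rewrite !IH -mulrDl -mulrA -invfM -exprSr; congr (_ / _).
pose h (p : bool * n.-tuple bool) := cons_tuple p.1 p.2.
have hb : {on [pred _ | true], bijective h}.
  exists (fun t => (thead t, behead_tuple t)) => [[b t] _|t _]; rewrite /h /=.
    by congr (_, _); apply: val_inj.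
  by rewrite [RHS]tuple_eta; apply: val_inj.
rewrite [RHS](reindex h) //.
rewrite -(pair_bigA _ (fun b t => f (nth false (h (b, t))))) /=.
rewrite big_bool; congr (_ + _); apply: eq_bigr => t _; congr f;
  by apply: funext => -[|k].
Qed.

Lemma prob_output_avg (P : cmd) (init : (nat -> bool) -> state R) T E :
  prob_output P init T E =
  avg T (fun om => (`[< exists t s, exec P (init om) t s /\ E s >])%:R).
Proof.
rewrite avg_tuple /prob_output; congr (_ / _).
rewrite -sum1_card natr_sum big_mkcond /=; apply: eq_bigr => t _.
by rewrite inE; case: ifP.
Qed.

Definition sgnc (b : bool) : R := if b then 1 else -1.

Lemma avg_rademacher2 d (a : nat -> R) :
  avg d (fun om => (\sum_(0 <= j < d) sgnc (om j) * a j) ^+ 2) =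
  \sum_(0 <= j < d) a j ^+ 2.
Proof.
elim: d a => [|d IH] a; first by rewrite /= !big_nil expr0n.
rewrite [RHS]big_nat_recl //= -IH.
rewrite -avgD.
rewrite (@eq_avg _ _ (fun om => 2 * a 0%N ^+ 2 +
   2 * (\sum_(0 <= j < d) sgnc (om j) * a j.+1) ^+ 2)); last first.
  by move=> om; rewrite !big_nat_recl //=; ring.
by rewrite avgD avg_cst avgZ; field.
Qed.

(** Averaging over the first sign turns [(a + S)^4] into [a^4 + 6 a^2 S^2 + S^4], which fits under
    the expansion of [3 (a^2 + s)^2]. *)
Lemma avg_rademacher4 d (a : nat -> R) :
  avg d (fun om => (\sum_(0 <= j < d) sgnc (om j) * a j) ^+ 4) <=
  3 * (\sum_(0 <= j < d) a j ^+ 2) ^+ 2.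
Proof.
elim: d a => [|d IH] a; first by rewrite /= !big_nil !expr0n /= mulr0.
rewrite [in leRHS]big_nat_recl //= -avgD.
rewrite (@eq_avg _ _ (fun om => 2 * a 0%N ^+ 4 +
   (12 * a 0%N ^+ 2 * (\sum_(0 <= j < d) sgnc (om j) * a j.+1) ^+ 2 +
    2 * (\sum_(0 <= j < d) sgnc (om j) * a j.+1) ^+ 4))); last first.
  by move=> om; rewrite !big_nat_recl //=; ring.
rewrite avgD avg_cst avgD !avgZ avg_rademacher2.
have := IH (fun j => a j.+1); set s := \sum_(_ <= _ < _) _.
set m := avg _ _ => h.
have a4 : 0 <= a 0%N ^+ 4 by rewrite -[4%N]/(2 * 2)%N exprM sqr_ge0.
have -> : 3 * (a 0%N ^+ 2 + s) ^+ 2 =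
  3 * a 0%N ^+ 4 + 6 * a 0%N ^+ 2 * s + 3 * s ^+ 2 by ring.
lra.
Qed.

End Avg.


(** * The filter *)

Section Filter.
Variables (R : realType) (N d : nat).
Variables (Y : 'I_N -> 'rV[R]_d) (eps eta2 B2 : R).
Implicit Types (w : 'I_N -> R) (x u : 'rV[R]_d).

(** Division is by [N] and not by the total weight, so that lowering weights lowers the matrix. *)
Definition gram w : 'M[R]_d :=
  \sum_i (w i / N%:R) *: ((Y i)^T *m Y i) - (eta2 - 2 * B2)%:M.

(** Scores below the cut-off can be left alone: the bad points, at most [eps N] in number, hold at
    most [6 N B2 |u|^2] of them altogether. *)
Definition tail_score u (i : 'I_N) : R :=
  if 6 * B2 * dot u u / eps < dot (Y i) u ^+ 2 then dot (Y i) u ^+ 2 else 0.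

Definition damped_sum w (tau : 'I_N -> R) (k : R) : R :=
  \sum_i w i * tau i / (1 + k * tau i).

(** A doubling search: [k + k0] doubles at each trial. The fuel makes it a structural recursion; the
    program runs the same search as an unbounded loop. *)
Fixpoint damping (f : R -> R) (thr k0 : R) (fuel : nat) (k : R) : R :=
  if fuel is n.+1 then
    if f k <= thr then k else damping f thr k0 n (k + k + k0)
  else k.

Definition fuel_of : nat := (trunc_log 2 N).+1.*2.

Definition norm_cap : R := N%:R * (eta2 + B2).

Definition damp w u : R :=
  damping (damped_sum w (tail_score u)) (12 * N%:R * B2 * dot u u)
    (1 / (norm_cap * dot u u)) fuel_of 0.

Definition downweight w u : 'I_N -> R :=
  fun i => w i / (1 + damp w u * tail_score u i).

Lemma dot_gram w x z : dot (x *m gram w) z =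
  \sum_i w i / N%:R * (dot (Y i) x * dot (Y i) z) - (eta2 - 2 * B2) * dot x z.
Proof.
rewrite /gram mulmxBr mul_mx_scalar dotDl dotNl dotZl mulmx_sumr dot_suml.
congr (_ - _); apply: eq_bigr => i _.
rewrite -scalemxAr dotZl mulmxA; congr (_ * _).
have -> : x *m (Y i)^T = (dot (Y i) x)%:M.
  by rewrite dotC dotE -mx11_scalar.
by rewrite mul_scalar_mx dotZl.
Qed.

Lemma gram_sym w : (gram w)^T = gram w.
Proof.
rewrite /gram linearB /= tr_scalar_mx raddf_sum; congr (_ - _).
by apply: eq_bigr => i _ /=; rewrite linearZ /= trmx_mul trmxK.
Qed.

Definition congr_score (M : 'M[R]_d) i := dot (Y i *m M) (Y i *m M).

Lemma congr_scoreE M i :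
  congr_score M i = \sum_j dot (Y i) (row j M^T) ^+ 2.
Proof. exact: dot_mulmxE. Qed.

Lemma congr_score_ge0 M i : 0 <= congr_score M i.
Proof. exact: dotxx_ge0. Qed.

Lemma trace_rows (M : 'M[R]_d) :
  \tr (M * M^T) = \sum_j dot (row j M^T) (row j M^T).
Proof.
rewrite mxtraceC; have -> : M^T * M = M^T * 1%:M * M^T^T.
  by rewrite -!mulmxE mulmx1 trmxK.
by rewrite trace_congr; apply: eq_bigr => j _; rewrite mulmx1.
Qed.

Lemma trace_gram w M :
  \tr (gram w * (M * M^T)) =
  \sum_i w i / N%:R * congr_score M i - (eta2 - 2 * B2) * \tr (M * M^T).
Proof.
have -> : \tr (gram w * (M * M^T)) = \tr (M^T * gram w * M^T^T).
  by rewrite trmxK mulrA mxtraceC mulrA.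
rewrite trace_congr trace_rows.
under eq_bigr => j _ do rewrite dot_gram.
rewrite sumrB -mulr_sumr; congr (_ - _); rewrite exchange_big /=; apply: eq_bigr => i _.
by rewrite -mulr_sumr congr_scoreE.
Qed.

(** * Stability of the good points under reweighting *)

Variable G : {set 'I_N}.

(** All that the filter knows about the good points. Second moments are taken about the origin, so
    that filtering involves no mean; first moments enter only in [estimate_error]. *)
Definition stable_sample : Prop :=
  [/\ (0 < N)%N, (1 - eps) * N%:R <= #|G|%:R, 0 < eps <= 1 / 100,
      [/\ 0 <= eta2, 0 <= B2 & 2 * eps * eta2 <= B2]
    & forall w, capped_simplex G ((1 - 3 * eps) * N%:R) w -> forall x,
      `|\sum_(i in G) w i * dot (Y i) x ^+ 2 - eta2 * dot x x|
        <= B2 * dot x x].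

Lemma stable_sampleP : stable_sample ->
  [/\ 0 < N%:R :> R, (1 - eps) * N%:R <= #|G|%:R, 0 < eps, eps <= 1 / 100
    & [/\ 0 <= eta2, 0 <= B2 & 2 * eps * eta2 <= B2]].
Proof. by case=> N0 cG /andP[e0 e1] h _; split; rewrite ?ltr0n. Qed.

Lemma stable_weighted w (W : R) : stable_sample -> (forall i, 0 <= w i <= 1) ->
  W = \sum_(i in G) w i -> (1 - 3 * eps) * N%:R <= W -> forall x,
  W * (eta2 - B2) * dot x x <= \sum_(i in G) w i * dot (Y i) x ^+ 2 <=
  W * (eta2 + B2) * dot x x.
Proof.
move=> SS w01 eW hW x; have [n0 cardG eps0 eps1 [eta20 B20 eta2B2]] := stable_sampleP SS.
have e3 : 0 < 1 - 3 * eps by lra.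
have W0 : 0 < W by exact: (lt_le_trans (mulr_gt0 e3 n0) hW).

have [_ _ _ _ stable] := SS.
have c0 := mulr_gt0 e3 n0.
pose w' i := if i \in G then w i / W else 0.
have cw : capped_simplex G ((1 - 3 * eps) * N%:R) w'.
  split; first split.
  - move=> i; rewrite /w'; case: ifP => // _.
    by rewrite divr_ge0 ?(ltW W0) //; case/andP: (w01 i).
  - rewrite -big_mkcond /= -mulr_suml -eW; field; lra.
  - by move=> i /negbTE; rewrite /w' => ->.
  - move=> i; rewrite /w' div1r; case: ifP => _; last by rewrite invr_ge0 (ltW c0).
    rewrite ler_pdivrMr // (le_trans _ (_ : 1 <= _)) //.
      by case/andP: (w01 i).
    by rewrite mulrC ler_pdivlMr // mul1r.
have := stable _ cw x.
have -> : \sum_(i in G) w' i * dot (Y i) x ^+ 2 =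
          (\sum_(i in G) w i * dot (Y i) x ^+ 2) / W.
  rewrite mulr_suml; apply: eq_bigr => i iG; rewrite /w' iG; ring.
set S := \sum_(i in G) _; rewrite ler_distl => /andP[h1 h2].
apply/andP; split.
  by move: h1; rewrite ler_pdivlMr //; lra.
by move: h2; rewrite ler_pdivrMr //; lra.
Qed.

(** The invariant of filtering. Bad points cannot lose more than [eps N], hence neither can good
    ones, and the good weight stays above [(1 - 2 eps) N], within the slack [3 eps] of the stability
    condition. *)
Definition valid w := (forall i, 0 <= w i <= 1) /\
  \sum_(i in G) (1 - w i) <= \sum_(i in ~: G) (1 - w i).

Lemma sum_setC (f : 'I_N -> R) :
  \sum_i f i = \sum_(i in G) f i + \sum_(i in ~: G) f i.
Proof.
by rewrite (bigID (mem G)) /=; congr (_ + _); apply: eq_bigl => i; rewrite inE.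
Qed.

Lemma card_bad : stable_sample -> #|~: G|%:R <= eps * N%:R :> R.
Proof.
move=> SS; have [n0 cardG eps0 eps1 [eta20 B20 eta2B2]] := stable_sampleP SS.
have := cardsC G; rewrite card_ord => e.
have : #|G|%:R + #|~: G|%:R = N%:R :> R by rewrite -natrD e.
lra.
Qed.

Lemma card_good_le : #|G|%:R <= N%:R :> R.
Proof. by rewrite ler_nat -[leqRHS]card_ord max_card. Qed.

Lemma valid_mass w : stable_sample -> valid w ->
  (1 - 2 * eps) * N%:R <= \sum_(i in G) w i <= N%:R.
Proof.
move=> SS [w01 hw]; have [n0 cardG eps0 eps1 [eta20 B20 eta2B2]] := stable_sampleP SS.
have hb : \sum_(i in ~: G) (1 - w i) <= eps * N%:R.
  apply: le_trans (card_bad SS); rewrite -sum1_card natr_sum; apply: ler_sum => i _.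
  by have := w01 i; lra.
have : \sum_(i in G) (1 - w i) = #|G|%:R - \sum_(i in G) w i.
  by rewrite sumrB sumr_const.
have : \sum_(i in G) w i <= \sum_(i in G) 1.
  by apply: ler_sum => i _; have := w01 i; lra.
rewrite sumr_const; have := card_good_le; lra.
Qed.

(** Origin of the shift in [gram]: as the good weight is at least [(1 - 2 eps) N], dividing by [N]
    costs a further [2 eps eta2 <= B2] on the lower side. *)
Lemma good_moment w x : stable_sample -> valid w ->
  (eta2 - 2 * B2) * dot x x <= \sum_(i in G) w i / N%:R * dot (Y i) x ^+ 2 <=
  (eta2 + B2) * dot x x.
Proof.
move=> SS vw; have [n0 cardG eps0 eps1 [eta20 B20 eta2B2]] := stable_sampleP SS.
have /andP[m1 m2] := valid_mass SS vw.
have x0 := dotxx_ge0 x.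
have m3 : (1 - 3 * eps) * N%:R <= \sum_(i in G) w i.
  by apply: le_trans m1; rewrite ler_wpM2r ?(ltW n0) //; lra.
have /andP[] := stable_weighted SS vw.1 erefl m3 x.
have -> : \sum_(i in G) w i / N%:R * dot (Y i) x ^+ 2 =
          (\sum_(i in G) w i * dot (Y i) x ^+ 2) / N%:R.
  by rewrite mulr_suml; apply: eq_bigr => i _; ring.
have : 0 <= \sum_(i in G) w i * dot (Y i) x ^+ 2.
  by apply: sumr_ge0 => i _; rewrite mulr_ge0 ?sqr_ge0 //; case/andP: (vw.1 i).
set S := \sum_(i in G) _; set W := \sum_(i in G) _ in m1 m2 *.
move=> S0 h1 h2; apply/andP; split; last first.
  rewrite ler_pdivrMr //; apply: (le_trans h2).
  rewrite [leRHS]mulrC mulrA ler_wpM2r // ler_wpM2r //; lra.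
(* The lower bound on the mass helps only when [eta2 - B2] is nonnegative; if the shift is not
   positive, nonnegativity of the sum suffices. *)
rewrite ler_pdivlMr //; have [lt|le] := leP (eta2 - 2 * B2) 0.
  by apply: le_trans S0; rewrite pmulr_lle0 // mulr_le0_ge0.
apply: le_trans h1; rewrite mulrAC ler_wpM2r //.
have : (1 - 2 * eps) * N%:R * (eta2 - B2) <= W * (eta2 - B2).
  by rewrite ler_wpM2r //; lra.
move=> h; apply: le_trans h; rewrite [leRHS]mulrAC ler_wpM2r ?(ltW n0) //.
have : 0 <= eps * B2 by rewrite mulr_ge0 // ltW.
lra.
Qed.

Lemma good_moment_congr w M : stable_sample -> valid w ->
  (eta2 - 2 * B2) * \tr (M * M^T) <= \sum_(i in G) w i / N%:R * congr_score M i
  <= (eta2 + B2) * \tr (M * M^T).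
Proof.
move=> SS vw; under eq_bigr => i _ do rewrite congr_scoreE mulr_sumr.
rewrite exchange_big /= trace_rows !mulr_sumr.
by apply/andP; split; apply: ler_sum => j _; case/andP: (good_moment (row j M^T) SS vw).
Qed.

Lemma psd_gram w : stable_sample -> valid w -> psd (gram w).
Proof.
move=> SS vw; have [n0 cardG eps0 eps1 [eta20 B20 eta2B2]] := stable_sampleP SS.
split=> [|x]; first exact: gram_sym.
rewrite dot_gram (bigID (mem G)) /=.
have /andP[] := good_moment x SS vw; rewrite -[X in _ - X]addr0.
have : 0 <= \sum_(i | i \notin G) w i / N%:R * (dot (Y i) x * dot (Y i) x).
  apply: sumr_ge0 => i _; rewrite -expr2 mulr_ge0 ?sqr_ge0 //.
  by rewrite divr_ge0 ?(ltW n0) //; case/andP: (vw.1 i).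
lra.
Qed.

Lemma psd_gramB w w' : (0 < N)%N ->
  (forall i, w' i <= w i) -> psd (gram w - gram w').
Proof.
move=> N0 le; have n0 : 0 < N%:R :> R by rewrite ltr0n.
split=> [|x]; first by rewrite linearB /= !gram_sym.
have -> : dot (x *m (gram w - gram w')) x =
    \sum_i (w i - w' i) / N%:R * dot (Y i) x ^+ 2.
  rewrite mulmxBr dotDl dotNl !dot_gram opprB addrA addrNK -sumrB.
  by apply: eq_bigr => i _; ring.
apply: sumr_ge0 => i _.
by rewrite mulr_ge0 ?sqr_ge0 // divr_ge0 ?(ltW n0) // subr_ge0.
Qed.

(** Subtract the lower stability bound for [G :\: S] from the upper one for [G]: the [eta2] terms
    differ by [#|S| eta2 <= 2 eps N eta2 <= N B2], and the errors add at most [2 N B2]. The slack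
    [3 eps] is what [G :\: S] needs. *)
Lemma good_subset_score (S : {set 'I_N}) u : stable_sample -> S \subset G ->
  #|S|%:R <= 2 * eps * N%:R ->
  \sum_(i in S) dot (Y i) u ^+ 2 <= 3 * N%:R * B2 * dot u u.
Proof.
move=> SS SG cS; have [n0 cardG eps0 eps1 [eta20 B20 eta2B2]] := stable_sampleP SS.
have u0 := dotxx_ge0 u.
pose wS (T : {set 'I_N}) i : R := (i \in T)%:R.
have sT (T : {set 'I_N}) (f : 'I_N -> R) : T \subset G ->
    \sum_(i in G) wS T i * f i = \sum_(i in T) f i.
  move=> TG; rewrite [LHS](big_setID T) /= [X in _ + X]big1 ?addr0.
    by rewrite (finset.setIidPr TG); apply: eq_bigr => i iT; rewrite /wS iT mul1r.
  by move=> i; rewrite inE /wS => /andP[/negbTE-> _]; rewrite mul0r.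
have w01 T i : 0 <= wS T i <= 1 by rewrite /wS; case: (i \in T); rewrite !lexx ler01.
have mT (T : {set 'I_N}) : T \subset G -> #|T|%:R = \sum_(i in G) wS T i.
  move=> TG; under eq_bigr => i _ do rewrite -[wS T i]mulr1.
  by rewrite sT // sumr_const.
have cGS : #|G :\: S|%:R = #|G|%:R - #|S|%:R :> R.
  have := cardsID S G; rewrite (finset.setIidPr SG) => <-; rewrite natrD; lra.
have en0 : 0 <= eps * N%:R by rewrite mulr_ge0 // ltW.
have hG : (1 - 3 * eps) * N%:R <= #|G|%:R by lra.
have hS : (1 - 3 * eps) * N%:R <= #|G :\: S|%:R by rewrite cGS; lra.
have /andP[_] := stable_weighted SS (w01 G) (mT G (subxx _)) hG u.
have /andP[+ _] := stable_weighted SS (w01 _) (mT _ (finset.subsetDl G S)) hS u.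
rewrite !sT ?finset.subsetDl // [X in _ -> X <= _ -> _](big_setID S) /= (finset.setIidPr SG) cGS.
set a := \sum_(i in S) _; set b := \sum_(i in _ :\: _) _ => h1 h2.
have cG := card_good_le.
have s0 : 0 <= #|S|%:R :> R by [].
have e1 : (2 * eps * eta2) * N%:R <= B2 * N%:R by rewrite ler_wpM2r // ltW.
have e2 : #|S|%:R * eta2 <= 2 * eps * N%:R * eta2 by rewrite ler_wpM2r.
have e3 : #|G|%:R * B2 <= N%:R * B2 by rewrite ler_wpM2r.
have e4 : 0 <= #|S|%:R * B2 by rewrite mulr_ge0.
have : (#|S|%:R * eta2 + (2 * #|G|%:R - #|S|%:R) * B2) * dot u u <=
   3 * N%:R * B2 * dot u u by rewrite ler_wpM2r //; lra.
lra.
Qed.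

Lemma card_subset_of (S : {set 'I_N}) m : (m <= #|S|)%N ->
  exists2 T : {set 'I_N}, T \subset S & #|T| = m.
Proof.
move=> mS; exists [set i in take m (enum S)].
  by apply/fintype.subsetP => i; rewrite inE => /mem_take; rewrite mem_enum.
rewrite cardsE (card_uniqP _) ?take_uniq ?enum_uniq // size_take -cardE.
by case: ltngtP mS.
Qed.

Lemma tail_score_ge0 u i : 0 <= tail_score u i.
Proof. by rewrite /tail_score; case: ifP => // _; rewrite sqr_ge0. Qed.

Lemma tail_score_le u i : tail_score u i <= dot (Y i) u ^+ 2.
Proof. by rewrite /tail_score; case: ifP => // _; rewrite sqr_ge0. Qed.

(* A tail of more than [2 eps N] good points would contain a subset of about
   that size violating [good_subset_score]. *)
Lemma good_tail_score u : stable_sample -> 1 <= eps * N%:R ->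
  \sum_(i in G) tail_score u i <= 3 * N%:R * B2 * dot u u.
Proof.
move=> SS eN1; have [n0 cardG eps0 eps1 [eta20 B20 eta2B2]] := stable_sampleP SS.
have u0 := dotxx_ge0 u.
pose c := 6 * B2 * dot u u / eps.
pose S := [set i in G | c < dot (Y i) u ^+ 2].
have SG : S \subset G by apply/fintype.subsetP => i; rewrite inE => /andP[].
have -> : \sum_(i in G) tail_score u i = \sum_(i in S) dot (Y i) u ^+ 2.
  rewrite [RHS](eq_bigl (fun i => (i \in G) && (c < dot (Y i) u ^+ 2))).
    by rewrite big_mkcondr.
  by move=> i; rewrite inE.
have [hS|hS] := leP #|S|%:R (2 * eps * N%:R); first exact: good_subset_score.
have t0 : 0 <= 2 * eps * N%:R by lra.
have /andP[m1 m2] := truncn_itv t0.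
set m := Num.truncn _ in m1 m2.
have mS : (m <= #|S|)%N by rewrite -(ler_nat R); lra.
have [T TS cT] := card_subset_of mS.
have hT := good_subset_score u SS (fintype.subset_trans TS SG).
rewrite cT in hT; have {}hT := hT m1.
have cT1 : m%:R * c <= \sum_(i in T) dot (Y i) u ^+ 2.
  rewrite -cT mulr_natl -sumr_const; apply: ler_sum => i /(fintype.subsetP TS).
  by rewrite inE => /andP[_ /ltW].
(* Rounding [2 eps N] down loses less than one, which [1 <= eps N] absorbs. *)
have mN : eps * N%:R <= m%:R by move: m2; rewrite -natr1; lra.
have c0 : 0 <= c by rewrite /c divr_ge0 ?(ltW eps0) // !mulr_ge0.
have cN : eps * N%:R * c = 6 * (N%:R * B2 * dot u u) by rewrite /c; field; lra.
have : eps * N%:R * c <= m%:R * c by rewrite ler_wpM2r.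
have NB0 : 0 <= N%:R * B2 * dot u u by rewrite !mulr_ge0 // ltW.
(* Six times [N B2 |u|^2] is at most three times the same quantity, so it is zero; the case of
   singletons then makes all good scores vanish. *)
rewrite cN => h6; have z0 : N%:R * B2 * dot u u = 0 by lra.
have all0 i : i \in G -> dot (Y i) u ^+ 2 <= 0.
  move=> iG; have := @good_subset_score [set i] u SS.
  rewrite finset.sub1set cards1 big_set1 => /(_ iG).
  have -> : 3 * N%:R * B2 * dot u u = 3 * (N%:R * B2 * dot u u) by ring.
  by rewrite z0 mulr0; apply; lra.
have -> : 3 * N%:R * B2 * dot u u = 3 * (N%:R * B2 * dot u u) by ring.
rewrite z0 mulr0; apply: sumr_le0 => i iS.
by apply: all0; apply: (fintype.subsetP SG).
Qed.

(** A search that moves has just left a value above [thr], and one trial at most halves [f]. *)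
Lemma damping_spec (f : R -> R) thr k0 n k : 0 <= k0 -> 0 <= k ->
  (forall k, 0 <= k -> f k <= 2 * f (k + k + k0)) ->
  let r := damping f thr k0 n k in 0 <= r /\ (r = k \/ thr / 2 <= f r).
Proof.
move=> k00 + hf; elim: n k => [|n IH] k kge /=; first by split=> //; left.
case: ifPn => [_|]; first by split=> //; left.
rewrite -ltNge => hk; have k' : 0 <= k + k + k0 by rewrite !addr_ge0.
have [r0 hr] := IH _ k'; split=> //; right; case: hr => // ->.
by rewrite ler_pdivrMr // mulrC; apply: le_trans (ltW hk) _; apply: hf.
Qed.

Lemma damping_stop (f : R -> R) thr k0 bound n k : 0 <= k0 ->
  (forall k, bound <= k -> f k <= thr) -> bound + k0 <= 2 ^+ n * (k + k0) ->
  f (damping f thr k0 n k) <= thr.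
Proof.
move=> k00 hf; elim: n k => [|n IH] k /=.
  by rewrite expr0 mul1r lerD2r; apply: hf.
rewrite exprSr => h; case: ifP => // _; apply: IH.
by apply: le_trans h _; rewrite -mulrA ler_wpM2l ?exprn_ge0 //; lra.
Qed.

Definition capped w := forall i, w i != 0 -> dot (Y i) (Y i) <= norm_cap.

Section Damped.
Variables (w tau : 'I_N -> R).

(** When [k0 tau <= 1], a trial at most doubles each denominator:
    [1 + (2 k + k0) tau <= 2 (1 + k tau)]. *)
Lemma damped_sum_half (k0 k : R) : (forall i, 0 <= w i) ->
  (forall i, 0 <= tau i) -> (forall i, w i != 0 -> k0 * tau i <= 1) ->
  0 <= k0 -> 0 <= k -> damped_sum w tau k <= 2 * damped_sum w tau (k + k + k0).
Proof.
move=> w0 t0 h k00 kge; rewrite /damped_sum mulr_sumr; apply: ler_sum => i _.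
have [->|wi] := eqVneq (w i) 0; first by rewrite !mul0r mulr0.
have kt : 0 <= k * tau i by rewrite mulr_ge0.
have k0t : 0 <= k0 * tau i by rewrite mulr_ge0.
have p1 : 0 < 1 + k * tau i by lra.
have p2 : 0 < 1 + (k + k + k0) * tau i by rewrite !mulrDl; lra.
rewrite ler_pdivrMr //.
have -> : 2 * (w i * tau i / (1 + (k + k + k0) * tau i)) * (1 + k * tau i) =
  w i * tau i * (2 * (1 + k * tau i)) / (1 + (k + k + k0) * tau i) by ring.
rewrite ler_pdivlMr // ler_wpM2l ?mulr_ge0 //.
by have := h _ wi; rewrite !mulrDl; lra.
Qed.

Lemma damped_sum_le (k : R) : (forall i, 0 <= w i <= 1) ->
  (forall i, 0 <= tau i) -> 0 < k -> damped_sum w tau k <= N%:R / k.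
Proof.
move=> w01 t0 k0; rewrite /damped_sum.
have -> : N%:R / k = \sum_(i < N) k^-1 by rewrite sumr_const card_ord mulr_natl.
apply: ler_sum => i _; have kt : 0 <= k * tau i by rewrite mulr_ge0 // ltW.
have /andP[wi0 wi1] := w01 i.
rewrite ler_pdivrMr; last lra.
have -> : k^-1 * (1 + k * tau i) = k^-1 + tau i by field; lra.
have : 0 < k^-1 by rewrite invr_gt0.
have : w i * tau i <= 1 * tau i by rewrite ler_wpM2r.
lra.
Qed.

End Damped.

Lemma fuel_of_exp : (N.+1%:R : R) ^+ 2 <= 2 ^+ fuel_of.
Proof.
rewrite /fuel_of -muln2 exprM lerXn2r ?nnegrE ?exprn_ge0 //.
by rewrite -natrX ler_nat trunc_log_ltn.
Qed.

Lemma tail_score_cap w u i : capped w -> w i != 0 ->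
  tail_score u i <= norm_cap * dot u u.
Proof.
move=> cw wi; apply: le_trans (tail_score_le u i) _.
by apply: le_trans (dot_CS _ _) _; rewrite ler_wpM2r ?dotxx_ge0 ?cw.
Qed.

(** From [2 eps eta2 <= B2] and [1 <= eps N] follows [2 eta2 <= N B2]: the ratio of the two scales
    is polynomial in [N]. This keeps the damping search and the number of rounds polylogarithmic. *)
Lemma norm_cap_le : stable_sample -> 1 <= eps * N%:R ->
  norm_cap <= 12 * B2 * (N.+1%:R ^+ 2 - 1).
Proof.
move=> SS eN1; have [n0 cardG eps0 eps1 [eta20 B20 eta2B2]] := stable_sampleP SS.
have h : eta2 * 2 <= B2 * N%:R.
  have : (2 * eps * eta2) * N%:R <= B2 * N%:R by rewrite ler_wpM2r // ltW.
  have : 1 * (2 * eta2) <= eps * N%:R * (2 * eta2) by rewrite ler_wpM2r // mulr_ge0.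
  lra.
rewrite /norm_cap -natr1.
have : N%:R * (eta2 * 2) <= N%:R * (B2 * N%:R) by rewrite ler_wpM2l // ltW.
have : 0 <= N%:R * B2 by rewrite mulr_ge0 // ltW.
have : 0 <= N%:R * B2 * N%:R by rewrite !mulr_ge0 // ltW.
lra.
Qed.

Lemma damp_spec w u : stable_sample -> 1 <= eps * N%:R -> 0 < B2 ->
  valid w -> capped w ->
  [/\ 0 <= damp w u,
      damped_sum w (tail_score u) (damp w u) <= 12 * N%:R * B2 * dot u u
    & damp w u = 0 \/
      6 * N%:R * B2 * dot u u <= damped_sum w (tail_score u) (damp w u)].
Proof.
move=> SS eN1 B2p vw cw.
have [n0 cardG eps0 eps1 [eta20 B20 eta2B2]] := stable_sampleP SS.
have u0 := dotxx_ge0 u.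
have cap0 : 0 < norm_cap by rewrite /norm_cap mulr_gt0 //; lra.
set k0 := 1 / (norm_cap * dot u u).
have k00 : 0 <= k0 by rewrite divr_ge0 // mulr_ge0 // ltW.
have w0 i : 0 <= w i by case/andP: (vw.1 i).
have kt i : w i != 0 -> k0 * tail_score u i <= 1.
  move=> wi; have h := tail_score_cap u cw wi.
  (* For [u = 0] the division by zero yields [k0 = 0]. *)
  have [U0|U0] := eqVneq (dot u u) 0.
    by rewrite /k0 U0 mulr0 invr0 mulr0 mul0r.
  have Up : 0 < norm_cap * dot u u by rewrite mulr_gt0 // lt_neqAle eq_sym U0.
  by rewrite /k0 mul1r mulrC ler_pdivrMr // mul1r.
have [r0 hr] := @damping_spec (damped_sum w (tail_score u))
  (12 * N%:R * B2 * dot u u) k0 fuel_of 0 k00 (lexx _)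
  (fun k => damped_sum_half w0 (tail_score_ge0 u) kt k00).
rewrite -/(damp w u) in r0 hr *.
split=> //; last by case: hr => [->|h]; [left|right] => //; lra.
have [U0|U0] := eqVneq (dot u u) 0.
  rewrite U0 mulr0 /damped_sum big1 // => i _.
  have [->|wi] := eqVneq (w i) 0; first by rewrite !mul0r.
  have := tail_score_cap u cw wi; rewrite U0 mulr0 => t0.
  have -> : tail_score u i = 0 by apply/eqP; rewrite eq_le t0 tail_score_ge0.
  by rewrite mulr0 mul0r.
have Up : 0 < dot u u by rewrite lt_neqAle eq_sym U0.
have Up' : 0 < norm_cap * dot u u by rewrite mulr_gt0.
have BU : 0 < 12 * B2 * dot u u by rewrite !mulr_gt0.
(* From this [k] on, the bound [N / k] on the damped sum is below the target. *)
apply: (@damping_stop _ _ _ (1 / (12 * B2 * dot u u))) => // [k hk|].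
  have kp : 0 < k by apply: lt_le_trans hk; rewrite divr_gt0.
  apply: le_trans (damped_sum_le vw.1 (tail_score_ge0 u) kp) _.
  rewrite ler_pdivrMr //.
  have : N%:R * (12 * B2 * dot u u * (1 / (12 * B2 * dot u u))) <=
         N%:R * (12 * B2 * dot u u * k).
    by rewrite ler_wpM2l ?(ltW n0) // ler_wpM2l // ltW.
  rewrite mul1r divff ?gt_eqF //; lra.
rewrite add0r -lerBrDr -[X in _ - X]mul1r -mulrBl /k0 mulrA mulr1.
rewrite ler_pdivrMr // mulrAC ler_pdivlMr // mul1r.
have := norm_cap_le SS eN1; have := fuel_of_exp.
move=> h1 h2; have h3 : norm_cap * dot u u <= 12 * B2 * (N.+1%:R ^+ 2 - 1) * dot u u.
  by rewrite ler_wpM2r.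
have : 12 * B2 * dot u u * (N.+1%:R ^+ 2) <= 12 * B2 * dot u u * 2 ^+ fuel_of.
  by rewrite ler_wpM2l // ltW.
lra.
Qed.

(** The weight lost at a point is [k] times its remaining tail score. In units of [N B2 |u|^2]: if
    anything is lost, at least 6 remain, of which the good points hold at most 3, so the bad points
    lose at least as much. At most 12 units of tail score and 6 below the cut-off make the 18. *)
Lemma downweight_spec w u : stable_sample -> 1 <= eps * N%:R -> 0 < B2 ->
  valid w -> capped w ->
  [/\ valid (downweight w u), capped (downweight w u),
      forall i, downweight w u i <= w i
    & \sum_(i in ~: G) downweight w u i * dot (Y i) u ^+ 2 <=
      18 * N%:R * B2 * dot u u].
Proof.
move=> SS eN1 B2p vw cw.
have [n0 cardG eps0 eps1 [eta20 B20 eta2B2]] := stable_sampleP SS.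
have [k0 hle hge] := damp_spec u SS eN1 B2p vw cw.
set k := damp w u in k0 hle hge.
have kt i : 0 <= k * tail_score u i by rewrite mulr_ge0 ?tail_score_ge0.
have w01 i : 0 <= downweight w u i <= w i.
  have /andP[h0 h1] := vw.1 i; rewrite /downweight -/k.
  have kp : 0 < 1 + k * tail_score u i by have := kt i; lra.
  rewrite divr_ge0 // ?(ltW kp) //= ler_pdivrMr // ler_peMr //; have := kt i; lra.
have w'1 i : 0 <= downweight w u i <= 1 by have := w01 i; have := vw.1 i; lra.
have loss i : w i = downweight w u i + k * (downweight w u i * tail_score u i).
  rewrite /downweight -/k; field; have := kt i; lra.
have sumE : damped_sum w (tail_score u) k = \sum_i downweight w u i * tail_score u i.
  by apply: eq_bigr => i _; rewrite /downweight -/k; ring.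
have s0 (P : pred 'I_N) : 0 <= \sum_(i | P i) downweight w u i * tail_score u i.
  by apply: sumr_ge0 => i _; rewrite mulr_ge0 ?tail_score_ge0 //; case/andP: (w01 i).
have sG : \sum_(i in G) downweight w u i * tail_score u i <= 3 * N%:R * B2 * dot u u.
  apply: le_trans (good_tail_score u SS eN1); apply: ler_sum => i _.
  by rewrite ler_piMl ?tail_score_ge0 //; have := w'1 i; lra.
have sC : \sum_i downweight w u i * tail_score u i =
    \sum_(i in G) downweight w u i * tail_score u i +
    \sum_(i in ~: G) downweight w u i * tail_score u i by exact: sum_setC.
split.
- split=> //.
  have e (P : pred 'I_N) : \sum_(i | P i) (1 - downweight w u i) = \sum_(i | P i) (1 - w i) +
      k * \sum_(i | P i) downweight w u i * tail_score u i.
    by rewrite mulr_sumr -big_split; apply: eq_bigr => i _; rewrite [in RHS]loss /=; ring.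
  rewrite !e lerD //; first by case: vw.
  have [->|h] := hge; first by rewrite !mul0r.
  by rewrite ler_wpM2l //; move: h; rewrite sumE sC; lra.
- move=> i; have [w0|wi _] := eqVneq (w i) 0; last exact: cw.
  by rewrite /downweight w0 mul0r eqxx.
- by move=> i; case/andP: (w01 i).
have u0 := dotxx_ge0 u.
have c0 : 0 <= 6 * B2 * dot u u / eps by rewrite divr_ge0 ?(ltW eps0) // !mulr_ge0.
have : \sum_(i in ~: G) downweight w u i * dot (Y i) u ^+ 2 <=
   \sum_(i in ~: G) (downweight w u i * tail_score u i + 6 * B2 * dot u u / eps).
  apply: ler_sum => i _; have /andP[h0 h1] := w'1 i.
  rewrite /tail_score; case: ifPn => [_|]; first by rewrite lerDl.
  rewrite -leNgt mulr0 add0r => h; apply: le_trans h.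
  by rewrite ler_piMl // sqr_ge0.
rewrite big_split /= sumr_const -mulr_natl => h.
have hb : #|~: G|%:R * (6 * B2 * dot u u / eps) <=
          eps * N%:R * (6 * B2 * dot u u / eps).
  by rewrite ler_wpM2r // card_bad.
have e : eps * N%:R * (6 * B2 * dot u u / eps) = 6 * N%:R * B2 * dot u u.
  by field; lra.
have := s0 (mem G); move: h hle; rewrite sumE sC; lra.
Qed.

(** * Expected contraction of the potential in one round *)

Section Contraction.
Variable K : nat.
Hypothesis K0 : (0 < K)%N.

Let p := (2 ^ K.-1)%N.
Let q := (2 ^ K)%N.

Definition sign_row (om : nat -> bool) : 'rV[R]_d := \row_j sgnc R (om j).

Definition potential w : R := \tr (gram w ^+ q.+1).

Definition step w om := downweight w (sign_row om *m gram w ^+ p).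

Definition theta : R := 180 * B2.
Definition threshold : R := d%:R * theta ^+ q.+1.

(** Cutting the potential off at its target removes the additive term from the recursion, so that
    the expectation decays geometrically; and a nonzero value exceeds [threshold], which is what
    Markov's inequality needs. *)
Definition excess w : R := if threshold < potential w then potential w else 0.

Lemma qE : q = (p + p)%N.
Proof. by rewrite /q /p addnn -mul2n -expnS prednK. Qed.

Lemma q_even : ~~ odd (1 + 2 ^ K).-1.
Proof. by rewrite add1n /= -/q qE addnn odd_double. Qed.

Lemma avg_sign_dot2 (v : 'rV[R]_d) :
  avg d (fun om => dot v (sign_row om) ^+ 2) = dot v v.
Proof.
pose a j := if insub j is Some o then v 0 o else 0.
have e om : dot v (sign_row om) = \sum_(0 <= j < d) sgnc R (om j) * a j.
  rewrite big_mkord; apply: eq_bigr => j _.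
  by rewrite mxE mulrC /a valK.
under eq_avg => om do rewrite e.
rewrite avg_rademacher2 big_mkord; apply: eq_bigr => j _.
by rewrite /a valK expr2.
Qed.

Lemma avg_sign_dot4 (v : 'rV[R]_d) :
  avg d (fun om => dot v (sign_row om) ^+ 4) <= 3 * dot v v ^+ 2.
Proof.
pose a j := if insub j is Some o then v 0 o else 0.
have e om : dot v (sign_row om) = \sum_(0 <= j < d) sgnc R (om j) * a j.
  rewrite big_mkord; apply: eq_bigr => j _.
  by rewrite mxE mulrC /a valK.
rewrite (eq_avg d (f2 := fun om => (\sum_(0 <= j < d) sgnc R (om j) * a j) ^+ 4)).
  apply: le_trans (avg_rademacher4 d a) _; rewrite big_mkord.
  rewrite (eq_bigr (fun j => v 0 j * v 0 j)) => [//|j _].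
  by rewrite /a valK expr2.
by move=> om; rewrite e.
Qed.

Lemma gram_expq w : gram w ^+ q = gram w ^+ p * (gram w ^+ p)^T.
Proof. by rewrite trmx_exp gram_sym -exprD -qE. Qed.

Lemma potential_le_trace w w' : stable_sample -> valid w -> valid w' ->
  (forall i, w' i <= w i) ->
  potential w' <= \tr (gram w' * gram w ^+ q).
Proof.
move=> SS vw vw' le; rewrite /potential -add1n -[X in _ <= \tr (X * _)]expr1.
apply: trace_exp_mono q_even; try exact: psd_gram.
by apply: psd_gramB => //; case: SS.
Qed.

Lemma trace_gram_split w w' : stable_sample -> valid w' ->
  \tr (gram w' * gram w ^+ q) <= 3 * B2 * \tr (gram w ^+ q) +
    \sum_(i in ~: G) w' i / N%:R * congr_score (gram w ^+ p) i.
Proof.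
move=> SS vw'; rewrite gram_expq trace_gram sum_setC.
have /andP[_] := good_moment_congr (gram w ^+ p) SS vw'.
lra.
Qed.

Lemma bad_trace_le w : stable_sample -> valid w ->
  \sum_(i in ~: G) w i / N%:R * congr_score (gram w ^+ p) i <= potential w.
Proof.
move=> SS vw; rewrite /potential exprS gram_expq trace_gram sum_setC.
have /andP[+ _] := good_moment_congr (gram w ^+ p) SS vw.
lra.
Qed.

Lemma potential_step_le w om : stable_sample -> 1 <= eps * N%:R -> 0 < B2 ->
  valid w -> capped w -> potential (step w om) <= potential w.
Proof.
move=> SS eN1 B2p vw cw.
have [vw' _ le _] := downweight_spec (sign_row om *m gram w ^+ p) SS eN1 B2p vw cw.
apply: le_trans (potential_le_trace SS vw vw' le) _.
have N0 : (0 < N)%N by case: SS.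
have := trace_congr_ge0 ((gram w ^+ p)^T) (psd_gramB N0 le).
rewrite trmxK mxtraceC mulrA -gram_expq mxtraceC mulrBl linearB /= subr_ge0.
by rewrite /potential exprS.
Qed.

(* [T] is the true and [t] the sketched score of a point: the sketch may miss
   the point, but then its second and fourth moments still control the loss. *)
Lemma sketch_bound (w w' T t : R) : 0 <= w' <= w -> 0 <= T -> 0 <= t ->
  (T = 0 -> t = 0) ->
  w' * T <= 2 / 3 * (w' * t) + w * (T - 2 / 3 * t + t ^+ 2 / T / 9).
Proof.
move=> /andP[w0 le] T0 t0; have [->|Tn0] := eqVneq T 0.
  by move=> /(_ erefl)->; rewrite expr0n /= !(mul0r, mulr0, subr0, addr0).
have -> : T - 2 / 3 * t + t ^+ 2 / T / 9 = (T - t / 3) ^+ 2 / T by field.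
have h : T - 2 / 3 * t <= (T - t / 3) ^+ 2 / T.
  rewrite ler_pdivlMr ?lt_neqAle ?(eq_sym 0) ?Tn0 //.
  have -> : (T - t / 3) ^+ 2 = (T - 2 / 3 * t) * T + (t / 3) ^+ 2 by field.
  by rewrite lerDl sqr_ge0.
have : w' * (T - 2 / 3 * t) <= w' * ((T - t / 3) ^+ 2 / T) by rewrite ler_wpM2l.
have : w' * ((T - t / 3) ^+ 2 / T) <= w * ((T - t / 3) ^+ 2 / T).
  by rewrite ler_wpM2r // divr_ge0 ?sqr_ge0.
lra.
Qed.

(** In expectation, with [E t = T] and [E t^2 <= 3 T^2], [sketch_bound] leaves the fraction
    [1 - 2 c + 3 c^2] of the bad trace, minimal at [c = 1 / 3] with value [2 / 3]. The 15 is 3 from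
    the good points plus two thirds of the 18 in [downweight_spec]. *)
Lemma avg_potential w : stable_sample -> 1 <= eps * N%:R -> 0 < B2 ->
  valid w -> capped w ->
  avg d (fun om => potential (step w om)) <=
  2 / 3 * potential w + 15 * B2 * \tr (gram w ^+ q).
Proof.
move=> SS eN1 B2p vw cw; set M := gram w ^+ p.
have [n0 cardG eps0 eps1 [eta20 B20 eta2B2]] := stable_sampleP SS.
pose T i := congr_score M i.
pose t om i := dot (Y i *m M) (sign_row om) ^+ 2.
pose U om := dot (sign_row om *m M) (sign_row om *m M).
have MT : M^T = M by rewrite trmx_exp gram_sym.
have tE om i : t om i = dot (Y i) (sign_row om *m M) ^+ 2.
  by rewrite /t dot_mulmxr MT.
have ptw om : potential (step w om) <= 3 * B2 * \tr (gram w ^+ q) +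
   (12 * B2 * U om + \sum_(i in ~: G) (w i / N%:R * T i +
      (- (w i / N%:R * (2 / 3)) * t om i +
      w i / N%:R * (T i)^-1 / 9 * dot (Y i *m M) (sign_row om) ^+ 4))).
  have [vw' _ le hb] := downweight_spec (sign_row om *m M) SS eN1 B2p vw cw.
  apply: le_trans (potential_le_trace SS vw vw' le) _.
  apply: le_trans (trace_gram_split w SS vw') _; rewrite lerD2l.
  set w' := downweight w _ in vw' le hb *.
  have h : \sum_(i in ~: G) w' i / N%:R * t om i <= 18 * B2 * U om.
    under eq_bigr => i _ do rewrite tE mulrAC.
    rewrite -mulr_suml ler_pdivrMr //; apply: le_trans hb _.
    by rewrite /U; lra.
  (* The remainder carries the old weight [w], which does not depend on the coins and so can be
     averaged; the term with [w'] is bounded for every outcome by [h]. *)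
  apply: le_trans (_ : \sum_(i in ~: G) (2 / 3 * (w' i / N%:R * t om i) +
      w i / N%:R * (T i - 2 / 3 * t om i + t om i ^+ 2 / T i / 9)) <= _).
    apply: ler_sum => i _; apply: sketch_bound; rewrite ?sqr_ge0 ?congr_score_ge0 //.
      rewrite divr_ge0 ?(ltW n0) //=; last by case/andP: (vw'.1 i).
      by rewrite ler_pM2r ?invr_gt0.
    move=> T0; apply/eqP; rewrite eq_le sqr_ge0 andbT.
    by apply: le_trans (dot_CS _ _) _; rewrite [dot _ _ in X in X * _]T0 mul0r.
  rewrite big_split /= -mulr_sumr lerD //; first by lra.
  rewrite le_eqVlt; apply/orP; left; apply/eqP.
  by apply: eq_bigr => i _; rewrite /t -exprM; ring.
apply: le_trans (ler_avg d ptw) _.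
have eU : avg d U = \tr (gram w ^+ q).
  rewrite gram_expq -/M trace_rows.
  rewrite (eq_avg d (f2 := fun om => \sum_j dot (row j M^T) (sign_row om) ^+ 2)).
    by rewrite avg_sum; apply: eq_bigr => j _; rewrite avg_sign_dot2.
  by move=> om; rewrite /U dot_mulmxE; apply: eq_bigr => j _; rewrite dotC.
rewrite avgD avg_cst avgD avgZ eU avg_sum.
suff : \sum_(i in ~: G) avg d (fun om => w i / N%:R * T i +
      (- (w i / N%:R * (2 / 3)) * t om i +
      w i / N%:R * (T i)^-1 / 9 * dot (Y i *m M) (sign_row om) ^+ 4)) <=
   2 / 3 * potential w by lra.
apply: le_trans (_ : \sum_(i in ~: G) 2 / 3 * (w i / N%:R * T i) <= _); last first.
  by rewrite -mulr_sumr ler_pM2l ?divr_gt0 // bad_trace_le.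
apply: ler_sum => i _; rewrite avgD avg_cst avgD !avgZ avg_sign_dot2.
rewrite -[dot (Y i *m M) _]/(T i).
have wi0 : 0 <= w i / N%:R by rewrite divr_ge0 ?(ltW n0) //; case/andP: (vw.1 i).
have T0 : 0 <= T i := congr_score_ge0 M i.
have c0 : 0 <= w i / N%:R * (T i)^-1 / 9 by do 2!apply: divr_ge0 => //.
have := ler_wpM2l c0 (avg_sign_dot4 (Y i *m M)); rewrite -[dot (Y i *m M) _]/(T i).
have -> : w i / N%:R * (T i)^-1 / 9 * (3 * T i ^+ 2) = w i / N%:R * T i / 3.
  have [->|Tn] := eqVneq (T i) 0; first by rewrite expr0n /= !mulr0 mul0r.
  by field; rewrite Tn /= lt0r_neq0.
lra.
Qed.

(** Above the target, [trace_exp_threshold] bounds [180 B2 tr A^q] by twice the potential, and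
    [2 / 3 + 15 * 2 / 180 = 5 / 6]. Below it, monotonicity keeps the excess at zero. *)
Lemma avg_excess w : stable_sample -> 1 <= eps * N%:R -> 0 < B2 ->
  valid w -> capped w ->
  avg d (fun om => excess (step w om)) <= 5 / 6 * excess w.
Proof.
move=> SS eN1 B2p vw cw; rewrite [X in _ <= _ * X]/excess.
have [n0 cardG eps0 eps1 [eta20 B20 eta2B2]] := stable_sampleP SS.
have th0 : 0 <= threshold.
  by rewrite mulr_ge0 // exprn_ge0 // mulr_ge0.
case: ifPn => [hp|]; last first.
  rewrite -leNgt => hp; rewrite mulr0 -[leRHS](avg_cst d); apply: ler_avg => om.
  rewrite /excess ifN // -leNgt; apply: le_trans hp.
  exact: potential_step_le.
apply: le_trans (_ : avg d (fun om => potential (step w om)) <= _).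
  apply: ler_avg => om; rewrite /excess; case: ifP => // _.
  apply: psd_trace_ge0; apply: psd_exp; apply: psd_gram => //.
  by have [] := downweight_spec (sign_row om *m gram w ^+ p) SS eN1 B2p vw cw.
apply: le_trans (avg_potential SS eN1 B2p vw cw) _.
have := @trace_exp_threshold R d (gram w) theta q (psd_gram SS vw).
rewrite -/(potential w) -/threshold {1 2}/theta mulr_ge0 // => /(_ isT); lra.
Qed.

(** The real [z] is the clock kept by the program; [fuel] bounds the number of rounds for the
    analysis only. *)
Fixpoint rounds (fuel : nat) (z : R) w om : 'I_N -> R :=
  if fuel is n.+1 then
    if z <= 1 then w else rounds n (z * 5 / 6) (step w om) (sdrop d om)
  else w.

Lemma rounds_spec fuel z w om : stable_sample -> 1 <= eps * N%:R -> 0 < B2 ->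
  valid w -> capped w ->
  valid (rounds fuel z w om) /\ capped (rounds fuel z w om).
Proof.
move=> SS eN1 B2p; elim: fuel z w om => [|n IH] z w om //= vw cw.
case: ifP => // _; apply: IH;
  by have [] := downweight_spec (sign_row om *m gram w ^+ p) SS eN1 B2p vw cw.
Qed.

Lemma excess_ge0 w : stable_sample -> valid w -> 0 <= excess w.
Proof.
move=> SS vw; rewrite /excess; case: ifP => // _.
by apply: psd_trace_ge0; apply: psd_exp; apply: psd_gram.
Qed.

Lemma avg_rounds fuel m z w : stable_sample -> 1 <= eps * N%:R -> 0 < B2 ->
  valid w -> capped w -> 0 < z -> z <= (6 / 5) ^+ fuel ->
  avg (fuel * d + m) (fun om => excess (rounds fuel z w om)) <= excess w / z.
Proof.
move=> SS eN1 B2p; elim: fuel z w => [|n IH] z w vw cw z0 hz /=.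
  rewrite avg_cst ler_pdivlMr // ler_piMr ?excess_ge0 //.
have [z1|z1] := leP z 1.
  by rewrite avg_cst ler_pdivlMr // ler_piMr ?excess_ge0.
rewrite mulSn -addnA.
have loc om1 om2 om : (forall k, (k < d)%N -> om1 k = om2 k) ->
    excess (rounds n (z * 5 / 6) (step w om1) om) =
    excess (rounds n (z * 5 / 6) (step w om2) om).
  move=> h; rewrite /step; have -> // : sign_row om1 = sign_row om2.
  by apply/rowP => j; rewrite !mxE h.
rewrite (avg_split _ loc).
have z' : 0 < z * 5 / 6 by lra.
apply: le_trans (_ : avg d (fun om => (z * 5 / 6)^-1 * excess (step w om)) <= _).
  apply: ler_avg => om; rewrite [leRHS]mulrC.
  have [vw' cw' _ _] := downweight_spec (sign_row om *m gram w ^+ p) SS eN1 B2p vw cw.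
  by apply: IH => //; move: hz; rewrite exprS; lra.
rewrite avgZ; apply: le_trans (ler_wpM2l _ (avg_excess SS eN1 B2p vw cw)) _.
  by rewrite invr_ge0 ltW.
by rewrite le_eqVlt; apply/orP; left; apply/eqP; field; lra.
Qed.

(** A direction with form above [2 theta] would give [(2 theta)^q <= tr A^q <= 2 d theta^q], against
    [2 d < 2^q]. The high power thus turns a trace bound into a norm bound without a factor [d]. *)
Lemma bad_moment_le w x : stable_sample -> 0 < B2 -> valid w ->
  excess w = 0 -> 2 * d%:R < 2 ^+ q :> R ->
  \sum_(i in ~: G) w i / N%:R * dot (Y i) x ^+ 2 <= 360 * B2 * dot x x.
Proof.
move=> SS B2p vw; rewrite /excess; have pA := psd_gram SS vw.
have th0 : 0 < theta by rewrite mulr_gt0.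
have hx : \sum_(i in ~: G) w i / N%:R * dot (Y i) x ^+ 2 <= dot (x *m gram w) x.
  rewrite dot_gram; under [X in _ <= X - _]eq_bigr => i _ do rewrite -expr2.
  rewrite (sum_setC (fun i => w i / N%:R * dot (Y i) x ^+ 2)).
  by have /andP[+ _] := good_moment x SS vw; lra.
move=> hE h2; apply: le_trans hx _; rewrite leNgt; apply/negP => hlt.
have thr0 : 0 <= threshold by rewrite mulr_ge0 // exprn_ge0 // ltW.
have hpot : potential w <= threshold.
  by rewrite leNgt; apply/negP => h; move: hE; rewrite h => e; lra.
have := trace_exp_threshold q pA (ltW th0).
rewrite -/(potential w) -/threshold => ht.
have htq : \tr (gram w ^+ q) <= 2 * d%:R * theta ^+ q.
  rewrite -(ler_pM2l th0); apply: le_trans ht _.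
  by apply: le_trans (lerD hpot (lexx _)) _; rewrite /threshold exprS; lra.
have t2 : 0 <= 2 * theta by rewrite mulr_ge0 // ltW.
have e2 : 2 * theta = 360 * B2 by rewrite /theta; ring.
have x0 := dotxx_ge0 x.
have := @dot_exp_ge R d (gram w) (2 * theta) x q pA t2; rewrite {1}e2.
move=> /(_ (ltW hlt)) h3.
have h4 : dot (x *m gram w ^+ q) x <= dot x x * \tr (gram w ^+ q).
  rewrite gram_expq; apply: le_trans (dot_mulmx_le x (gram w ^+ p)).
  by rewrite -mulmxE mulmxA -dot_mulmxr.
have h5 : dot x x * \tr (gram w ^+ q) <= dot x x * (2 * d%:R * theta ^+ q).
  by rewrite ler_wpM2l.
have xp : 0 < dot x x.
  rewrite lt_neqAle x0 andbT; apply/eqP => x00.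
  have := dot_CS (x *m gram w) x; rewrite -x00 mulr0 => h6.
  move: hlt; rewrite -x00 mulr0 => h7.
  have h8 : 0 < dot (x *m gram w) x ^+ 2 by rewrite exprn_gt0.
  lra.
have tq : 0 < theta ^+ q * dot x x by rewrite mulr_gt0 // exprn_gt0.
have : 2 * d%:R * (theta ^+ q * dot x x) < 2 ^+ q * (theta ^+ q * dot x x).
  by rewrite ltr_pM2r.
move: h3; rewrite exprMn; lra.
Qed.

(** * Initial weights and initial potential *)

Definition prune : 'I_N -> R :=
  fun i => if dot (Y i) (Y i) <= norm_cap then 1 else 0.

Lemma capped_prune : capped prune.
Proof. by move=> i; rewrite /prune; case: ifP => //; rewrite eqxx. Qed.

(** In the second moment along [Y i], the term of the point itself is already the fourth power of
    its norm. *)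
Lemma good_norm_le i : stable_sample -> i \in G -> dot (Y i) (Y i) <= norm_cap.
Proof.
move=> SS iG; have [n0 cardG eps0 eps1 [eta20 B20 eta2B2]] := stable_sampleP SS.
have c1 : (1 - 3 * eps) * N%:R <= #|G|%:R.
  by apply: le_trans cardG; rewrite ler_wpM2r ?(ltW n0) //; lra.
have s1 : #|G|%:R = \sum_(k in G) (1 : R) by rewrite sumr_const.
have w1 (k : 'I_N) : 0 <= (1 : R) <= 1 by rewrite ler01 lexx.
have /andP[_] := stable_weighted SS w1 s1 c1 (Y i).
rewrite (bigD1 i) //= mul1r => h; clear w1 s1.
have y0 := dotxx_ge0 (Y i).
have s0 : 0 <= \sum_(k in G | k != i) 1 * dot (Y k) (Y i) ^+ 2.
  by apply: sumr_ge0 => k _; rewrite mul1r sqr_ge0.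
have h2 : dot (Y i) (Y i) * dot (Y i) (Y i) <= norm_cap * dot (Y i) (Y i).
  rewrite -expr2; apply: le_trans (_ : #|G|%:R * (eta2 + B2) * dot (Y i) (Y i) <= _).
    by move: h s0; set a := \sum_(_ in _ | _) _; lra.
  by rewrite ler_wpM2r // /norm_cap ler_wpM2r ?addr_ge0 // card_good_le.
have [y00|yn0] := eqVneq (dot (Y i) (Y i)) 0.
  by rewrite y00 /norm_cap mulr_ge0 ?(ltW n0) // addr_ge0.
by move: h2; rewrite ler_pM2r // lt_neqAle eq_sym yn0.
Qed.

Lemma valid_prune : stable_sample -> valid prune.
Proof.
move=> SS; have p01 i : 0 <= prune i <= 1.
  by rewrite /prune; case: ifP => _; rewrite !lexx ler01.
split=> //; rewrite big1 => [|i iG]; last by rewrite /prune good_norm_le // subrr.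
by apply: sumr_ge0 => i _; have := p01 i; lra.
Qed.

Lemma gram_le w x : stable_sample -> valid w -> capped w ->
  dot (x *m gram w) x <= (norm_cap + 2 * B2) * dot x x.
Proof.
move=> SS vw cw; have [n0 cardG eps0 eps1 [eta20 B20 eta2B2]] := stable_sampleP SS.
have x0 := dotxx_ge0 x.
have cap0 : 0 <= norm_cap by rewrite /norm_cap mulr_ge0 ?(ltW n0) // addr_ge0.
rewrite dot_gram.
have : \sum_i w i / N%:R * (dot (Y i) x * dot (Y i) x) <=
       \sum_(i < N) norm_cap * dot x x / N%:R.
  apply: ler_sum => i _; rewrite mulrAC ler_wpM2r ?invr_ge0 ?(ltW n0) //.
  have [->|wi] := eqVneq (w i) 0; first by rewrite mul0r mulr_ge0.
  have /andP[w0 w1] := vw.1 i; rewrite -expr2.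
  apply: le_trans (_ : 1 * dot (Y i) x ^+ 2 <= _); first by rewrite ler_wpM2r ?sqr_ge0.
  by rewrite mul1r; apply: le_trans (dot_CS _ _) _; rewrite ler_wpM2r ?cw.
have -> : \sum_(i < N) norm_cap * dot x x / N%:R = norm_cap * dot x x.
  by rewrite sumr_const card_ord -mulr_natl; field; lra.
have : 0 <= eta2 * dot x x by rewrite mulr_ge0.
lra.
Qed.

Lemma potential_prune_le : stable_sample ->
  potential prune <= d%:R * (norm_cap + 2 * B2) ^+ q.+1.
Proof.
move=> SS; have [n0 cardG eps0 eps1 [eta20 B20 eta2B2]] := stable_sampleP SS.
have vw := valid_prune SS; have cw := capped_prune.
set L := norm_cap + 2 * B2.
have L0 : 0 <= L by rewrite /L addr_ge0 // /norm_cap mulr_ge0 ?(ltW n0) // addr_ge0.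
have pA := psd_gram SS vw.
have pD : psd (L%:M - gram prune).
  split=> [|x]; first by rewrite linearB /= tr_scalar_mx gram_sym.
  by rewrite mulmxBr mul_mx_scalar dotDl dotNl dotZl subr_ge0 gram_le.
have := trace_exp_mono pA (psd_scalar d L0) pD q_even.
rewrite add1n -/q -/(potential prune); move/le_trans; apply.
have -> : (L%:M : 'M[R]_d) ^+ (2 ^ K) = (L ^+ q)%:M.
  by rewrite -/q; elim: q => [|n IH]; rewrite ?expr0 // !exprS IH -mulmxE scalar_mxM.
rewrite expr1 -mulmxE mul_mx_scalar mxtraceZ exprS mulrA [leRHS]mulrC.
rewrite ler_wpM2l ?exprn_ge0 //.
have := psd_trace_ge0 pD; rewrite linearB /= mxtrace_scalar -mulr_natl; lra.
Qed.

End Contraction.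

End Filter.


(** * Reasoning about programs *)

Fixpoint nwrites (c : cmd) : seq nat :=
  match c with
  | NSet a _ _ => [:: a]
  | Flip a _ => [:: a]
  | Seq c1 c2 | If _ c1 c2 => nwrites c1 ++ nwrites c2
  | While _ c1 => nwrites c1
  | _ => [::]
  end.

Fixpoint rwrites (c : cmd) : seq nat :=
  match c with
  | RSet a _ _ => [:: a]
  | Seq c1 c2 | If _ c1 c2 => rwrites c1 ++ rwrites c2
  | While _ c1 => rwrites c1
  | _ => [::]
  end.

Fixpoint tosses (c : cmd) : bool :=
  match c with
  | Flip _ _ => true
  | Seq c1 c2 | If _ c1 c2 => tosses c1 || tosses c2
  | While _ c1 => tosses c1
  | _ => false
  end.

Fixpoint loopfree (c : cmd) : bool :=
  match c with
  | Seq c1 c2 | If _ c1 c2 => loopfree c1 && loopfree c2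
  | While _ _ => false
  | _ => true
  end.

Fixpoint maxcost (c : cmd) : nat :=
  match c with
  | Skip => 1
  | NSet _ i e => (ncost i + ncost e).+1
  | RSet _ i e => (ncost i + rcost e).+1
  | Flip _ i => (ncost i).+1
  | Seq c1 c2 => maxcost c1 + maxcost c2
  | If b c1 c2 => (bcost b + (maxcost c1 + maxcost c2)).+1
  | While _ _ => 0
  end.

Section Programs.
Variable R : realType.
Implicit Types (c : cmd) (s : state R).

(** Tracks whole arrays rather than cells: enough to carry whatever a postcondition does not mention
    through a composition. *)
Definition frame c s s' : Prop :=
  [/\ forall a, a \notin nwrites c -> nmem s' a = nmem s a,
      forall a, a \notin rwrites c -> rmem s' a = rmem s a
    & ~~ tosses c -> coins s' = coins s].

Lemma upd_other (T : Type) (m : nat -> nat -> T) (a b k : nat) v :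
  b != a -> upd m a k v b = m b.
Proof. by move=> /negbTE ba; apply: funext => l; rewrite /upd ba. Qed.

Lemma upd_at (T : Type) (m : nat -> nat -> T) (a k l : nat) v :
  upd m a k v a l = if l == k then v else m a l.
Proof. by rewrite /upd eqxx. Qed.

Lemma exec_frame c s t s' : exec c s t s' -> frame c s s'.
Proof.
elim=> {c s t s'} //=.
- by move=> a i e s; split=> //= b; rewrite inE => h; rewrite upd_other.
- by move=> a i e s; split=> //= b; rewrite inE => h; rewrite upd_other.
- by move=> a i s; split=> //= b; rewrite inE => h; rewrite upd_other.
- move=> c1 c2 s t1 s1 t2 s2 _ [h1 h2 h3] _ [k1 k2 k3].
  split=> [a|a|] /=; rewrite ?mem_cat ?negb_or => /andP[m1 m2].
  + by rewrite k1 // h1.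
  + by rewrite k2 // h2.
  + by rewrite k3 // h3.
- move=> b c1 c2 s t s' _; case: (beval s b) => -[h1 h2 h3];
  split=> [a|a|] /=; rewrite ?mem_cat ?negb_or => /andP[m1 m2];
  by rewrite ?h1 ?h2 ?h3.
- move=> b c s t1 s1 t2 s2 _ _ [h1 h2 h3] _ [k1 k2 k3].
  by split=> [a|a|] /= m; rewrite ?k1 ?k2 ?k3 ?h1 ?h2 ?h3.
Qed.

Fixpoint sem c s : state R :=
  match c with
  | NSet a i e => State (upd (nmem s) a (neval s i) (neval s e)) (rmem s) (coins s)
  | RSet a i e => State (nmem s) (upd (rmem s) a (neval s i) (reval s e)) (coins s)
  | Flip a i => State (upd (nmem s) a (neval s i) (nat_of_bool (coins s 0%N)))
                  (rmem s) (fun k => coins s k.+1)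
  | Seq c1 c2 => sem c2 (sem c1 s)
  | If b c1 c2 => if beval s b then sem c1 s else sem c2 s
  | _ => s
  end.

(** A total-correctness triple with a time bound. *)
Definition runs c s (B : nat) (Q : state R -> Prop) : Prop :=
  exists t s', [/\ exec c s t s', (t <= B)%N & Q s'].

Lemma runs_sem c s B (Q : state R -> Prop) :
  loopfree c -> (maxcost c <= B)%N -> Q (sem c s) -> runs c s B Q.
Proof.
move=> lf cB q.
suff [t [h1 h2]] : exists t, exec c s t (sem c s) /\ (t <= maxcost c)%N.
  by exists t, (sem c s); split=> //; apply: leq_trans cB.
elim: c s lf {cB q} => //=.
- by move=> s _; exists 1%N; split=> //; apply: ExSkip.
- by move=> a i e s _; eexists; split; first exact: ExNSet.
- by move=> a i e s _; eexists; split; first exact: ExRSet.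
- by move=> a i s _; eexists; split; first exact: ExFlip.
- move=> c1 IH1 c2 IH2 s /andP[l1 l2].
  have [t1 [h1 k1]] := IH1 s l1; have [t2 [h2 k2]] := IH2 (sem c1 s) l2.
  by exists (t1 + t2)%N; split; [apply: ExSeq h1 h2|apply: leq_add].
- move=> b c1 IH1 c2 IH2 s /andP[l1 l2].
  have [t1 [h1 k1]] := IH1 s l1; have [t2 [h2 k2]] := IH2 s l2.
  case e: (beval s b).
    exists (bcost b + t1).+1; split; first by apply: ExIf; rewrite e.
    by rewrite ltnS leq_add2l (leq_trans k1) // leq_addr.
  exists (bcost b + t2).+1; split; first by apply: ExIf; rewrite e.
  by rewrite ltnS leq_add2l (leq_trans k2) // leq_addl.
Qed.

Lemma runs_weaken c s B B' (Q Q' : state R -> Prop) :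
  runs c s B Q -> (B <= B')%N ->
  (forall s', frame c s s' -> Q s' -> Q' s') -> runs c s B' Q'.
Proof.
move=> [t [s' [h1 h2 h3]]] hB hQ; exists t, s'; split=> //.
  exact: leq_trans hB.
by apply: hQ h3; apply: exec_frame h1.
Qed.

Lemma runs_seq c1 c2 s B1 B2 B (Q1 Q : state R -> Prop) :
  runs c1 s B1 Q1 ->
  (forall s1, frame c1 s s1 -> Q1 s1 -> runs c2 s1 B2 Q) ->
  (B1 + B2 <= B)%N -> runs (Seq c1 c2) s B Q.
Proof.
move=> [t1 [s1 [h1 k1 q1]]] H hB.
have [t2 [s2 [h2 k2 q2]]] := H s1 (exec_frame h1) q1.
exists (t1 + t2)%N, s2; split=> //; first exact: ExSeq h1 h2.
by apply: leq_trans hB; apply: leq_add.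
Qed.

Lemma frame_trans c s1 s2 s3 : frame c s1 s2 -> frame c s2 s3 -> frame c s1 s3.
Proof.
move=> [h1 h2 h3] [k1 k2 k3].
by split=> [a|a|] m; rewrite ?k1 ?k2 ?k3 ?h1 ?h2 ?h3.
Qed.

End Programs.

Notation nv a := (NGet a (NConst 0)).
Notation rv a := (RGet a (NConst 0)).
Notation nset a e := (NSet a (NConst 0) e).
Notation rset a e := (RSet a (NConst 0) e).
Notation incr a := (nset a (NAdd (nv a) (NConst 1))).

Definition For (i : nat) (b : nexpr) (body : cmd) : cmd :=
  Seq (nset i (NConst 0)) (While (BNot (NLe b (nv i))) (Seq body (incr i))).

Section For.
Variable R : realType.

Definition setctr (i k : nat) (s : state R) : state R :=
  State (upd (nmem s) i 0 k) (rmem s) (coins s).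

(** The bound [b] is evaluated anew at each test, hence the hypothesis that it keeps the value [n]
    on all framed states. The invariant is asked after the counter has been incremented. The 20 pays
    for the test, at most 14, and the increment, 6. *)
Lemma runs_for (I : nat -> state R -> Prop) i b body n tb s B :
  i \notin nwrites body -> (ncost b <= 9)%N ->
  (forall s', frame (For i b body) s s' -> neval s' b = n) ->
  I 0%N (setctr i 0 s) ->
  (forall k s', (k < n)%N -> frame (For i b body) s s' -> nmem s' i 0 = k ->
    I k s' -> runs body s' tb (fun s2 => I k.+1 (setctr i k.+1 s2))) ->
  (n.+1 * (tb + 20) <= B)%N ->
  runs (For i b body) s B (I n).
Proof.
move=> ib cb hb I0 step hB.
set W := While (BNot (NLe b (nv i))) (Seq body (incr i)).
set f := frame (For i b body) s in hb step *.
suff loop m k s' : (m + k)%N = n -> f s' -> nmem s' i 0 = k -> I k s' ->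
    runs W s' (m * (tb + 20) + 14)%N (I n).
  have f0 : f (setctr i 0 s).
    by split=> //= a; rewrite inE negb_or => /andP[h _]; rewrite upd_other.
  apply: (@runs_seq _ _ _ _ 3 (n * (tb + 20) + 14) _ (fun s' => s' = setctr i 0 s)).
  - by apply: runs_sem.
  - move=> s1 _ ->; apply: (loop n 0%N); rewrite ?addn0 //.
    by rewrite /= upd_at.
  - by apply: leq_trans hB; rewrite mulSn; lia.
elim: m k s' => [|m IH] k s' mk fs ik Ik.
  have c0 : beval s' (BNot (NLe b (nv i))) = false.
    by rewrite /= (hb _ fs) ik -mk add0n leqnn.
  exists (bcost (BNot (NLe b (nv i)))).+1, s'.
  split; [exact: ExWhileDone|by rewrite /=; lia|by rewrite -mk add0n].
have kn : (k < n)%N by lia.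
have c1 : beval s' (BNot (NLe b (nv i))) = true by rewrite /= (hb _ fs) ik -ltnNge.
have [t1 [s1 [h1 k1 q1]]] := step k s' kn fs ik Ik.
have f1 := exec_frame h1.
have is1 : nmem s1 i 0 = k by case: f1 => -> //; rewrite ik.
have h2 : exec (incr i) s1 6 (setctr i k.+1 s1).
  have -> : setctr i k.+1 s1 = sem (incr i) s1 by rewrite /setctr /= is1 addn1.
  exact: ExNSet.
have h3 := ExSeq h1 h2.
have f3 : f (setctr i k.+1 s1).
  apply: frame_trans fs _; have [g1 g2 g3] := exec_frame h3.
  split=> [a|a|] m'.
  - by apply: g1; move: m'; rewrite /= inE negb_or => /andP[].
  - by apply: g2.
  - by apply: g3.
have ik3 : nmem (setctr i k.+1 s1) i 0 = k.+1 by rewrite /= upd_at.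
have [t4 [s4 [h4 k4 q4]]] := IH k.+1 _ (ltac:(lia)) f3 ik3 q1.
exists (bcost (BNot (NLe b (nv i))) + (t1 + 6) + t4).+1, s4; split=> //.
  exact: ExWhileStep c1 h3 h4.
by rewrite /= mulSn; lia.
Qed.

End For.


(** * The program *)

Notation nN := (NGet 0 (NConst 0)).
Notation nD := (NGet 0 (NConst 1)).
Notation rn k := (RNat (NConst k)).
Notation rp k := (RGet 0 (NConst k)).

(* Arrays of naturals: 2, 3 row and column counters; 4 flat index into the
   data; 5 the power [p]; 6 its counter; 7 the last coin.
   Arrays of reals: 4 the shifted data; 5 weights; 6 the sketch vector; 7 a
   scratch vector; 8 tail scores; 9 accumulator; 10 [B2]; 11 [norm_cap];
   12 the clock; 13 damping; 14 its target; 15 tail cut-off; 16 the shift of the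
   Gram matrix; 17 [4 ^ p]; 18 the damping step; 19 [|u|^2]; 20 [ratio ^ (2 p)];
   21 [ratio]. *)

Definition row_dot : cmd :=
  Seq (rset 9 (rn 0))
    (For 3 nD
      (Seq (rset 9 (RAdd (rv 9) (RMul (RGet 4 (nv 4)) (RGet 6 (nv 3))))) (incr 4))).

Definition add_row : cmd :=
  For 3 nD
    (Seq (RSet 7 (nv 3) (RAdd (RGet 7 (nv 3)) (RMul (rv 9) (RGet 4 (nv 4)))))
         (incr 4)).

(** One product with the Gram matrix in [O(N d)] operations, without forming the matrix. The flat
    index is moved back by [d] after each [row_dot], so that [add_row] reads the same row; naturals
    cannot be multiplied to recompute it. *)
Definition matvec : cmd :=
  Seq (For 3 nD (RSet 7 (nv 3) (RSub (rn 0) (RMul (rv 16) (RGet 6 (nv 3))))))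
  (Seq (nset 4 (NConst 0))
  (Seq (For 2 nN
     (Seq row_dot
     (Seq (Seq (nset 4 (NSub (nv 4) nD))
               (rset 9 (RMul (RDiv (RGet 5 (nv 2)) (RNat nN)) (rv 9))))
          add_row)))
  (For 3 nD (RSet 6 (nv 3) (RGet 7 (nv 3)))))).

Definition toss_signs : cmd :=
  For 3 nD (Seq (Flip 7 (NConst 0))
                (RSet 6 (nv 3) (RSub (RNat (NAdd (nv 7) (nv 7))) (rn 1)))).

Definition sqnorm : cmd :=
  Seq (rset 19 (rn 0))
    (For 3 nD (rset 19 (RAdd (rv 19) (RMul (RGet 6 (nv 3)) (RGet 6 (nv 3)))))).

Definition scores : cmd :=
  Seq (nset 4 (NConst 0))
    (For 2 nN (Seq row_dot
      (If (RLe (RMul (rv 9) (rv 9)) (rv 15)) (RSet 8 (nv 2) (rn 0))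
          (RSet 8 (nv 2) (RMul (rv 9) (rv 9)))))).

Definition damped : cmd :=
  Seq (rset 9 (rn 0))
    (For 2 nN (rset 9 (RAdd (rv 9)
      (RDiv (RMul (RGet 5 (nv 2)) (RGet 8 (nv 2)))
            (RAdd (rn 1) (RMul (rv 13) (RGet 8 (nv 2)))))))).

Definition search : cmd :=
  Seq damped
    (While (BNot (RLe (rv 9) (rv 14)))
      (Seq (rset 13 (RAdd (RAdd (rv 13) (rv 13)) (rv 18))) damped)).

Definition reweight : cmd :=
  For 2 nN (RSet 5 (nv 2) (RDiv (RGet 5 (nv 2))
    (RAdd (rn 1) (RMul (rv 13) (RGet 8 (nv 2)))))).

Definition set_cutoffs : cmd :=
  Seq (rset 15 (RDiv (RMul (RMul (rn 6) (rv 10)) (rv 19)) (rp 0)))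
  (Seq (rset 14 (RMul (RMul (RMul (rn 12) (RNat nN)) (rv 10)) (rv 19)))
  (Seq (rset 18 (RDiv (rn 1) (RMul (rv 11) (rv 19))))
       (rset 13 (rn 0)))).

Definition round : cmd :=
  Seq (rset 12 (RDiv (RMul (rv 12) (rn 5)) (rn 6)))
  (Seq toss_signs
  (Seq (For 6 (nv 5) matvec)
  (Seq sqnorm
  (Seq set_cutoffs
  (Seq scores
  (Seq search reweight)))))).

(** * Correctness and cost of one round *)

Section ProgramSpecs.
Variables (R : realType) (N d : nat).
Hypotheses (N0 : (0 < N)%N) (d0 : (0 < d)%N).
Implicit Types s : state R.

Definition dims s := nmem s 0 0 = N /\ nmem s 0 1 = d.

Lemma dims_frame c s s' : dims s -> frame c s s' -> 0 \notin nwrites c -> dims s'.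
Proof. by move=> [e1 e2] [f _ _] h; rewrite /dims f. Qed.

Lemma row_dot_spec s : dims s -> runs row_dot s (100 * d) (fun s' =>
  rmem s' 9 0 = \sum_(0 <= j < d) rmem s 4 (nmem s 4 0 + j)%N * rmem s 6 j /\
  nmem s' 4 0 = (nmem s 4 0 + d)%N).
Proof.
move=> ds.
apply: (@runs_seq _ _ _ _ 10 (d.+1 * 40) _ (fun s' => rmem s' 9 0 = 0)).
- exact: runs_sem.
- move=> s1 f1 z1; have d1 := dims_frame ds f1 isT; have [g1 g2 _] := f1.
  apply: (@runs_for _ (fun k s' =>
     rmem s' 9 0 = \sum_(0 <= j < k) rmem s 4 (nmem s 4 0 + j)%N * rmem s 6 j /\
     nmem s' 4 0 = (nmem s 4 0 + k)%N) _ _ _ d 20) => //.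
  + by move=> s' f; have [] := dims_frame d1 f isT.
  + by rewrite big_nil addn0 /= /upd /= z1 (g1 4%N isT).
  + move=> k s' kd [h1 h2 _] jk [a1 a2]; apply: runs_sem => //.
    rewrite /= /upd /= a1 a2 jk (h2 4%N isT) (h2 6%N isT) (g2 4%N isT) (g2 6%N isT).
    by rewrite big_nat_recr //= addn1 addnS.
- lia.
Qed.

Lemma add_row_spec s : dims s -> runs add_row s (100 * d) (fun s' =>
  (forall j, (j < d)%N -> rmem s' 7 j =
     rmem s 7 j + rmem s 9 0 * rmem s 4 (nmem s 4 0 + j)%N) /\
  nmem s' 4 0 = (nmem s 4 0 + d)%N).
Proof.
move=> ds.
apply: (@runs_weaken _ _ _ (d.+1 * 40) _ (fun s' =>
  (forall j, rmem s' 7 j = if (j < d)%N then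
     rmem s 7 j + rmem s 9 0 * rmem s 4 (nmem s 4 0 + j)%N else rmem s 7 j) /\
  nmem s' 4 0 = (nmem s 4 0 + d)%N)); last 2 first.
- lia.
- by move=> s' _ [h1 h2]; split=> // j jd; rewrite h1 jd.
apply: (@runs_for _ (fun k s' =>
  (forall j, rmem s' 7 j = if (j < k)%N then
     rmem s 7 j + rmem s 9 0 * rmem s 4 (nmem s 4 0 + j)%N else rmem s 7 j) /\
  nmem s' 4 0 = (nmem s 4 0 + k)%N) _ _ _ d 20) => //.
- by move=> s' f; have [] := dims_frame ds f isT.
- by rewrite addn0.
- move=> k s' kd [h1 h2 _] jk [a1 a2]; apply: runs_sem => //.
  split=> [j|]; last by rewrite /= /upd /= a2 addn1 addnS.
  rewrite /= upd_at jk a2 (h2 4%N isT) (h2 9%N isT) a1 ltnn.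
  case: (ltngtP j k) => [jk1|jk1|->]; rewrite ?a1.
  + by rewrite jk1 (ltn_trans jk1).
  + by rewrite (leq_gtF (ltnW jk1)) ltnS leqNgt jk1.
  + by rewrite ltnS leqnn.
Qed.

Lemma matvec_spec s : dims s -> runs matvec s (1000 * (N * d)) (fun s' =>
  forall j, (j < d)%N -> rmem s' 6 j =
   \sum_(0 <= i < N) (rmem s 5 i / N%:R *
      \sum_(0 <= l < d) rmem s 4 (i * d + l)%N * rmem s 6 l) * rmem s 4 (i * d + j)%N
   - rmem s 16 0 * rmem s 6 j).
Proof.
move=> ds.
apply: (@runs_seq _ _ _ _ (d.+1 * 40) (800 * (N * d)) _ (fun s' =>
  forall j, (j < d)%N -> rmem s' 7 j = - (rmem s 16 0 * rmem s 6 j))); last 1 first.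
- nia.
- apply: (@runs_for _ (fun k s' => forall j, (j < k)%N ->
     rmem s' 7 j = - (rmem s 16 0 * rmem s 6 j)) _ _ _ d 20) => //.
  + by move=> s' f; have [] := dims_frame ds f isT.
  + move=> k s' kd [h1 h2 _] jk a1; apply: runs_sem => // j.
    rewrite ltnS leq_eqVlt /= upd_at jk => /orP[/eqP->|lt].
      by rewrite eqxx (h2 16%N isT) (h2 6%N isT) sub0r.
    by rewrite ltn_eqF // a1.
move=> s1 f1 q1; have d1 := dims_frame ds f1 isT; have [g1 g2 _] := f1.
apply: (@runs_seq _ _ _ _ 10 (700 * (N * d)) _ (fun s' => nmem s' 4 0 = 0%N));
  [exact: runs_sem| |nia].
move=> s2 f2 q2; have d2 := dims_frame d1 f2 isT; have [k1 k2 _] := f2.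
pose F i j := (rmem s 5 i / N%:R * \sum_(0 <= l < d) rmem s 4 (i * d + l)%N * rmem s 6 l)
    * rmem s 4 (i * d + j)%N.
apply: (@runs_seq _ _ _ _ (N.+1 * (230 * d + 20)) (d.+1 * 40) _ (fun s' =>
  (forall j, (j < d)%N -> rmem s' 7 j =
     - (rmem s 16 0 * rmem s 6 j) + \sum_(0 <= i < N) F i j) /\
  nmem s' 4 0 = (N * d)%N)); last 1 first.
- nia.
- apply: (@runs_for _ (fun k s' => (forall j, (j < d)%N -> rmem s' 7 j =
     - (rmem s 16 0 * rmem s 6 j) + \sum_(0 <= i < k) F i j) /\
     nmem s' 4 0 = (k * d)%N) _ _ _ N (230 * d)) => //.
  + by move=> s' f; have [] := dims_frame d2 f isT.
  + by split=> [j jd|]; rewrite /= /upd /= ?q2 // big_nil addr0 (k2 7%N isT) q1.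
  + move=> k s' kN f ik [a1 a2]; have d' := dims_frame d2 f isT; have [h1 h2 _] := f.
    have r4 : rmem s' 4 = rmem s 4 by rewrite (h2 4%N isT) (k2 4%N isT) (g2 4%N isT).
    have r5 : rmem s' 5 = rmem s 5 by rewrite (h2 5%N isT) (k2 5%N isT) (g2 5%N isT).
    have r6 : rmem s' 6 = rmem s 6 by rewrite (h2 6%N isT) (k2 6%N isT) (g2 6%N isT).
    apply: (runs_seq (row_dot_spec d') (B2 := 125 * d)); last by lia.
    move=> s3 f3 [b1 b2]; have d3 := dims_frame d' f3 isT; have [m1 m2 _] := f3.
    apply: (@runs_seq _ _ _ _ 25 (100 * d) _ (fun s' => nmem s' 4 0 = (k * d)%N /\
      rmem s' 9 0 = rmem s 5 k / N%:R *
        \sum_(0 <= l < d) rmem s 4 (k * d + l)%N * rmem s 6 l)); last by lia.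
      apply: runs_sem => //=; rewrite /upd /= b2 a2 b1 a2.
      have [-> ->] := d3; rewrite addnK (m2 5%N isT) r5 (m1 2%N isT) ik r4 r6.
      by [].
    move=> s4 f4 [c1 c2]; have d4 := dims_frame d3 f4 isT; have [n1 n2 _] := f4.
    apply: runs_weaken (add_row_spec d4) (leqnn _) _ => s5 _ [e1 e2].
    split=> [j jd|]; last by rewrite /= /upd /= e2 c1 mulSn addnC.
    rewrite /= e1 // (n2 7%N isT) (m2 7%N isT) a1 // c2 (n2 4%N isT) (m2 4%N isT) r4 c1.
    by rewrite big_nat_recr //= addrA.
move=> s3 f3 [q3 _]; have d3 := dims_frame d2 f3 isT.
apply: (@runs_weaken _ _ _ (d.+1 * 40) _ (fun s' => forall j, (j < d)%N ->
  rmem s' 6 j = rmem s3 7 j)); [|by []|]; last first.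
  by move=> s' _ h j jd; rewrite h // q3 // addrC.
apply: (@runs_for _ (fun k s' => forall j, (j < k)%N ->
  rmem s' 6 j = rmem s3 7 j) _ _ _ d 20) => //.
- by move=> s' f; have [] := dims_frame d3 f isT.
- move=> k s' kd [h1 h2 _] jk a1; apply: runs_sem => // j.
  rewrite ltnS leq_eqVlt /= upd_at jk => /orP[/eqP->|lt].
    by rewrite eqxx (h2 7%N isT).
  by rewrite ltn_eqF // a1.
Qed.

Definition pts s : 'I_N -> 'rV[R]_d := fun i => \row_j rmem s 4 (i * d + j)%N.
Definition wts s : 'I_N -> R := fun i => rmem s 5 i.
Definition vec a s : 'rV[R]_d := \row_j rmem s a j.

Lemma dot_delta (x : 'rV[R]_d) (j : 'I_d) : dot x (delta_mx 0 j) = x 0 j.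
Proof.
rewrite /dot (bigD1 j) //= big1 => [|l lj].
  by rewrite mxE !eqxx mulr1 addr0.
by rewrite mxE (negbTE lj) andbF mulr0.
Qed.

Lemma matvec_gram s (eta2 B2 : R) : dims s -> rmem s 16 0 = eta2 - 2 * B2 ->
  runs matvec s (1000 * (N * d)) (fun s' =>
    vec 6 s' = vec 6 s *m gram (pts s) eta2 B2 (wts s)).
Proof.
move=> ds sh; apply: runs_weaken (matvec_spec ds) (leqnn _) _ => s' _ h.
apply/rowP => j; rewrite -[RHS]dot_delta dot_gram dot_delta !mxE h // sh.
congr (_ - _); rewrite big_mkord; apply: eq_bigr => i _.
rewrite dot_delta mxE mulrA; congr (_ * _ * _).
by rewrite big_mkord; apply: eq_bigr => l _; rewrite !mxE.
Qed.

Lemma power_spec s (eta2 B2 : R) p : dims s -> rmem s 16 0 = eta2 - 2 * B2 ->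
  nmem s 5 0 = p ->
  runs (For 6 (nv 5) matvec) s (p.+1 * (1000 * (N * d) + 20)) (fun s' =>
    vec 6 s' = vec 6 s *m gram (pts s) eta2 B2 (wts s) ^+ p).
Proof.
move=> ds sh hp.
apply: (@runs_for _ (fun k s' =>
  vec 6 s' = vec 6 s *m gram (pts s) eta2 B2 (wts s) ^+ k) _ _ _ p (1000 * (N * d))) => //.
- by move=> s' [f _ _]; rewrite /= (f 5%N isT).
- by have -> : gram (pts s) eta2 B2 (wts s) ^+ 0 = 1%:M by []; rewrite mulmx1.
- move=> k s' kp f _ a1; have d' := dims_frame ds f isT; have [h1 h2 _] := f.
  have sh' : rmem s' 16 0 = eta2 - 2 * B2 by rewrite (h2 16%N isT).
  apply: runs_weaken (matvec_gram d' sh') (leqnn _) _ => s2 _ e.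
  rewrite -[vec 6 (setctr _ _ _)]/(vec 6 s2) e a1 -mulmxA exprSr.
  by rewrite /pts /wts (h2 4%N isT) (h2 5%N isT).
Qed.

Lemma toss_signs_spec s : dims s -> runs toss_signs s (100 * d) (fun s' =>
  vec 6 s' = sign_row R d (coins s) /\ coins s' = sdrop d (coins s)).
Proof.
move=> ds; apply: (@runs_weaken _ _ _ (d.+1 * 50) _ (fun s' =>
  (forall j, (j < d)%N -> rmem s' 6 j = sgnc R (coins s j)) /\
  coins s' = sdrop d (coins s))); last 2 first.
- lia.
- by move=> s' _ [h1 h2]; split=> //; apply/rowP => j; rewrite !mxE h1.
apply: (@runs_for _ (fun k s' =>
  (forall j, (j < k)%N -> rmem s' 6 j = sgnc R (coins s j)) /\
  coins s' = sdrop k (coins s)) _ _ _ d 30) => //.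
- by move=> s' f; have [] := dims_frame ds f isT.
- move=> k s' kd _ jk [a1 a2]; apply: runs_sem => //.
  split=> [j|]; last by apply: funext => l; rewrite /= a2 /sdrop addSnnS.
  rewrite ltnS leq_eqVlt /= upd_at /upd /= jk => /orP[/eqP->|lt].
    by rewrite eqxx a2 /sdrop addn0; case: (coins s k); rewrite /= ?addrK ?sub0r.
  by rewrite ltn_eqF // a1.
Qed.

Lemma sqnorm_spec s : dims s -> runs sqnorm s (100 * d) (fun s' =>
  rmem s' 19 0 = dot (vec 6 s) (vec 6 s)).
Proof.
move=> ds.
apply: (@runs_seq _ _ _ _ 10 (d.+1 * 40) _ (fun s' => rmem s' 19 0 = 0));
  [exact: runs_sem| |lia].
move=> s1 f1 z1; have d1 := dims_frame ds f1 isT; have [g1 g2 _] := f1.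
apply: (@runs_weaken _ _ _ (d.+1 * 40) _ (fun s' =>
  rmem s' 19 0 = \sum_(0 <= j < d) rmem s 6 j * rmem s 6 j)) => //; last first.
  by move=> s' _ ->; rewrite big_mkord; apply: eq_bigr => j _; rewrite mxE.
apply: (@runs_for _ (fun k s' =>
  rmem s' 19 0 = \sum_(0 <= j < k) rmem s 6 j * rmem s 6 j) _ _ _ d 20) => //.
- by move=> s' f; have [] := dims_frame d1 f isT.
- by rewrite big_nil /= z1.
- move=> k s' kd [h1 h2 _] jk a1; apply: runs_sem => //.
  by rewrite /= /upd /= a1 jk (h2 6%N isT) (g2 6%N isT) big_nat_recr.
Qed.

Lemma scores_spec s : dims s -> runs scores s (400 * (N * d)) (fun s' =>
  forall i : 'I_N, rmem s' 8 i =
    if rmem s 15 0 < dot (pts s i) (vec 6 s) ^+ 2 then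
      dot (pts s i) (vec 6 s) ^+ 2 else 0).
Proof.
move=> ds.
apply: (@runs_seq _ _ _ _ 10 (N.+1 * (150 * d + 20)) _ (fun s' => nmem s' 4 0 = 0%N));
  [exact: runs_sem| |nia].
move=> s1 f1 z1; have d1 := dims_frame ds f1 isT; have [g1 g2 _] := f1.
pose F i := let t := (\sum_(0 <= l < d) rmem s 4 (i * d + l)%N * rmem s 6 l) in
  if t * t <= rmem s 15 0 then 0 else t * t.
apply: (@runs_weaken _ _ _ (N.+1 * (150 * d + 20)) _ (fun s' =>
  (forall i, (i < N)%N -> rmem s' 8 i = F i) /\ nmem s' 4 0 = (N * d)%N)) => //; last first.
  move=> s' _ [h _] i; rewrite h // /F /= leNgt.
  have -> : \sum_(0 <= l < d) rmem s 4 (i * d + l) * rmem s 6 l = dot (pts s i) (vec 6 s).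
    by rewrite big_mkord; apply: eq_bigr => l _; rewrite !mxE.
  by rewrite expr2; case: (_ < _).
apply: (@runs_for _ (fun k s' =>
  (forall i, (i < k)%N -> rmem s' 8 i = F i) /\ nmem s' 4 0 = (k * d)%N) _ _ _ N (150 * d)) => //.
- by move=> s' f; have [] := dims_frame d1 f isT.
- move=> k s' kN f ik [a1 a2]; have d' := dims_frame d1 f isT; have [h1 h2 _] := f.
  apply: (runs_seq (row_dot_spec d') (B2 := 40)); last by lia.
  move=> s3 f3 [b1 b2]; have [m1 m2 _] := f3.
  have e : rmem s3 9 0 = \sum_(0 <= l < d) rmem s 4 (k * d + l)%N * rmem s 6 l.
    by rewrite b1 a2 (h2 4%N isT) (h2 6%N isT) (g2 4%N isT) (g2 6%N isT).
  apply: runs_sem => //; split=> [i|]; last first.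
    by rewrite /= /upd /=; case: ifP => _ /=; rewrite b2 a2 mulSn addnC.
  rewrite ltnS leq_eqVlt /= (m2 15%N isT) (h2 15%N isT) (g2 15%N isT) e.
  move=> /orP[/eqP->|lt].
    by rewrite /F /=; case: ifP => _ /=; rewrite upd_at (m1 2%N isT) ik eqxx // e.
  by case: ifP => _ /=; rewrite upd_at (m1 2%N isT) ik ltn_eqF // (m2 8%N isT) a1.
Qed.

Definition tail s : 'I_N -> R := fun i => rmem s 8 i.

Lemma damped_spec s : dims s -> runs damped s (150 * N) (fun s' =>
  rmem s' 9 0 = damped_sum (wts s) (tail s) (rmem s 13 0)).
Proof.
move=> ds.
apply: (@runs_seq _ _ _ _ 10 (N.+1 * 60) _ (fun s' => rmem s' 9 0 = 0));
  [exact: runs_sem| |lia].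
move=> s1 f1 z1; have d1 := dims_frame ds f1 isT; have [g1 g2 _] := f1.
apply: (@runs_weaken _ _ _ (N.+1 * 60) _ (fun s' => rmem s' 9 0 =
  \sum_(0 <= i < N) rmem s 5 i * rmem s 8 i / (1 + rmem s 13 0 * rmem s 8 i))) => //;
  last first.
  by move=> s' _ ->; rewrite big_mkord.
apply: (@runs_for _ (fun k s' => rmem s' 9 0 =
  \sum_(0 <= i < k) rmem s 5 i * rmem s 8 i / (1 + rmem s 13 0 * rmem s 8 i)) _ _ _ N 40) => //.
- by move=> s' f; have [] := dims_frame d1 f isT.
- by rewrite big_nil /= z1.
- move=> k s' kd [h1 h2 _] jk a1; apply: runs_sem => //.
  rewrite /= /upd /= a1 jk (h2 5%N isT) (h2 8%N isT) (h2 13%N isT).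
  by rewrite (g2 5%N isT) (g2 8%N isT) (g2 13%N isT) big_nat_recr.
Qed.

(** The loop has no fuel. That [damping] ends below the target makes it halt, and at the same
    value. *)
Lemma search_spec s fuel : dims s ->
  let f := damped_sum (wts s) (tail s) in
  let k := damping f (rmem s 14 0) (rmem s 18 0) fuel (rmem s 13 0) in
  f k <= rmem s 14 0 ->
  runs search s (fuel.+1 * (200 * N)) (fun s' => rmem s' 13 0 = k).
Proof.
move=> ds f k hk.
apply: (@runs_seq _ _ _ _ (150 * N) (fuel * (200 * N) + 10) _
  (fun s' => rmem s' 9 0 = f (rmem s 13 0))); [exact: damped_spec| |nia].
move=> s1 f1 e1; have d1 := dims_frame ds f1 isT; have [g1 g2 _] := f1.
have {e1} : rmem s1 9 0 = f (rmem s1 13 0) by rewrite e1 (g2 13%N isT).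
have w1 : wts s1 = wts s by rewrite /wts (g2 5%N isT).
have t1 : tail s1 = tail s by rewrite /tail (g2 8%N isT).
move: hk (g2 14%N isT) (g2 18%N isT) w1 t1; rewrite /k -(g2 13%N isT).
clear f1 g1 g2 k.
elim: fuel s1 d1 => [|n IH] s1 d1 /= hk e14 e18 w1 t1 e9.
  eexists; exists s1; split; first by apply: ExWhileDone; rewrite /= e9 e14 hk.
    by rewrite /=; lia.
  by [].
move: hk; case: ifP => [hf _|hf hk].
  eexists; exists s1; split; first by apply: ExWhileDone; rewrite /= e9 e14 hf.
    by rewrite /=; lia.
  by [].
have c1 : beval s1 (BNot (RLe (rv 9) (rv 14))) = true by rewrite /= e9 e14 hf.
have : runs (Seq (rset 13 (RAdd (RAdd (rv 13) (rv 13)) (rv 18))) damped) s1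
    (150 * N + 20) (fun s' => rmem s' 13 0 = rmem s1 13 0 + rmem s1 13 0 + rmem s 18 0 /\
       rmem s' 9 0 = f (rmem s' 13 0)).
  apply: (@runs_seq _ _ _ _ 15 (150 * N) _ (fun s' =>
     rmem s' 13 0 = rmem s1 13 0 + rmem s1 13 0 + rmem s 18 0)); last by lia.
    by apply: runs_sem => //; rewrite /= /upd /= e18.
  move=> s2 f2 e2; have d2 := dims_frame d1 f2 isT; have [m1 m2 _] := f2.
  apply: runs_weaken (damped_spec d2) (leqnn _) _ => s3 [_ n2 _].
  rewrite !(n2 13%N isT) => ->; split=> //.
  by congr (damped_sum _ _ _); rewrite ?/wts ?/tail ?(m2 5%N isT) ?(m2 8%N isT).
move=> [t2 [s2 [h2 b2 [e2 e2']]]]; have f2 := exec_frame h2.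
have d2 := dims_frame d1 f2 isT; have [m1 m2 _] := f2.
rewrite -e2 in hk *.
have [||||t3 [s3 [h3 b3 q3]]] := IH s2 d2 hk _ _ _ _ e2'.
- by rewrite (m2 14%N isT).
- by rewrite (m2 18%N isT).
- by rewrite -w1 /wts (m2 5%N isT).
- by rewrite -t1 /tail (m2 8%N isT).
exists (bcost (BNot (RLe (rv 9) (rv 14))) + t2 + t3).+1, s3; split=> //.
  exact: ExWhileStep c1 h2 h3.
by rewrite /=; nia.
Qed.

Lemma reweight_spec s : dims s -> runs reweight s (100 * N) (fun s' =>
  wts s' = fun i => wts s i / (1 + rmem s 13 0 * tail s i)).
Proof.
move=> ds; pose F i := rmem s 5 i / (1 + rmem s 13 0 * rmem s 8 i).
apply: (@runs_weaken _ _ _ (N.+1 * 50) _ (fun s' =>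
  forall i, rmem s' 5 i = if (i < N)%N then F i else rmem s 5 i)); last 2 first.
- lia.
- by move=> s' _ h; apply: funext => i; rewrite /wts h ltn_ord.
apply: (@runs_for _ (fun k s' =>
  forall i, rmem s' 5 i = if (i < k)%N then F i else rmem s 5 i) _ _ _ N 30) => //.
- by move=> s' f; have [] := dims_frame ds f isT.
- move=> k s' kd [h1 h2 _] jk a1; apply: runs_sem => // i.
  rewrite /= upd_at jk (h2 8%N isT) (h2 13%N isT) !a1 ltnn.
  case: (ltngtP i k) => [ik|ik|->].
  + by rewrite ltnS (ltnW ik).
  + by rewrite ltnS leqNgt ik.
  + by rewrite ltnS leqnn.
Qed.

Lemma round_spec s (eps eta2 B2 : R) K :
  dims s -> nmem s 5 0 = (2 ^ K.-1)%N -> rmem s 0 0 = eps ->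
  rmem s 10 0 = B2 -> rmem s 11 0 = norm_cap N eta2 B2 ->
  rmem s 16 0 = eta2 - 2 * B2 ->
  (forall u, damped_sum (wts s) (tail_score (pts s) eps B2 u)
      (damp (pts s) eps eta2 B2 (wts s) u) <= 12 * N%:R * B2 * dot u u) ->
  runs round s (3000 * (N * d * (2 ^ K.-1 + fuel_of N + 1))) (fun s' =>
    [/\ wts s' = step (pts s) eps eta2 B2 K (wts s) (coins s),
        coins s' = sdrop d (coins s) & rmem s' 12 0 = rmem s 12 0 * 5 / 6]).
Proof.
move=> ds hp he hB hL hsh hdamp.
set p := (2 ^ K.-1)%N in hp *; set fu := fuel_of N.
have p0 : (0 < p)%N by rewrite expn_gt0.
pose B5 := (fu.+1 * (200 * N) + 100 * N)%N.
apply: (@runs_seq _ _ _ _ 20 (100 * d + (p.+1 * (1000 * (N * d) + 20) +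
  (100 * d + (100 + (400 * (N * d) + B5))))) _
  (fun s' => rmem s' 12 0 = rmem s 12 0 * 5 / 6)); last by rewrite /B5; nia.
  exact: runs_sem.
move=> s1 f1 z1; have d1 := dims_frame ds f1 isT; have [g1 g2 g3] := f1.
apply: (runs_seq (toss_signs_spec d1)) => // s2 f2 [v2 c2].
have d2 := dims_frame d1 f2 isT; have [h1 h2 _] := f2.
have sh2 : rmem s2 16 0 = eta2 - 2 * B2 by rewrite (h2 16%N isT) (g2 16%N isT).
have p2 : nmem s2 5 0 = p by rewrite (h1 5%N isT) (g1 5%N isT).
apply: (runs_seq (power_spec d2 sh2 p2)) => // s3 f3 v3.
have d3 := dims_frame d2 f3 isT; have [k1 k2 k3] := f3.
apply: (runs_seq (sqnorm_spec d3)) => // s4 f4 v4.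
have d4 := dims_frame d3 f4 isT; have [l1 l2 l3] := f4.
set u := vec 6 s3 in v3 v4.
apply: (@runs_seq _ _ _ _ 100 (400 * (N * d) + B5) _ (fun s' =>
  [/\ rmem s' 15 0 = 6 * B2 * dot u u / eps, rmem s' 14 0 = 12 * N%:R * B2 * dot u u,
      rmem s' 18 0 = 1 / (norm_cap N eta2 B2 * dot u u) & rmem s' 13 0 = 0])) => //.
  apply: runs_sem => //; have [eN _] := d4.
  rewrite /= /upd /= v4 eN.
  rewrite (l2 0%N isT) (l2 10%N isT) (l2 11%N isT) (k2 0%N isT) (k2 10%N isT) (k2 11%N isT).
  rewrite (h2 0%N isT) (h2 10%N isT) (h2 11%N isT) (g2 0%N isT) (g2 10%N isT) (g2 11%N isT).
  by rewrite he hB hL.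
move=> s5 f5 [e15 e14 e18 e13]; have d5 := dims_frame d4 f5 isT; have [m1 m2 m3] := f5.
have u5 : vec 6 s5 = u by rewrite /vec (m2 6%N isT) (l2 6%N isT).
have r4 : rmem s5 4 = rmem s 4.
  by rewrite (m2 4%N isT) (l2 4%N isT) (k2 4%N isT) (h2 4%N isT) (g2 4%N isT).
have r5 : rmem s5 5 = rmem s 5.
  by rewrite (m2 5%N isT) (l2 5%N isT) (k2 5%N isT) (h2 5%N isT) (g2 5%N isT).
apply: (runs_seq (scores_spec d5)) => // s6 f6 v6.
have d6 := dims_frame d5 f6 isT; have [n1 n2 n3] := f6.
have w6 : wts s6 = wts s by rewrite /wts (n2 5%N isT) r5.
have t6 : tail s6 = tail_score (pts s) eps B2 u.
  by apply: funext => i; rewrite /tail v6 u5 e15 /tail_score /pts r4.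
have uE : u = sign_row R d (coins s) *m gram (pts s) eta2 B2 (wts s) ^+ p.
  have -> : pts s = pts s2 by rewrite /pts (h2 4%N isT) (g2 4%N isT).
  have -> : wts s = wts s2 by rewrite /wts (h2 5%N isT) (g2 5%N isT).
  by rewrite v3 v2 g3.
have dE : damping (damped_sum (wts s6) (tail s6)) (rmem s6 14 0) (rmem s6 18 0)
    fu (rmem s6 13 0) = damp (pts s) eps eta2 B2 (wts s) u.
  by rewrite (n2 14%N isT) (n2 18%N isT) (n2 13%N isT) e14 e18 e13 w6 t6.
have hs : damped_sum (wts s6) (tail s6) (damping (damped_sum (wts s6) (tail s6))
    (rmem s6 14 0) (rmem s6 18 0) fu (rmem s6 13 0)) <= rmem s6 14 0.
  by rewrite dE w6 t6 (n2 14%N isT) e14.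
apply: (runs_seq (search_spec d6 hs) (B2 := 100 * N)) => // s7 f7 v7.
have d7 := dims_frame d6 f7 isT; have [o1 o2 o3] := f7.
apply: runs_weaken (reweight_spec d7) (leqnn _) _ => s8 [_ q2 q3] e8; split.
- rewrite e8 v7 dE; apply: funext => i.
  have -> : wts s7 = wts s by rewrite /wts (o2 5%N isT) -/(wts s6).
  have -> : tail s7 = tail_score (pts s) eps B2 u by rewrite /tail (o2 8%N isT) -t6.
  by rewrite /step /downweight -uE.
- by rewrite q3 // o3 // n3 // m3 // l3 // k3 // c2 g3.
rewrite (q2 12%N isT) (o2 12%N isT) (n2 12%N isT) (m2 12%N isT) (l2 12%N isT).
by rewrite (k2 12%N isT) (h2 12%N isT).
Qed.

End ProgramSpecs.


(** * Initialization and assembly of the program *)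

Definition set_consts : cmd :=
  Seq (rset 10 (RMul (rn 3) (RAdd (RMul (rp 3) (rp 3)) (RMul (rp 4) (rp 4)))))
  (Seq (rset 11 (RMul (RNat nN) (RAdd (RMul (rp 2) (rp 2)) (rv 10))))
  (Seq (rset 16 (RSub (RMul (rp 2) (rp 2)) (RMul (rn 2) (rv 10))))
       (nset 4 (NConst 0)))).

Definition build_row : cmd :=
  Seq (rset 9 (rn 0))
    (For 3 nD
      (Seq (RSet 4 (nv 4) (RSub (RGet 1 (nv 4))
              (RMul (RNat (NGet 1 (nv 4))) (RGet 2 (nv 3)))))
      (Seq (rset 9 (RAdd (rv 9) (RMul (RGet 4 (nv 4)) (RGet 4 (nv 4)))))
           (incr 4)))).

Definition build : cmd :=
  For 2 nN (Seq build_row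
    (If (RLe (rv 9) (rv 11)) (RSet 5 (nv 2) (rn 1)) (RSet 5 (nv 2) (rn 0)))).

(** Repeated squaring: [p] doubles while [4^p] and [ratio^(2 p)] are squared, until [4^p > 2 d]. *)
Definition set_power : cmd :=
  Seq (Seq (rset 21 (RDiv (RAdd (rv 11) (RMul (rn 2) (rv 10))) (RMul (rn 180) (rv 10))))
      (Seq (nset 5 (NConst 1))
      (Seq (rset 17 (rn 4)) (rset 20 (RMul (rv 21) (rv 21))))))
    (While (RLe (rv 17) (RMul (rn 2) (RNat nD)))
      (Seq (rset 17 (RMul (rv 17) (rv 17)))
      (Seq (rset 20 (RMul (rv 20) (rv 20)))
           (nset 5 (NAdd (nv 5) (nv 5)))))).

Definition set_clock : cmd :=
  If (RLe (rn 1) (RMul (rp 0) (RNat nN)))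
    (rset 12 (RDiv (RMul (rv 20) (rv 21)) (rp 5))) (rset 12 (rn 0)).

Definition main_loop : cmd := While (BNot (RLe (rv 12) (rn 1))) round.

Definition add_scaled_row : cmd :=
  For 3 nD
    (Seq (RSet 3 (nv 3) (RAdd (RGet 3 (nv 3))
           (RMul (RDiv (RGet 5 (nv 2)) (RNat nN)) (RGet 4 (nv 4)))))
         (incr 4)).

Definition finish : cmd :=
  Seq (For 3 nD (RSet 3 (nv 3) (RGet 2 (nv 3))))
  (Seq (nset 4 (NConst 0)) (For 2 nN add_scaled_row)).

Definition program : cmd :=
  Seq set_consts
  (Seq build (Seq set_power (Seq set_clock (Seq main_loop finish)))).

(** The least [K] with [2 d < 2^(2^K)], so that [2^K] is of order [log d]. *)
Definition power_of (d : nat) : nat := (trunc_log 2 (trunc_log 2 (2 * d))).+1.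

Lemma power_ofP d k : (0 < d)%N -> (2 ^ 2 ^ k <= 2 * d)%N = (k < power_of d)%N.
Proof.
move=> d0; rewrite /power_of; set a := trunc_log 2 (2 * d).
have a0 : (0 < a)%N.
  have := @trunc_log_ltn 2 (2 * d) isT; rewrite -/a.
  by case: a => // h; lia.
have h1 : (2 ^ a <= 2 * d)%N by apply: trunc_logP => //; lia.
have h2 : (2 * d < 2 ^ a.+1)%N by apply: trunc_log_ltn.
have h3 : (2 ^ trunc_log 2 a <= a)%N by apply: trunc_logP.
have h4 : (a < 2 ^ (trunc_log 2 a).+1)%N by apply: trunc_log_ltn.
rewrite ltnS; apply/idP/idP => h.
  rewrite leqNgt; apply/negP => lt.
  have : (2 ^ a.+1 <= 2 ^ 2 ^ k)%N.
    by rewrite leq_exp2l // (leq_trans h4) // leq_exp2l.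
  lia.
apply: leq_trans h1; rewrite leq_exp2l //; apply: leq_trans h3.
by rewrite leq_exp2l.
Qed.

Section MainSpecs.
Variables (R : realType) (N d : nat).
Hypotheses (N0 : (0 < N)%N) (d0 : (0 < d)%N).
Implicit Types s : state R.
Local Notation dims := (dims N d).
Local Notation pts := (@pts R N d).
Local Notation wts := (@wts R N).

Let F s i j : R := rmem s 1 (i * d + j)%N - (nmem s 1 (i * d + j)%N)%:R * rmem s 2 j.

Lemma build_row_spec s i : dims s -> nmem s 4 0 = (i * d)%N ->
  runs build_row s (200 * d) (fun s' =>
    [/\ nmem s' 4 0 = (i * d + d)%N,
        rmem s' 9 0 = \sum_(0 <= j < d) F s i j * F s i j,
        forall j, (j < d)%N -> rmem s' 4 (i * d + j)%N = F s i j
      & forall l, (l < i * d)%N -> rmem s' 4 l = rmem s 4 l]).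
Proof.
move=> ds k0.
apply: (@runs_seq _ _ _ _ 10 (d.+1 * 80) _ (fun s' => rmem s' 9 0 = 0));
  [exact: runs_sem| |lia].
move=> s1 f1 z1; have d1 := dims_frame ds f1 isT; have [g1 g2 _] := f1.
apply: (@runs_for _ (fun k s' =>
    [/\ nmem s' 4 0 = (i * d + k)%N,
        rmem s' 9 0 = \sum_(0 <= j < k) F s i j * F s i j,
        forall j, (j < k)%N -> rmem s' 4 (i * d + j)%N = F s i j
      & forall l, (l < i * d)%N -> rmem s' 4 l = rmem s 4 l]) _ _ _ d 60) => //.
- by move=> s' f; have [] := dims_frame d1 f isT.
- split=> //; rewrite /= ?/upd /= ?addn0 ?big_nil ?(g1 4%N isT) // => l _.
  by rewrite (g2 4%N isT).
- move=> k s' kd [h1 h2 _] jk [a1 a2 a3 a4]; apply: runs_sem => //.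
  have v : rmem s' 1 (nmem s' 4 0) - (nmem s' 1 (nmem s' 4 0))%:R * rmem s' 2 (nmem s' 3 0) = F s i k.
    rewrite /F jk a1 (h2 1%N isT) (h1 1%N isT) (h2 2%N isT).
    by rewrite (g2 1%N isT) (g1 1%N isT) (g2 2%N isT).
  split=> [||j|l lt].
  + by rewrite /= /upd /= a1 addn1 addnS.
  + rewrite /= /upd /= eqxx v big_nat_recr //=.
    by rewrite a2.
  + rewrite ltnS leq_eqVlt /= /upd /= => /orP[/eqP->|lt].
      by rewrite v a1 eqxx.
    by rewrite a1 eqn_add2l ltn_eqF // a3.
  + rewrite /= /upd /= a1 ltn_eqF ?a4 //; lia.
Qed.

Lemma build_spec s : dims s -> nmem s 4 0 = 0%N ->
  runs build s (600 * (N * d)) (fun s' =>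
    (forall i j, (i < N)%N -> (j < d)%N -> rmem s' 4 (i * d + j)%N = F s i j) /\
    (forall i, (i < N)%N -> rmem s' 5 i =
       if \sum_(0 <= j < d) F s i j * F s i j <= rmem s 11 0 then 1 else 0)).
Proof.
move=> ds k0.
apply: (@runs_weaken _ _ _ (N.+1 * (250 * d + 20)) _ (fun s' =>
    [/\ nmem s' 4 0 = (N * d)%N,
       forall i j, (i < N)%N -> (j < d)%N -> rmem s' 4 (i * d + j)%N = F s i j
     & forall i, (i < N)%N -> rmem s' 5 i =
       if \sum_(0 <= j < d) F s i j * F s i j <= rmem s 11 0 then 1 else 0])); last 2 first.
- nia.
- by move=> s' _ [_ h1 h2].
apply: (@runs_for _ (fun k s' =>
    [/\ nmem s' 4 0 = (k * d)%N,
       forall i j, (i < k)%N -> (j < d)%N -> rmem s' 4 (i * d + j)%N = F s i j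
     & forall i, (i < k)%N -> rmem s' 5 i =
       if \sum_(0 <= j < d) F s i j * F s i j <= rmem s 11 0 then 1 else 0]) _ _ _ N (250 * d)) => //.
- by move=> s' f; have [] := dims_frame ds f isT.
- move=> k s' kN f ik [a1 a2 a3]; have d' := dims_frame ds f isT; have [h1 h2 _] := f.
  have FE i j : F s' i j = F s i j by rewrite /F (h2 1%N isT) (h1 1%N isT) (h2 2%N isT).
  apply: (runs_seq (build_row_spec d' a1) (B2 := 40)); last by lia.
  move=> s1 f1 [b1 b2 b3 b4]; have [g1 g2 _] := f1.
  have e9 : rmem s1 9 0 = \sum_(0 <= j < d) F s k j * F s k j.
    by rewrite b2; apply: eq_bigr => j _; rewrite !FE.
  apply: runs_sem => //; split=> [|i j|i].
  + by rewrite /= /upd /=; case: ifP => _ /=; rewrite b1 mulSn addnC.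
  + rewrite ltnS leq_eqVlt => /orP[/eqP->|lt] jd.
      by rewrite /= /upd /=; case: ifP => _ /=; rewrite b3 // FE.
    rewrite /= /upd /=; case: ifP => _ /=; rewrite b4 ?a2 //; nia.
  + rewrite ltnS leq_eqVlt /= e9 (g2 11%N isT) (h2 11%N isT) => /orP[/eqP->|lt].
      by case: ifP => _ /=; rewrite upd_at (g1 2%N isT) ik eqxx.
    by case: ifP => _ /=; rewrite upd_at (g1 2%N isT) ik (ltn_eqF lt) (g2 5%N isT) a3.
Qed.

Lemma power_loop_spec s r m k : dims s -> (m + k).+1 = power_of d ->
  nmem s 5 0 = (2 ^ k)%N -> rmem s 20 0 = r ^+ (2 ^ k.+1) ->
  rmem s 17 0 = (2 ^ 2 ^ k.+1)%N%:R ->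
  runs (While (RLe (rv 17) (RMul (rn 2) (RNat nD)))
      (Seq (rset 17 (RMul (rv 17) (rv 17)))
      (Seq (rset 20 (RMul (rv 20) (rv 20)))
           (nset 5 (NAdd (nv 5) (nv 5)))))) s (m * 60 + 20) (fun s' =>
   nmem s' 5 0 = (2 ^ (power_of d).-1)%N /\ rmem s' 20 0 = r ^+ (2 ^ power_of d)).
Proof.
elim: m k s => [|m IH] k s ds mk e5 e20 e17;
  have [_ eD] := ds;
  have cE : beval s (RLe (rv 17) (RMul (rn 2) (RNat nD))) = (k.+1 < power_of d)%N
    by rewrite /= e17 eD -natrM ler_nat power_ofP.
  eexists; exists s; split; first by apply: ExWhileDone; rewrite cE -mk add0n ltnn.
    by [].
  by rewrite -mk add0n.
have c1 : beval s (RLe (rv 17) (RMul (rn 2) (RNat nD))) = true.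
  by rewrite cE -mk; apply/idP; lia.
have [t1 [s1 [h1 b1 [e5' e20' e17']]]] : runs (Seq (rset 17 (RMul (rv 17) (rv 17)))
      (Seq (rset 20 (RMul (rv 20) (rv 20)))
           (nset 5 (NAdd (nv 5) (nv 5))))) s 40 (fun s' =>
   [/\ nmem s' 5 0 = (2 ^ k.+1)%N, rmem s' 20 0 = r ^+ (2 ^ k.+2)
     & rmem s' 17 0 = (2 ^ 2 ^ k.+2)%N%:R]).
  apply: runs_sem => //; rewrite /= /upd /= e5 e20 e17; split.
  - by rewrite expnS mul2n addnn.
  - by rewrite -exprD [in RHS]expnS mul2n addnn.
  - by rewrite -natrM -expnD [in RHS](expnS 2 k.+1) mul2n addnn.
have d1 := dims_frame ds (exec_frame h1) isT.
have mk' : (m + k.+1).+1 = power_of d by rewrite -mk addnS.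
have [t2 [s2 [h2 b2 q2]]] := IH _ _ d1 mk' e5' e20' e17'.
eexists; exists s2; split; first exact: ExWhileStep c1 h1 h2.
  by rewrite /=; lia.
by [].
Qed.

Lemma set_power_spec s r : dims s ->
  (rmem s 11 0 + 2 * rmem s 10 0) / (180 * rmem s 10 0) = r ->
  runs set_power s (power_of d * 60 + 80) (fun s' =>
   [/\ nmem s' 5 0 = (2 ^ (power_of d).-1)%N, rmem s' 20 0 = r ^+ (2 ^ power_of d)
     & rmem s' 21 0 = r]).
Proof.
move=> ds hr.
apply: (@runs_seq _ _ _ _ 50 ((power_of d).-1 * 60 + 20) _ (fun s' =>
   [/\ nmem s' 5 0 = (2 ^ 0)%N, rmem s' 20 0 = r ^+ (2 ^ 1), rmem s' 21 0 = r
     & rmem s' 17 0 = (2 ^ 2 ^ 1)%N%:R])); last by lia.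
  by apply: runs_sem => //=; split; rewrite /upd //= hr.
move=> s1 f1 [e5 e20 e21 e17]; have {ds f1} d1 := dims_frame ds f1 isT.
apply: (runs_weaken (@power_loop_spec s1 r (power_of d).-1 0 d1 _ e5 e20 e17)) => //.
  by rewrite addn0.
by move=> s' [_ f _] [h1 h2]; split=> //; rewrite (f 21%N isT).
Qed.

Lemma finish_spec s : dims s -> runs finish s (400 * (N * d)) (fun s' =>
  forall j, (j < d)%N -> rmem s' 3 j = rmem s 2 j +
    \sum_(0 <= i < N) rmem s 5 i / N%:R * rmem s 4 (i * d + j)%N).
Proof.
move=> ds.
apply: (@runs_seq _ _ _ _ (d.+1 * 40) (300 * (N * d)) _ (fun s' =>
  forall j, (j < d)%N -> rmem s' 3 j = rmem s 2 j)); last by nia.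
  apply: (@runs_for _ (fun k s' => forall j, (j < k)%N ->
     rmem s' 3 j = rmem s 2 j) _ _ _ d 20) => //.
  - by move=> s' f; have [] := dims_frame ds f isT.
  - move=> k s' kd [h1 h2 _] jk a1; apply: runs_sem => // j.
    rewrite ltnS leq_eqVlt /= upd_at jk => /orP[/eqP->|lt].
      by rewrite eqxx (h2 2%N isT).
    by rewrite ltn_eqF // a1.
move=> s1 f1 e1; have d1 := dims_frame ds f1 isT; have [g1 g2 _] := f1.
apply: (@runs_seq _ _ _ _ 10 (N.+1 * (100 * d + 20)) _ (fun s' => nmem s' 4 0 = 0%N));
  [exact: runs_sem| |nia].
move=> s2 f2 q2; have d2 := dims_frame d1 f2 isT; have [k1 k2 _] := f2.
pose H i j := rmem s 5 i / N%:R * rmem s 4 (i * d + j)%N.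
have r3 : rmem s2 3 = rmem s1 3 by rewrite (k2 3%N isT).
have r4 : rmem s2 4 = rmem s 4 by rewrite (k2 4%N isT) (g2 4%N isT).
have r5 : rmem s2 5 = rmem s 5 by rewrite (k2 5%N isT) (g2 5%N isT).
apply: (@runs_weaken _ _ _ (N.+1 * (100 * d + 20)) _ (fun s' =>
  (forall j, (j < d)%N -> rmem s' 3 j = rmem s 2 j + \sum_(0 <= i < N) H i j) /\
  nmem s' 4 0 = (N * d)%N)) => //; last by move=> s' _ [].
apply: (@runs_for _ (fun k s' =>
  (forall j, (j < d)%N -> rmem s' 3 j = rmem s 2 j + \sum_(0 <= i < k) H i j) /\
  nmem s' 4 0 = (k * d)%N) _ _ _ N (100 * d)) => //.
- by move=> s' f; have [] := dims_frame d2 f isT.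
- by split=> // j jd; rewrite big_nil addr0 /= r3 e1.
- move=> k s' kN f ik [a1 a2]; have d' := dims_frame d2 f isT; have [h1 h2 _] := f.
  (* The test [j < d] always succeeds; it shapes the goal as the last instance of the inner
     invariant. *)
  apply: (@runs_weaken _ _ _ (d.+1 * 50) _ (fun s2 =>
    (forall j, (j < d)%N -> rmem s2 3 j = rmem s' 3 j + (if (j < d)%N then H k j else 0)) /\
    nmem s2 4 0 = (k * d + d)%N)); last 2 first.
  + lia.
  + move=> s3 _ [b1 b2]; split=> [j jd|]; last by rewrite /= /upd /= b2 mulSn addnC.
    by rewrite /= b1 // jd a1 // big_nat_recr //= addrA.
  apply: (@runs_for _ (fun l s2 =>
    (forall j, (j < d)%N -> rmem s2 3 j = rmem s' 3 j + (if (j < l)%N then H k j else 0)) /\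
    nmem s2 4 0 = (k * d + l)%N) _ _ _ d 30) => //.
  + by move=> s3 f3; have [] := dims_frame d' f3 isT.
  + by split=> [j jd|]; rewrite /= ?addr0 // /upd /= a2 addn0.
  + move=> l s3 ld [m1 m2 _] jl [b1 b2]; apply: runs_sem => //.
    split=> [j jd|]; last by rewrite /= /upd /= b2 addn1 addnS.
    have [iN _] := d'.
    rewrite /= upd_at jl b2 (m1 2%N isT) ik (m1 0%N isT) iN.
    rewrite (m2 5%N isT) (m2 4%N isT) (h2 5%N isT) (h2 4%N isT) r4 r5 !b1 //.
    case: (ltngtP j l) => [jl1|jl1|->].
    * by rewrite ltnS (ltnW jl1).
    * by rewrite ltnS leqNgt jl1.
    * by rewrite ?ltnn ltnS leqnn addr0.
Qed.

(** The hypotheses of the filter are asked only when the clock exceeds 1: they may fail in the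
    degenerate cases, where the loop does not run. *)
Lemma main_loop_spec s (eps eta2 B2 : R) (G : {set 'I_N}) K fuel :
  dims s -> nmem s 5 0 = (2 ^ K.-1)%N -> rmem s 0 0 = eps ->
  rmem s 10 0 = B2 -> rmem s 11 0 = norm_cap N eta2 B2 ->
  rmem s 16 0 = eta2 - 2 * B2 ->
  (1 < rmem s 12 0 -> [/\ stable_sample (pts s) eps eta2 B2 G,
     1 <= eps * N%:R, 0 < B2, valid G (wts s) & capped (pts s) eta2 B2 (wts s)]) ->
  rmem s 12 0 <= (6 / 5) ^+ fuel ->
  runs main_loop s (fuel * (3100 * (N * d * (2 ^ K.-1 + fuel_of N + 1))) + 20)
   (fun s' => wts s' = rounds (pts s) eps eta2 B2 K fuel (rmem s 12 0)
                         (wts s) (coins s)).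
Proof.
elim: fuel s => [|n IH] s ds hp he hB hL hsh hv hz.
  eexists; exists s; split; first by apply: ExWhileDone; rewrite /= hz.
    by apply: leq_trans (leq_addl _ _).
  by [].
have [z1|z1] := leP (rmem s 12 0) 1.
  eexists; exists s; split; first by apply: ExWhileDone; rewrite /= z1.
    by apply: leq_trans (leq_addl _ _).
  by rewrite /= z1.
have [SS eN1 B2p vw cw] := hv z1.
have hd u := let: And3 _ h _ := damp_spec u SS eN1 B2p vw cw in h.
have [t1 [s1 [h1 b1 [w1 c1 z1']]]] := round_spec N0 d0 ds hp he hB hL hsh hd.
have f1 := exec_frame h1; have d1 := dims_frame ds f1 isT; have [g1 g2 _] := f1.
have p1 : pts s1 = pts s by rewrite /pts (g2 4%N isT).
have [|||||||t2 [s2 [h2 b2 q2]]] := IH s1 d1.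
- by rewrite (g1 5%N isT).
- by rewrite (g2 0%N isT).
- by rewrite (g2 10%N isT).
- by rewrite (g2 11%N isT).
- by rewrite (g2 16%N isT).
- move=> _; rewrite p1 w1; split=> //; rewrite /step;
  by have [] := downweight_spec (sign_row R d (coins s) *m gram (pts s) eta2 B2 (wts s) ^+ (2 ^ K.-1)) SS eN1 B2p vw cw.
- by rewrite z1'; move: hz; rewrite exprS; lra.
have cT : beval s (BNot (RLe (rv 12) (rn 1))) = true by rewrite /= -ltNge.
eexists; exists s2; split; first exact: ExWhileStep cT h1 h2.
  move: b1 b2; have : (0 < N * d)%N by rewrite muln_gt0 N0 d0.
  rewrite /=; set q := (2 ^ K.-1 + fuel_of N + 1)%N.
  have : (0 < q)%N by rewrite /q addn1.
  set T := (N * d * q)%N; move=> q0 Nd0.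
  have T0 : (0 < T)%N by rewrite muln_gt0 Nd0.
  rewrite mulSn; lia.
by rewrite q2 /= leNgt z1 /= w1 c1 z1' p1.
Qed.

(** The power of [ratio], with exponent [2^K + 1], bounds the initial potential over its target; the
    division by [delta] prepares Markov's inequality. *)
Definition clock_init (ratio eps delta : R) K : R :=
  if 1 <= eps * N%:R then ratio ^+ (2 ^ K) * ratio / delta else 0.

Lemma program_spec s (eps eta beta rho delta : R) (Y : 'I_N -> 'rV[R]_d)
    (G : {set 'I_N}) fuel (eta2 B2 ratio z : R) K :
  dims s -> rmem s 0 0 = eps -> rmem s 0 2 = eta -> rmem s 0 3 = beta ->
  rmem s 0 4 = rho -> rmem s 0 5 = delta ->
  (forall (i : 'I_N) (j : 'I_d), Y i 0 j = F s i j) ->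
  eta2 = eta * eta -> B2 = 3 * (beta * beta + rho * rho) ->
  ratio = (norm_cap N eta2 B2 + 2 * B2) / (180 * B2) ->
  K = power_of d -> z = clock_init ratio eps delta K ->
  stable_sample Y eps eta2 B2 G -> z <= (6 / 5) ^+ fuel ->
  runs program s (5000 * (N * d * (2 ^ K.-1 + fuel_of N + 1) * fuel.+1)) (fun s' =>
    forall j : 'I_d, rmem s' 3 j = rmem s 2 j +
      \sum_i rounds Y eps eta2 B2 K fuel z (prune Y eta2 B2) (coins s) i / N%:R * Y i 0 j).
Proof.
move=> ds p0 p2 p3 p4 p5 hY e2 eB er eK ez SS hz.
set C := (3100 * (N * d * (2 ^ K.-1 + fuel_of N + 1)))%N.
have Kd : (2 ^ K.-1 <= 2 * d)%N.
  have [K1|K1] := ltnP 1 K; last first.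
    have -> : K = 1%N by apply/eqP; rewrite eqn_leq K1 eK.
    by rewrite expn0; lia.
  have h : (K.-1 < power_of d)%N by rewrite eK.
  have := power_ofP K.-1 d0; rewrite h => h2.
  by apply: leq_trans h2; apply: ltnW; apply: ltn_expl.
have KK : (K <= 2 ^ K.-1)%N.
  by have := ltn_expl K.-1 (isT : (1 < 2)%N); rewrite eK.
apply: (@runs_seq _ _ _ _ 60 (600 * (N * d) + (K * 60 + 80 + (60 + (fuel * C + 20 + 400 * (N * d))))) _
  (fun s' => [/\ rmem s' 10 0 = B2, rmem s' 11 0 = norm_cap N eta2 B2,
     rmem s' 16 0 = eta2 - 2 * B2 & nmem s' 4 0 = 0%N])).
- apply: runs_sem => //; have [eN _] := ds.
  by rewrite /= /upd /= p2 p3 p4 eN -e2 -eB.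
- move=> s1 f1 [c10 c11 c16 c4]; have d1 := dims_frame ds f1 isT; have [g1 g2 g3] := f1.
  have FE i j : F s1 i j = F s i j by rewrite /F (g2 1%N isT) (g1 1%N isT) (g2 2%N isT).
  apply: (runs_seq (build_spec d1 c4)) => // s2 f2 [y2 w2].
  have d2 := dims_frame d1 f2 isT; have [h1 h2 h3] := f2.
  have pY : pts s2 = Y.
    by apply: funext => i; apply/rowP => j; rewrite mxE y2 // FE hY.
  have wP : wts s2 = prune Y eta2 B2.
    apply: funext => i; rewrite /wts w2 // /prune c11; congr (if _ <= _ then _ else _).
    by rewrite big_mkord; apply: eq_bigr => j _; rewrite FE hY.
  have r2 : (rmem s2 11 0 + 2 * rmem s2 10 0) / (180 * rmem s2 10 0) = ratio.
    by rewrite (h2 11%N isT) (h2 10%N isT) c10 c11.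
  rewrite eK; apply: (runs_seq (set_power_spec d2 r2)) => // s3 f3 [e5 e20 e21].
  have d3 := dims_frame d2 f3 isT; have [k1 k2 k3] := f3; rewrite -eK in e5 e20 *.
  apply: (@runs_seq _ _ _ _ 60 (fuel * C + 20 + 400 * (N * d)) _ (fun s' => rmem s' 12 0 = z)) => //.
    apply: runs_sem => //=; have [eN _] := d3.
    have q0 : rmem s3 0 = rmem s 0 by rewrite (k2 0%N isT) (h2 0%N isT) (g2 0%N isT).
    rewrite q0 p0 eN ez /clock_init; case: ifP => _ //=.
    by rewrite /upd /= e20 e21 p5.
  move=> s4 f4 z4; have d4 := dims_frame d3 f4 isT; have [l1 l2 l3] := f4.
  have P4 : pts s4 = Y by rewrite -pY /pts (l2 4%N isT) (k2 4%N isT).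
  have W4 : wts s4 = prune Y eta2 B2 by rewrite -wP /wts (l2 5%N isT) (k2 5%N isT).
  have c4' : coins s4 = coins s by rewrite l3 // k3 // h3 // g3.
  have S4 : stable_sample (pts s4) eps eta2 B2 G by rewrite P4.
  have B20 : 0 <= B2 by case: SS => _ _ _ [].
  have main := @main_loop_spec s4 eps eta2 B2 G K fuel d4.
  have [|||||||t5 [s5 [h5 b5 q5]]] := main.
  + by rewrite (l1 5%N isT).
  + by rewrite (l2 0%N isT) (k2 0%N isT) (h2 0%N isT) (g2 0%N isT).
  + by rewrite (l2 10%N isT) (k2 10%N isT) (h2 10%N isT).
  + by rewrite (l2 11%N isT) (k2 11%N isT) (h2 11%N isT).
  + by rewrite (l2 16%N isT) (k2 16%N isT) (h2 16%N isT).
  + rewrite z4 ez /clock_init; case: ifP => [eN1|_]; last by rewrite ltr10.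
    move=> zgt; split=> //; rewrite ?W4 ?P4.
    (* If [B2 = 0], division by zero makes [ratio] and hence the clock zero, so it could not exceed
       1. *)
    * rewrite lt_neqAle B20 andbT; apply/eqP => B0; move: zgt.
      have -> : ratio = 0 by rewrite er -B0 !mulr0 invr0 mulr0.
      by rewrite mulr0 mul0r ltr10.
    * exact: valid_prune SS.
    * exact: capped_prune.
  + by rewrite z4.
  have f5 := exec_frame h5; have d5 := dims_frame d4 f5 isT; have [m1 m2 m3] := f5.
  apply: (@runs_seq _ _ _ _ (fuel * C + 20) _ _ (fun s' => s' = s5)); last exact: leqnn.
    by exists t5, s5.
  move=> s6 _ ->; apply: (runs_weaken (finish_spec d5)) => // s7 _ h j.
  rewrite h // (m2 2%N isT) (l2 2%N isT) (k2 2%N isT) (h2 2%N isT) (g2 2%N isT).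
  congr (_ + _); rewrite big_mkord; apply: eq_bigr => i _.
  rewrite -[rmem s5 5 i]/(wts s5 i) q5 P4 W4 z4 c4'; congr (_ * _).
  by rewrite (m2 4%N isT) -P4 mxE.
- set q := (2 ^ K.-1 + fuel_of N + 1)%N in C *.
  have q0 : (2 ^ K.-1 < q)%N by rewrite /q; lia.
  have : (0 < N * d)%N by rewrite muln_gt0 N0.
  have : (K <= q)%N by lia.
  rewrite /C; move: (N * d)%N => M Kq M0.
  have h1 : (q <= M * q)%N by nia.
  have h2 : (M <= M * q)%N by nia.
  have -> : (M * q * fuel.+1 = M * q + M * q * fuel)%N by rewrite mulnS.
  by move: (M * q)%N h1 h2 => T h1 h2; nia.
Qed.

End MainSpecs.


(** * From goodness to stability *)

Section Norms.
Variables (R : realType) (d : nat).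
Implicit Types (x : 'rV[R]_d) (A : 'M[R]_d).

Lemma l2norm_sqr x : l2norm x ^+ 2 = dot x x.
Proof.
rewrite /l2norm sqr_sqrtr; first by apply: eq_bigr => j _; rewrite expr2.
by apply: sumr_ge0 => j _; rewrite sqr_ge0.
Qed.

Lemma l2norm_ge0 x : 0 <= l2norm x. Proof. exact: sqrtr_ge0. Qed.

Lemma l2norm_le_sqr x c : l2norm x <= c -> dot x x <= c ^+ 2.
Proof.
move=> h; rewrite -l2norm_sqr lerXn2r ?nnegrE ?l2norm_ge0 //.
exact: le_trans (l2norm_ge0 x) h.
Qed.

Lemma opnorm_form A c x : opnorm A <= c -> `|dot (x *m A) x| <= c * dot x x.
Proof.
move=> hc; have [x0|x0] := eqVneq (dot x x) 0.
  have := dot_CS (x *m A) x; rewrite x0 !mulr0 => h.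
  have /eqP : dot (x *m A) x ^+ 2 = 0 by apply/eqP; rewrite eq_le h sqr_ge0.
  by rewrite sqrf_eq0 => /eqP->; rewrite normr0.
have xp : 0 < dot x x by rewrite lt_neqAle eq_sym x0 dotxx_ge0.
pose r := l2norm x.
have r2 : r ^+ 2 = dot x x := l2norm_sqr x.
have r0 : 0 < r.
  rewrite lt_neqAle l2norm_ge0 andbT eq_sym; apply: contraNneq x0 => e.
  by rewrite -r2 e expr0n.
pose y := r^-1 *: x.
have y1 : dot y y = 1 by rewrite dotZl dotZr -r2; field; rewrite gt_eqF.
have ly : l2norm y = 1.
  by apply/eqP; rewrite -(@eqrXn2 _ 2) ?l2norm_ge0 // l2norm_sqr y1 expr1n.
(* [sup] dominates the elements only of a set that is bounded above; the Frobenius norm bounds this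
   one. *)
have hub : has_ubound [set l2norm (z *m A) | z in [set z : 'rV[R]_d | l2norm z <= 1]]%classic.
  exists (Num.sqrt (\tr (A * A^T))) => _ [z /= hz <-].
  have hz2 := l2norm_le_sqr hz; rewrite expr1n in hz2.
  have t0 : 0 <= \tr (A * A^T).
    have -> : A * A^T = A * 1%:M * A^T by rewrite -!mulmxE mulmx1.
    by apply: trace_congr_ge0; apply: psd_scalar.
  rewrite -(@ler_pXn2r _ 2) ?nnegrE ?l2norm_ge0 ?sqrtr_ge0 //.
  rewrite l2norm_sqr sqr_sqrtr //; apply: le_trans (dot_mulmx_le z A) _.
  by rewrite ler_piMl.
have hy : l2norm (y *m A) <= c.
  apply: le_trans hc; apply: ub_le_sup => //; exists y => //=.
  by rewrite ly.
have c0 : 0 <= c by apply: le_trans hy; apply: l2norm_ge0.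
have hd : `|dot (y *m A) y| <= c.
  rewrite -(@ler_pXn2r _ 2) ?nnegrE // real_normK ?num_real //.
  apply: le_trans (dot_CS _ _) _; rewrite y1 mulr1.
  exact: l2norm_le_sqr.
have -> : dot (x *m A) x = r ^+ 2 * dot (y *m A) y.
  have -> : x = r *: y by rewrite scalerA mulfV ?scale1r // gt_eqF.
  rewrite -scalemxAl dotZl dotZr -/y; rewrite /y -scalemxAl !dotZl !dotZr.
  by field; rewrite gt_eqF.
by rewrite normrM ger0_norm ?sqr_ge0 // mulrC -r2 ler_wpM2r // sqr_ge0.
Qed.

Lemma weighted_CS (I : finType) (P : pred I) (a b : I -> R) :
  (forall i, P i -> 0 <= a i) ->
  (\sum_(i | P i) a i * b i) ^+ 2 <=
  (\sum_(i | P i) a i) * (\sum_(i | P i) a i * b i ^+ 2).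
Proof.
move=> a0; rewrite mulrC; apply: discriminant_le => [|s]; first exact: sumr_ge0.
have : 0 <= \sum_(i | P i) a i * (b i + s) ^+ 2.
  by apply: sumr_ge0 => i /a0 ai; rewrite mulr_ge0 ?sqr_ge0.
congr (_ <= _); rewrite !mulr_sumr -!big_split /=.
by apply: eq_bigr => i _; ring.
Qed.

End Norms.

Section Reduction.
Variables (R : realType) (N d : nat) (X : 'M[option R]_(N, d)) (X0 : 'M[R]_(N, d)).
Variables (eps gs eta beta rho : R) (nu mu : 'rV[R]_d) (G : {set 'I_N}).

Let v := nu - mu.
Let dev i : 'rV[R]_d := row i (adjusted X X0 mu) - mu.
Let g j : R := obs_frac X G j.

(** This is [X^(i,nu) - nu]: at a missing entry [nu] cancels. *)
Definition residual i : 'rV[R]_d :=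
  \row_j (X0 i j - (nat_of_bool (isSome (X i j)))%:R * nu 0 j).

Let vobs i : 'rV[R]_d := \row_j ((nat_of_bool (isSome (X i j)))%:R * v 0 j).

Lemma residualE i : residual i = dev i - vobs i.
Proof.
apply/rowP => j; rewrite !mxE; case: (X i j) => [x|] /=; ring.
Qed.

Lemma sum_observed (f : 'I_N -> R) j :
  \sum_(i in G) (nat_of_bool (isSome (X i j)))%:R * f i =
  \sum_(i in G :&: observed X j) f i.
Proof.
rewrite [RHS](eq_bigl (fun i => (i \in G) && isSome (X i j))); last first.
  by move=> i; rewrite !inE.
rewrite big_mkcondr; apply: eq_bigr => i _.
by case: (X i j) => [x|]; rewrite /= ?mul1r ?mul0r.
Qed.

(** After Cauchy-Schwarz at each point, exchanging the sums counts [v_j^2] once for every good point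
    that observes [j]. *)
Lemma vobs_moment (c : R) (x : 'rV[R]_d) : 0 <= c ->
  \sum_(i in G) c * dot (vobs i) x ^+ 2 <=
  dot x x * \sum_j c * #|G :&: observed X j|%:R * v 0 j ^+ 2.
Proof.
move=> c0; apply: le_trans (_ : \sum_(i in G) c * (dot (vobs i) (vobs i) * dot x x) <= _).
  by apply: ler_sum => i _; rewrite ler_wpM2l // dot_CS.
under eq_bigr => i _ do rewrite mulrA.
rewrite -mulr_suml mulrC ler_wpM2l ?dotxx_ge0 //.
have -> : \sum_(i in G) c * dot (vobs i) (vobs i) =
   \sum_j \sum_(i in G) (nat_of_bool (isSome (X i j)))%:R * (c * v 0 j ^+ 2).
  rewrite exchange_big /=; apply: eq_bigr => i _; rewrite mulr_sumr.
  apply: eq_bigr => j _; rewrite !mxE; case: (X i j) => [y|] /=; ring.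
apply: ler_sum => j _; rewrite sum_observed sumr_const.
by rewrite -[c * v 0 j ^+ 2 *+ _]mulr_natl; lra.
Qed.

Lemma dot_outer_sum (w : 'I_N -> R) (c : R) (x : 'rV[R]_d) :
  dot (x *m (\sum_(i in G) w i *: ((dev i)^T *m dev i) - c%:M)) x =
  \sum_(i in G) w i * dot (dev i) x ^+ 2 - c * dot x x.
Proof.
rewrite mulmxBr mul_mx_scalar dotDl dotNl dotZl mulmx_sumr dot_suml.
congr (_ - _); apply: eq_bigr => i _.
rewrite -scalemxAr dotZl mulmxA; congr (_ * _).
have -> : x *m (dev i)^T = (dot (dev i) x)%:M by rewrite dotC dotE -mx11_scalar.
by rewrite mul_scalar_mx dotZl expr2.
Qed.

Hypothesis N0 : (0 < N)%N.

Definition regime : Prop :=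
  [/\ 0 < eps < 1, 240 * 200 * eps <= gs <= 1, 0 <= eta,
      4 * eta ^+ 2 * eps * ln (1 / eps) <= beta ^+ 2
    & good_witness X X0 eps gs eta beta mu G /\ wnorm g v <= rho].

Let B2 := 3 * (beta * beta + rho * rho).

Lemma regimeP : regime ->
  [/\ 0 < eps, eps <= 1 / 100, 2 * eps * eta ^+ 2 <= beta ^+ 2,
      \sum_j g j * v 0 j ^+ 2 <= rho ^+ 2 /\ 0 <= \sum_j g j * v 0 j ^+ 2
    & forall j, 240 * 200 * eps <= g j /\ g j <= 1].
Proof.
case=> /andP[e0 e1] /andP[h1 h2] eta0 hK [[cG hg _] hr].
have g1 j : g j <= 1.
  rewrite /g /obs_frac; have [->|G0] := eqVneq #|G| 0%N; first by rewrite invr0 mulr0.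
  rewrite ler_pdivrMr ?ltr0n ?lt0n // mul1r ler_nat subset_leq_card //.
  exact: finset.subsetIl.
have g0 j : 240 * 200 * eps <= g j by apply: le_trans (hg j).
have s0 : 0 <= \sum_j g j * v 0 j ^+ 2.
  by apply: sumr_ge0 => j _; rewrite mulr_ge0 ?sqr_ge0 // /g /obs_frac divr_ge0.
split=> //.
- by lra.
(* [ln (1 / eps) >= 1 - eps >= 1 / 2], so the constant 4 of the regime becomes 2. *)
- have h : ln eps <= eps - 1.
    have := @le_ln1Dx R (eps - 1); have -> : 1 + (eps - 1) = eps by ring.
    by apply; lra.
  have hl : ln (1 / eps) = - ln eps by rewrite div1r lnV.
  have hp : 0 <= 4 * eta ^+ 2 * eps by rewrite !mulr_ge0 ?sqr_ge0 // ltW.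
  have : 4 * eta ^+ 2 * eps * (1 / 2) <= 4 * eta ^+ 2 * eps * ln (1 / eps).
    by rewrite ler_wpM2l // hl; lra.
  lra.
- split=> //; have r0 : 0 <= rho by apply: le_trans hr; apply: sqrtr_ge0.
  have : wnorm g v ^+ 2 <= rho ^+ 2 by rewrite lerXn2r ?nnegrE ?sqrtr_ge0.
  by rewrite /wnorm sqr_sqrtr.
Qed.

Lemma card_G0 : regime -> 0 < #|G|%:R :> R /\ N%:R <= 2 * #|G|%:R :> R.
Proof.
move=> RG; have [e0 e1 _ _ _] := regimeP RG; case: RG => _ _ _ _ [[cG _ _] _].
have n0 : 0 < N%:R :> R by rewrite ltr0n.
have h : 1 / 2 * N%:R <= (1 - eps) * N%:R by rewrite ler_wpM2r ?(ltW n0) //; lra.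
split; lra.
Qed.

Lemma obs_fracE j : regime -> #|G :&: observed X j|%:R = g j * #|G|%:R.
Proof. by move=> /card_G0[G0 _]; rewrite /g /obs_frac mulfVK // gt_eqF. Qed.

(** Cauchy-Schwarz between [Q1] and [Q3] would bound the cross term [Q2] only to the order of
    [eta rho], and [eta] may be much larger than [beta]. Grouping [Q2] by coordinates instead
    produces the sums over [G :&: observed X j], of norm at most [beta sqrt(eps)]; as [eps <= g j],
    this gives [|Q2| <= beta rho |x|^2]. The errors add up to [beta^2 + (beta^2 + rho^2) + 2 rho^2],
    within [B2]. *)
Lemma residual_stable : regime ->
  stable_sample residual eps (eta * eta) B2 G.
Proof.
move=> RG; have [e0 e1 h2 [hr hr0] hg] := regimeP RG.
have [G0 NG] := card_G0 RG.
have [_ _ _ _ [[cG _ gw] _]] := RG.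
have n0 : 0 < N%:R :> R by rewrite ltr0n.
have b2 : 0 <= beta ^+ 2 := sqr_ge0 beta.
have rr2 : 0 <= rho ^+ 2 := sqr_ge0 rho.
have BE : B2 = 3 * (beta ^+ 2 + rho ^+ 2) by rewrite /B2 !expr2.
split=> //; first by apply/andP; split=> //; lra.
  by rewrite -expr2 sqr_ge0 BE; split=> //; lra.
move=> w cw x; have [hm hc ho] := gw w cw; have [[w0 _ _] wcap] := cw.
rewrite -expr2 BE; set U := dot x x.
have U0 : 0 <= U := dotxx_ge0 x.
have /= := opnorm_form x hc; rewrite dot_outer_sum.
set Q1 := \sum_(i in G) _ => hQ1.
pose Q2 := \sum_(i in G) w i * (dot (dev i) x * dot (vobs i) x).
pose Q3 := \sum_(i in G) w i * dot (vobs i) x ^+ 2.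
have -> : \sum_(i in G) w i * dot (residual i) x ^+ 2 = Q1 - 2 * Q2 + Q3.
  rewrite /Q1 /Q2 /Q3 mulr_sumr -sumrB -big_split /=; apply: eq_bigr => i _.
  by rewrite residualE dotDl dotNl; ring.
have Q30 : 0 <= Q3.
  by apply: sumr_ge0 => i _; rewrite mulr_ge0 ?sqr_ge0.
have Q3le : Q3 <= 2 * rho ^+ 2 * U.
  set c := 1 / ((1 - 3 * eps) * N%:R) in wcap.
  have p0 : 0 < (1 - 3 * eps) * N%:R by rewrite mulr_gt0 //; lra.
  have c0 : 0 <= c by rewrite divr_ge0 // ltW.
  have cG2 : c * #|G|%:R <= 2.
    rewrite /c mulrAC ler_pdivrMr // mul1r.
    have : 1 / 2 * N%:R <= (1 - 3 * eps) * N%:R.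
      by rewrite ler_wpM2r ?(ltW n0) //; lra.
    have : #|G|%:R <= N%:R :> R by rewrite ler_nat -[leqRHS]card_ord max_card.
    lra.
  apply: le_trans (_ : \sum_(i in G) c * dot (vobs i) x ^+ 2 <= _).
    by apply: ler_sum => i _; rewrite ler_wpM2r ?sqr_ge0.
  apply: le_trans (vobs_moment x c0) _; rewrite mulrC ler_wpM2r //.
  have -> : \sum_j c * #|G :&: observed X j|%:R * v 0 j ^+ 2 =
      c * #|G|%:R * (\sum_j g j * v 0 j ^+ 2).
    by rewrite mulr_sumr; apply: eq_bigr => j _; rewrite obs_fracE //; ring.
  apply: le_trans (_ : 2 * (\sum_j g j * v 0 j ^+ 2) <= _); first by rewrite ler_wpM2r.
  by rewrite ler_wpM2l.
have Q2le : `|Q2| <= (beta ^+ 2 + rho ^+ 2) / 2 * U.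
  pose a j := \sum_(i in G :&: observed X j) w i *: dev i.
  have Q2E : Q2 = \sum_j 1 * ((x 0 j) * (v 0 j * dot (a j) x)).
    rewrite /Q2 /a; under [RHS]eq_bigr => j _.
      rewrite dot_suml (eq_bigr (fun i => w i * dot (dev i) x)); last first.
        by move=> i _; rewrite dotZl.
      rewrite -sum_observed mul1r 2!mulr_sumr; over.
    rewrite exchange_big /=; apply: eq_bigr => i _.
    rewrite [dot (vobs i) x]/dot 2!mulr_sumr; apply: eq_bigr => j _.
    by rewrite mxE; ring.
  have CS : Q2 ^+ 2 <= U * \sum_j (v 0 j * dot (a j) x) ^+ 2.
    pose X1 : 'rV[R]_d := \row_j (v 0 j * dot (a j) x).
    have -> : Q2 = dot x X1.
      rewrite Q2E [RHS]/dot; apply: eq_bigr => j _; rewrite mul1r; congr (_ * _).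
      by rewrite [RHS]mxE.
    apply: le_trans (dot_CS _ _) _; rewrite ler_wpM2l //.
    by apply: ler_sum => j _; rewrite mxE expr2.
  have aj j : dot (a j) x ^+ 2 <= beta ^+ 2 * eps * U.
    apply: le_trans (dot_CS _ _) _; rewrite ler_wpM2r //.
    by have := l2norm_le_sqr (ho j); rewrite exprMn sqr_sqrtr // ltW.
  have sv : eps * \sum_j v 0 j ^+ 2 <= rho ^+ 2.
    apply: le_trans hr; rewrite mulr_sumr; apply: ler_sum => j _.
    by rewrite ler_wpM2r ?sqr_ge0 //; have [] := hg j; lra.
  have h : \sum_j (v 0 j * dot (a j) x) ^+ 2 <= beta ^+ 2 * rho ^+ 2 * U.
    apply: le_trans (_ : \sum_j v 0 j ^+ 2 * (beta ^+ 2 * eps * U) <= _).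
      by apply: ler_sum => j _; rewrite exprMn ler_wpM2l ?sqr_ge0.
    rewrite -mulr_suml.
    have : beta ^+ 2 * U * (eps * \sum_j v 0 j ^+ 2) <= beta ^+ 2 * U * rho ^+ 2.
      by rewrite ler_wpM2l // mulr_ge0.
    lra.
  have c0 : 0 <= (beta ^+ 2 + rho ^+ 2) / 2 * U by rewrite mulr_ge0 // divr_ge0 // addr_ge0.
  rewrite -(@ler_pXn2r _ 2) ?nnegrE // real_normK ?num_real //.
  apply: le_trans CS _; apply: le_trans (ler_wpM2l U0 h) _.
  rewrite exprMn.
  have -> : U * (beta ^+ 2 * rho ^+ 2 * U) = beta ^+ 2 * rho ^+ 2 * U ^+ 2 by ring.
  rewrite ler_wpM2r ?sqr_ge0 //; have := sqr_ge0 (beta ^+ 2 - rho ^+ 2); lra.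
have b2U : 0 <= beta ^+ 2 * U := mulr_ge0 b2 U0.
have r2U : 0 <= rho ^+ 2 * U := mulr_ge0 rr2 U0.
rewrite -/U in hQ1.
move: hQ1 Q2le; rewrite !ler_norml => /andP[a1 a2] /andP[a3 a4].
by apply/andP; split; lra.
Qed.

(** Testing [e] against itself gives [|e|^2 = P1 + P2 + P3]: the bad points, of mass at most [eps];
    the mean of the good deviations; and the good weight lost relative to the uniform weight
    [1 / #|G|], at most [2 eps] in all. Each square is [O(eps (beta^2 + rho^2)) |e|^2], and
    [3 (360 * 3 + 2) < 4000]. *)
Lemma estimate_error w e : regime -> valid G w ->
  (forall x, \sum_(i in ~: G) w i / N%:R * dot (residual i) x ^+ 2 <=
             360 * B2 * dot x x) ->
  e = \sum_i (w i / N%:R) *: residual i + \row_j (g j * v 0 j) ->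
  dot e e <= 40 * 100 * eps * (beta ^+ 2 + rho ^+ 2).
Proof.
move=> RG vw hbad eE; have [e0 e1 h2 [hr hr0] hg] := regimeP RG.
have SS := residual_stable RG.
have [G0 NG] := card_G0 RG; have [_ _ _ _ [[cG _ gw] _]] := RG.
have n0 : 0 < N%:R :> R by rewrite ltr0n.
have b2 : 0 <= beta ^+ 2 := sqr_ge0 beta.
have rr2 : 0 <= rho ^+ 2 := sqr_ge0 rho.
have BE : B2 = 3 * (beta ^+ 2 + rho ^+ 2) by rewrite /B2 !expr2.
have GN : #|G|%:R <= N%:R :> R by rewrite ler_nat -[leqRHS]card_ord max_card.
have /andP[m1 m2] := valid_mass SS vw.
set W := \sum_(i in G) w i in m1 m2.
have w0 i : 0 <= w i by case/andP: (vw.1 i).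
have w1 i : w i <= 1 by case/andP: (vw.1 i).
pose U := dot e e; have U0 : 0 <= U := dotxx_ge0 e.
pose c i := #|G|%:R^-1 - w i / N%:R.
pose P1 := \sum_(i in ~: G) w i / N%:R * dot (residual i) e.
pose P2 := \sum_(i in G) w i / N%:R * dot (dev i) e.
pose P3 := \sum_(i in G) c i * dot (vobs i) e.
have gvE : dot (\row_j (g j * v 0 j)) e = \sum_(i in G) #|G|%:R^-1 * dot (vobs i) e.
  under [RHS]eq_bigr => i _ do rewrite /dot mulr_sumr.
  rewrite exchange_big /=; apply: eq_bigr => j _; rewrite mxE.
  rewrite [RHS](eq_bigr (fun i => (nat_of_bool (isSome (X i j)))%:R *
     (#|G|%:R^-1 * (v 0 j * e 0 j)))); last by move=> i _; rewrite mxE; ring.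
  rewrite sum_observed sumr_const -[_ *+ _]mulr_natl obs_fracE //.
  by field; rewrite gt_eqF.
have UE : U = P1 + P2 + P3.
  rewrite /U {1}eE dotDl gvE dot_suml (sum_setC G) /P1 /P2 /P3 addrAC addrC -addrA.
  congr (_ + _); first by apply: eq_bigr => i _; rewrite dotZl.
  rewrite -!big_split /=; apply: eq_bigr => i _.
  by rewrite dotZl residualE dotDl dotNl /c; ring.
have P1le : P1 ^+ 2 <= 360 * eps * B2 * U.
  have a0 i : i \in ~: G -> 0 <= w i / N%:R by rewrite divr_ge0 // ltW.
  apply: le_trans (weighted_CS (fun i => dot (residual i) e) a0) _.
  have ha : \sum_(i in ~: G) w i / N%:R <= eps.
    rewrite -mulr_suml ler_pdivrMr //; apply: le_trans (card_bad SS).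
    by rewrite -sum1_card natr_sum; apply: ler_sum.
  apply: le_trans (_ : eps * (360 * B2 * U) <= _); last by lra.
  rewrite ler_pM ?hbad //; first exact: sumr_ge0.
  by apply: sumr_ge0 => i /a0 wi; rewrite mulr_ge0 ?sqr_ge0.
have W0 : 0 < W.
  by apply: lt_le_trans m1; rewrite mulr_gt0 //; lra.
have P2le : P2 ^+ 2 <= beta ^+ 2 * eps * U.
  pose w' i := if i \in G then w i / W else 0.
  have cw : capped_simplex G ((1 - 3 * eps) * N%:R) w'.
    split; first split.
    - by move=> i; rewrite /w'; case: ifP => // _; rewrite divr_ge0 // ltW.
    - by rewrite -big_mkcond /= -mulr_suml -/W; field; rewrite gt_eqF.
    - by move=> i /negbTE; rewrite /w' => ->.
    - have p0 : 0 < (1 - 3 * eps) * N%:R by rewrite mulr_gt0 //; lra.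
      have pW : (1 - 3 * eps) * N%:R <= W.
        by apply: le_trans m1; rewrite ler_wpM2r ?(ltW n0) //; lra.
      move=> i; rewrite /w'; case: ifP => _; last by rewrite divr_ge0 // ltW.
      rewrite ler_pdivrMr // mulrAC mul1r ler_pdivlMr //.
      by apply: le_trans pW; rewrite ler_piMl // ltW.
  have [hD _ _] := gw w' cw.
  set D := \sum_(i in G) w' i *: (row i (adjusted X X0 mu) - mu) in hD.
  have -> : P2 = W / N%:R * dot D e.
    rewrite /D dot_suml mulr_sumr; apply: eq_bigr => i iG.
    by rewrite dotZl /w' iG; field; rewrite !gt_eqF.
  rewrite exprMn; apply: le_trans (_ : 1 * dot D e ^+ 2 <= _).
    rewrite ler_wpM2r ?sqr_ge0 // expr_le1 // ?divr_ge0 ?(ltW W0) ?(ltW n0) //.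
    by rewrite ler_pdivrMr // mul1r.
  rewrite mul1r; apply: le_trans (dot_CS _ _) _; rewrite ler_wpM2r //.
  by have := l2norm_le_sqr hD; rewrite exprMn sqr_sqrtr // ltW.
have P3le : P3 ^+ 2 <= 2 * eps * rho ^+ 2 * U.
  have c0 i : i \in G -> 0 <= c i.
    move=> _; rewrite /c subr_ge0; apply: le_trans (_ : 1 / N%:R <= _).
      by rewrite ler_wpM2r ?invr_ge0 // ltW.
    by rewrite mul1r lef_pV2 ?posrE.
  apply: le_trans (weighted_CS (fun i => dot (vobs i) e) c0) _.
  have hc : \sum_(i in G) c i <= 2 * eps.
    rewrite sumrB sumr_const -mulr_suml -/W -[_ *+ _]mulr_natl mulfV ?gt_eqF //.
    have : 1 - 2 * eps <= W / N%:R by rewrite ler_pdivlMr.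
    lra.
  have hq : \sum_(i in G) c i * dot (vobs i) e ^+ 2 <= rho ^+ 2 * U.
    have i0 : 0 <= #|G|%:R^-1 :> R by rewrite invr_ge0 ltW.
    apply: le_trans (_ : \sum_(i in G) #|G|%:R^-1 * dot (vobs i) e ^+ 2 <= _).
      apply: ler_sum => i _; rewrite ler_wpM2r ?sqr_ge0 // /c.
      by rewrite lerBlDr lerDl divr_ge0 // ltW.
    apply: le_trans (vobs_moment e i0) _; rewrite mulrC ler_wpM2r //.
    apply: le_trans hr; apply: ler_sum => j _.
    have -> // : #|G|%:R^-1 * #|G :&: observed X j|%:R = g j.
    by rewrite mulrC.
  have := ler_pM (sumr_ge0 _ c0) _ hc hq; rewrite -!mulrA; apply.
  by apply: sumr_ge0 => i /c0 ci; rewrite mulr_ge0 ?sqr_ge0.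
have hU : U * U <= 40 * 100 * eps * (beta ^+ 2 + rho ^+ 2) * U.
  have h3 : U ^+ 2 <= 3 * (P1 ^+ 2 + P2 ^+ 2 + P3 ^+ 2).
    rewrite {1}UE; have := sqr_ge0 (P1 - P2); have := sqr_ge0 (P1 - P3).
    have := sqr_ge0 (P2 - P3); lra.
  have eb : 0 <= eps * beta ^+ 2 * U := mulr_ge0 (mulr_ge0 (ltW e0) b2) U0.
  have er : 0 <= eps * rho ^+ 2 * U := mulr_ge0 (mulr_ge0 (ltW e0) rr2) U0.
  rewrite -expr2; apply: le_trans h3 _; move: P1le; rewrite BE; lra.
have [U00|Un0] := eqVneq U 0.
  by rewrite -/U U00 mulr_ge0 ?addr_ge0 // !mulr_ge0 // ltW.
by move: hU; rewrite ler_pM2r // lt_neqAle eq_sym Un0.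
Qed.

(** In a coordinate with [t = g j], the new error is [(1 - t) a + b] with [a] from [v] and [b] from
    [e]. The pointwise inequality [k1] leaves [t (1 - t / 2) a^2] at the price of [3 b^2], and
    [t >= gs] gives a uniform gain. *)
Lemma progress w : regime -> valid G w ->
  (forall x, \sum_(i in ~: G) w i / N%:R * dot (residual i) x ^+ 2 <=
             360 * B2 * dot x x) ->
  wnorm g (nu + \sum_i (w i / N%:R) *: residual i - mu) ^+ 2 <=
  120 * 100 * beta ^+ 2 * eps + (1 - 1 / 4 * gs) * rho ^+ 2.
Proof.
move=> RG vw hbad; set e := \sum_i (w i / N%:R) *: residual i + \row_j (g j * v 0 j).
have he := estimate_error RG vw hbad (erefl e); have [e0 e1 h2 [hr hr0] hg] := regimeP RG.
have [_ /andP[hgs gs1] _ _ [[_ hgj _] _]] := RG.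
have rr2 : 0 <= rho ^+ 2 := sqr_ge0 rho.
have -> : nu + \sum_i (w i / N%:R) *: residual i - mu =
    v - \row_j (g j * v 0 j) + e.
  by rewrite /e [X in _ = _ + X]addrC addrA subrK /v addrAC.
rewrite /wnorm sqr_sqrtr; last first.
  apply: sumr_ge0 => j _; rewrite mulr_ge0 ?sqr_ge0 //.
  by have [h _] := hg j; lra.
apply: le_trans (_ : \sum_j ((1 - gs / 2) * (g j * v 0 j ^+ 2) +
    3 * (e 0 j * e 0 j)) <= _).
  apply: ler_sum => j _.
  have -> : (v - \row_j (g j * v 0 j) + e) 0 j = v 0 j - g j * v 0 j + e 0 j.
    rewrite mxE; congr (_ + _); rewrite mxE; congr (_ + _).
    by rewrite mxE; congr (- _); rewrite mxE.
  move: (v 0 j) (e 0 j) => a b.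
  have [gj0 gj1] := hg j; have gjs : gs <= g j := hgj j.
  move: (g j) gj0 gj1 gjs => t t0 t1 ts; have {}t0 : 0 <= t by lra.
  have k1 : t * (a - t * a + b) ^+ 2 <= (t - t ^+ 2 / 2) * a ^+ 2 + 3 * b ^+ 2.
    (* Completion of the square; the coefficient left on [b^2] is at least [1 + t], because
       [(1 - t)^2 <= 1 - t]. *)
    have -> : (t - t ^+ 2 / 2) * a ^+ 2 + 3 * b ^+ 2 = t * (a - t * a + b) ^+ 2 +
      ((t * a / 1 - 2 * (1 - t) * b) ^+ 2 / 2 + t ^+ 2 * (1 - t) * a ^+ 2 +
       (3 - t - 2 * (1 - t) ^+ 2) * b ^+ 2) by field.
    rewrite lerDl; apply: addr_ge0; first apply: addr_ge0.
    - by rewrite divr_ge0 // sqr_ge0.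
    - by rewrite mulr_ge0 ?sqr_ge0 // mulr_ge0 ?sqr_ge0 // subr_ge0.
    - rewrite mulr_ge0 ?sqr_ge0 //.
      have : (1 - t) ^+ 2 <= (1 - t) * 1 by rewrite expr2 ler_wpM2l //; lra.
      lra.
  apply: le_trans k1 _; rewrite -[b * b]expr2.
  have : gs * t * a ^+ 2 <= t * t * a ^+ 2.
    by rewrite ler_wpM2r ?sqr_ge0 // ler_wpM2r.
  lra.
rewrite big_split /= -!mulr_sumr -[\sum_j e 0 j * _]/(dot e e).
have k1 : (1 - gs / 2) * (\sum_j g j * v 0 j ^+ 2) <= (1 - gs / 2) * rho ^+ 2.
  by rewrite ler_wpM2l //; lra.
have k2 : 240 * 200 * eps * rho ^+ 2 <= gs * rho ^+ 2 by rewrite ler_wpM2r.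
lra.
Qed.

End Reduction.


(** * Running time and conclusion *)

Lemma nth_allpairs (S T U : Type) (f : S -> T -> U) z x0 y0 (s : seq S) (t : seq T) i j :
  (i < size s)%N -> (j < size t)%N ->
  nth z [seq f x y | x <- s, y <- t] (i * size t + j) = f (nth x0 s i) (nth y0 t j).
Proof.
elim: s i => [|x s IH] [|i] //= si tj; rewrite nth_cat size_map.
  by rewrite tj (nth_map y0).
rewrite mulSn -addnA ltnNge leq_addr /= addKn; exact: IH.
Qed.

Lemma nth_row_major (T : Type) (N d : nat) (A : 'M[T]_(N, d)) z (i : 'I_N) (j : 'I_d) :
  nth z (row_major A) (i * d + j) = A i j.
Proof.
have := @nth_allpairs _ _ _ (fun i j => A i j) z i j (enum 'I_N) (enum 'I_d) i j.
by rewrite !size_enum_ord !nth_ord_enum; apply.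
Qed.

Lemma nth_row_vector (T : Type) (d : nat) (v : 'rV[T]_d) z (j : 'I_d) :
  nth z (row_major v) j = v ord0 j.
Proof. by have := nth_row_major v z ord0 j; rewrite mul0n add0n. Qed.

Section Time.
Variable R : realType.

Lemma ln_geB (x : R) : 0 < x -> 1 - x^-1 <= ln x.
Proof.
move=> x0; have := @le_ln1Dx R (x^-1 - 1); have -> : 1 + (x^-1 - 1) = x^-1 by ring.
rewrite lnV // => h; have : 0 < x^-1 by rewrite invr_gt0.
by move=> h'; have := h (ltac:(lra)); lra.
Qed.

Lemma ln_leB (x : R) : 0 < x -> ln x <= x - 1.
Proof.
move=> x0; have := @le_ln1Dx R (x - 1); have -> : 1 + (x - 1) = x by ring.
by apply; lra.
Qed.

(** Turns a bound on the logarithm of the clock into a number of rounds, by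
    [ln (6 / 5) >= 1 / 6]. *)
Lemma exp_fuel (z y : R) : 0 <= y -> ln z <= y ->
  exists fuel : nat, z <= (6 / 5) ^+ fuel /\ fuel%:R <= 6 * y + 1.
Proof.
move=> y0 hz; have y6 : 0 <= 6 * y by lra.
have /andP[m1 m2] := truncn_itv y6.
exists (Num.truncn (6 * y)).+1; split; last by rewrite -natr1; lra.
set n := (Num.truncn _).+1 in m2 *.
have p1 : 1 <= (6 / 5 : R) ^+ n by rewrite exprn_ege1 //; lra.
have [z1|z1] := leP z 1; first exact: le_trans p1.
have l : 1 / 6 <= ln (6 / 5 : R).
  have := @ln_geB (6 / 5); have -> : (6 / 5 : R)^-1 = 5 / 6 by field.
  by move=> h; have := h (ltac:(lra)); lra.
rewrite -ler_ln ?posrE; [|lra|lra].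
rewrite lnXn; last lra.
rewrite -[ln _ *+ n]mulr_natr; apply: le_trans hz _.
have : 1 / 6 * n%:R <= ln (6 / 5 : R) * n%:R by rewrite ler_wpM2r.
lra.
Qed.

Lemma ln2_ge : 1 / 2 <= ln 2 :> R.
Proof.
have := @ln_geB 2; have -> : (2 : R)^-1 = 1 / 2 by rewrite div1r.
by move=> h; have := h (ltac:(lra)); lra.
Qed.

Lemma pow2_ln (n m : nat) : (2 ^ n <= m)%N -> n%:R <= 2 * ln m%:R :> R.
Proof.
move=> h; have m0 : (0 < m)%N by apply: leq_trans h; rewrite expn_gt0.
have : ln (2 ^+ n : R) <= ln m%:R.
  by rewrite ler_ln ?posrE ?exprn_gt0 ?ltr0n // -natrX ler_nat.
rewrite lnXn // -[ln 2 *+ n]mulr_natr => h2.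
have : 1 / 2 * n%:R <= ln 2 * n%:R :> R by rewrite ler_wpM2r // ln2_ge.
lra.
Qed.

(** One logarithmic factor comes from the products and the damping search of a round, two from the
    part [(2^K + 1) * 2 ln N] of the number of rounds. The part [L] of that number is already a
    factor of [m], and [L >= 1 / 2] gives [M <= 2 m] for the other terms. *)
Lemma time_bound (N d fuel : nat) (L : R) : (0 < N)%N -> (0 < d)%N ->
  1 / 2 <= L ->
  fuel%:R <= 6 * ((2 ^ power_of d).+1%:R * (2 * ln N%:R) + L) + 1 ->
  (5000 * (N * d * (2 ^ (power_of d).-1 + fuel_of N + 1) * fuel.+1))%N%:R <=
  softO (50 * 100 * 11 * 226) 3 (N%:R * d%:R * L).
Proof.
move=> N0 d0 L2 hf; set K := power_of d in hf *.
have n1 : 1 <= N%:R :> R by rewrite ler1n.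
have d1 : 1 <= d%:R :> R by rewrite ler1n.
set M := N%:R * d%:R; have M1 : 1 <= M by rewrite mulr_ege1.
have lnN0 : 0 <= ln N%:R :> R by apply: ln_ge0.
have lnd0 : 0 <= ln d%:R :> R by apply: ln_ge0.
have lnME : ln M = ln N%:R + ln d%:R by rewrite lnM // posrE; lra.
have ln21 : ln 2 <= 1 :> R by have := @ln_leB 2; move=> h; have := h (ltac:(lra)); lra.
rewrite /softO; set m := M * L; set l := 1 + ln (1 + m).
have mM : M <= 2 * m.
  have : M * (1 / 2) <= M * L by rewrite ler_wpM2l //; lra.
  by rewrite /m; lra.
have hl : ln M <= l.
  have : ln (M / 2) <= ln (1 + m) by rewrite ler_ln ?posrE; lra.
  have -> : ln M = ln (M / 2) + ln 2.
    by rewrite -lnM ?posrE ?divr_gt0 ?mulfVK //; lra.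
  by rewrite /l; lra.
have l1 : 1 <= l by rewrite /l lerDl ln_ge0 //; lra.
have hp : (2 ^ K.-1)%N%:R <= 4 * l.
  have h : (2 ^ 2 ^ K.-1 <= 2 * d)%N by rewrite power_ofP.
  have := pow2_ln h; rewrite natrM lnM ?posrE; [|lra|lra]; lra.
have hq : (2 ^ K).+1%:R <= 9 * l.
  rewrite -natr1; have -> : (2 ^ K = 2 * 2 ^ K.-1)%N by rewrite -expnS.
  rewrite natrM; lra.
have hF : (fuel_of N)%:R <= 6 * l.
  have h : (2 ^ trunc_log 2 N <= N)%N by apply: trunc_logP.
  have := pow2_ln h; rewrite /fuel_of -muln2 natrM -natr1; lra.
have l0 : 0 <= l by lra.
have hf2 : fuel.+1%:R <= 108 * l ^+ 2 + 6 * L + 2.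
  have : (2 ^ K).+1%:R * (2 * ln N%:R) <= 9 * l * (2 * l) by rewrite ler_pM //; lra.
  rewrite -natr1; lra.
have ll : l <= l ^+ 2 by rewrite expr2 ler_peMl.
have l2 : 1 <= l ^+ 2 by lra.
have m0 : 0 <= m by lra.
have h3 : M * fuel.+1%:R <= 226 * m * l ^+ 2.
  have a1 : M * fuel.+1%:R <= M * (108 * l ^+ 2 + 6 * L + 2) by rewrite ler_wpM2l //; lra.
  have a2 : M * l ^+ 2 <= 2 * m * l ^+ 2 by rewrite ler_wpM2r //; lra.
  have a3 : m * 1 <= m * l ^+ 2 by rewrite ler_wpM2l.
  have a4 : M * (6 * L) = 6 * m by rewrite /m; ring.
  have a5 : M <= M * l ^+ 2 by rewrite ler_peMr //; lra.
  lra.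
have h4 : (2 ^ K.-1 + fuel_of N + 1)%N%:R <= 11 * l by rewrite !natrD; lra.
rewrite !natrM -/M; apply: le_trans (_ : 5000 * ((11 * l) * (226 * m * l ^+ 2)) <= _).
  rewrite ler_pM2l // mulrAC mulrC ler_pM //; last by rewrite mulr_ge0 //; lra.
have -> : 50 * 100 * 11 * 226 * (M * L) * l ^+ 3 = 50 * 100 * (11 * l * (226 * m * l ^+ 2)).
  by rewrite /m; ring.
rewrite ler_wpM2r //; last by rewrite -natrM ler_nat.
by apply: mulr_ge0; [lra|apply: mulr_ge0 (sqr_ge0 l); lra].
Qed.

End Time.

(** * Probability of success *)

Section Success.
Variables (R : realType) (N d : nat) (X : 'M[option R]_(N, d)) (X0 : 'M[R]_(N, d)).
Variables (eps gs eta beta rho delta : R) (nu mu : 'rV[R]_d) (G : {set 'I_N}).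

Let Y := residual X X0 nu.
Let B2 := 3 * (beta * beta + rho * rho).
Let eta2 := eta * eta.
Let ratio := (norm_cap N eta2 B2 + 2 * B2) / (180 * B2).
Let K := power_of d.
Let z := clock_init N ratio eps delta K.
Let s om := input X X0 nu [:: eps; gs; eta; beta; rho; delta] om.

Lemma program_on_input om fuel :
  (0 < N)%N -> (0 < d)%N -> stable_sample Y eps eta2 B2 G -> z <= (6 / 5) ^+ fuel ->
  runs program (s om) (5000 * (N * d * (2 ^ K.-1 + fuel_of N + 1) * fuel.+1)) (fun s' =>
    output d s' = nu + \sum_i (rounds Y eps eta2 B2 K fuel z (prune Y eta2 B2) om i / N%:R)
                             *: Y i).
Proof.
move=> N0 d0 SS hz.
have hY (i : 'I_N) (j : 'I_d) : Y i 0 j = rmem (s om) 1 (i * d + j)%N -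
    (nmem (s om) 1 (i * d + j)%N)%:R * rmem (s om) 2 j.
  rewrite /= !nth_row_major mxE mxE; congr (_ - _ * _).
  by rewrite nth_row_vector.
have dm : dims N d (s om) by [].
have h := program_spec (delta := delta) N0 d0 dm (erefl : rmem (s om) 0 0 = eps)
  (erefl : rmem (s om) 0 2 = eta) (erefl : rmem (s om) 0 3 = beta)
  (erefl : rmem (s om) 0 4 = rho) erefl hY erefl erefl erefl erefl erefl SS hz.
apply: (runs_weaken h) => // s' _ e; apply/rowP => j; rewrite !mxE e.
have -> : rmem (s om) 2 j = nu 0 j.
  by rewrite /= nth_row_vector.
by congr (_ + _); rewrite summxE; apply: eq_bigr => i _; rewrite [RHS]mxE.
Qed.

Hypothesis N0 : (0 < N)%N.
Hypothesis d0 : (0 < d)%N.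

(** The degenerate cases, in which the pruned weights already suffice: either there is no bad point,
    or the norm cap is zero and only zero residuals keep weight. *)
Lemma prune_bad_moment_le fuel om x :
  stable_sample Y eps eta2 B2 G -> ~~ (1 < z) ->
  (B2 = 0 -> eta2 = 0) -> (eps * N%:R < 1 \/ B2 = 0) ->
  \sum_(i in ~: G) rounds Y eps eta2 B2 K fuel z (prune Y eta2 B2) om i / N%:R *
     dot (Y i) x ^+ 2 <= 360 * B2 * dot x x.
Proof.
move=> SS z1 hB hdeg; have x0 := dotxx_ge0 x.
have B20 : 0 <= B2 by case: SS => _ _ _ [].
have -> : rounds Y eps eta2 B2 K fuel z (prune Y eta2 B2) om = prune Y eta2 B2.
  by case: fuel => //= n; rewrite leNgt (negbTE z1).
case: hdeg => [eN|B0].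
  rewrite big_pred0 => [|i]; first by rewrite mulr_ge0 // mulr_ge0.
  apply/negP => iG; have h : 1 <= #|~: G|%:R :> R.
    by rewrite ler1n; apply/card_gt0P; exists i.
  by have := card_bad SS; lra.
rewrite B0 mulr0 mul0r big1 // => i _; rewrite /prune /norm_cap hB // addr0 mulr0.
case: ifPn => [Y0|_]; last by rewrite mul0r mul0r.
have := dot_CS (Y i) x; have -> : dot (Y i) (Y i) = 0.
  by apply/eqP; rewrite eq_le Y0 dotxx_ge0.
rewrite mul0r => h; have -> : dot (Y i) x ^+ 2 = 0 by apply/eqP; rewrite eq_le h sqr_ge0.
by rewrite mulr0.
Qed.

(** The initial potential is at most [d (ratio theta)^(q+1)], which is [ratio^(q+1)] times the
    threshold; dividing by the clock leaves [delta] times the threshold. *)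
Lemma excess_prune_le : stable_sample Y eps eta2 B2 G -> 0 < B2 -> 0 < delta ->
  1 <= eps * N%:R ->
  0 < z /\ excess Y eta2 B2 K (prune Y eta2 B2) / z <= delta * threshold d B2 K.
Proof.
move=> SS B2p dl eN1; have [n0 _ _ _ [eta20 _ _]] := stable_sampleP SS.
have cap0 : 0 < norm_cap N eta2 B2 by rewrite /norm_cap mulr_gt0 //; lra.
have c0 : 0 < 180 * B2 by rewrite mulr_gt0.
have r0 : 0 < ratio by rewrite divr_gt0 //; lra.
have zE : z = ratio ^+ (2 ^ K).+1 / delta by rewrite /z /clock_init eN1 -exprSr.
have zp : 0 < z by rewrite zE divr_gt0 // exprn_gt0.
split=> //; rewrite ler_pdivrMr //.
apply: le_trans (_ : d%:R * (norm_cap N eta2 B2 + 2 * B2) ^+ (2 ^ K).+1 <= _).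
  rewrite /excess; case: ifP => _.
    by have := potential_prune_le (K := K) (isT : (0 < K)%N) SS.
  by rewrite mulr_ge0 // exprn_ge0 // addr_ge0 ?(ltW cap0) // mulr_ge0 // ltW.
have -> : norm_cap N eta2 B2 + 2 * B2 = ratio * (180 * B2).
  by rewrite /ratio mulfVK // gt_eqF.
rewrite exprMn zE /threshold /theta le_eqVlt; apply/orP; left; apply/eqP.
by field; rewrite gt_eqF.
Qed.

(** Markov's inequality: the success indicator is at least [1 - excess / threshold], because a
    nonzero excess is above the threshold and a zero one gives the moment bound. *)
Lemma success_probability fuel m :
  stable_sample Y eps eta2 B2 G -> (B2 = 0 -> eta2 = 0) -> 0 < delta ->
  z <= (6 / 5) ^+ fuel ->
  1 - delta <= avg (fuel * d + m) (fun om => (`[< valid G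
     (rounds Y eps eta2 B2 K fuel z (prune Y eta2 B2) om) /\
     forall x, \sum_(i in ~: G) rounds Y eps eta2 B2 K fuel z (prune Y eta2 B2) om i / N%:R *
     dot (Y i) x ^+ 2 <= 360 * B2 * dot x x >])%:R).
Proof.
move=> SS hB dl hz; have B20 : 0 <= B2 by case: SS => _ _ _ [].
have vp := valid_prune SS; have cp := @capped_prune R N d Y eta2 B2.
have [deg|ndeg] := pselect (eps * N%:R < 1 \/ B2 = 0).
  have z1 : ~~ (1 < z).
    rewrite -leNgt /z /clock_init; case: ifP => // eN1; case: deg => [|B0]; first lra.
    have -> : ratio = 0 by rewrite /ratio B0 !mulr0 invr0 mulr0.
    by rewrite mulr0 mul0r.
  rewrite (eq_avg _ (f2 := fun=> 1)); first by rewrite avg_cst; lra.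
  move=> om; rewrite asboolT //; split=> [|x]; last exact: prune_bad_moment_le.
  have -> // : rounds Y eps eta2 B2 K fuel z (prune Y eta2 B2) om = prune Y eta2 B2.
  by case: (fuel) => //= n; rewrite leNgt (negbTE z1).
have eN1 : 1 <= eps * N%:R by rewrite leNgt; apply/negP => h; apply: ndeg; left.
have B2p : 0 < B2.
  by rewrite lt_neqAle B20 andbT eq_sym; apply/eqP => h; apply: ndeg; right.
have [zp hex] := excess_prune_le SS B2p dl eN1.
have K0 : (0 < K)%N by [].
set rd := fun om => rounds Y eps eta2 B2 K fuel z (prune Y eta2 B2) om.
have hav := @avg_rounds R N d Y eps eta2 B2 G K K0 fuel m z _ SS eN1 B2p vp cp zp hz.
have th0 : 0 < threshold d B2 K.
  by rewrite mulr_gt0 ?ltr0n // exprn_gt0 // mulr_gt0.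
apply: le_trans (_ : avg (fuel * d + m) (fun om => 1 + - (threshold d B2 K)^-1 *
    excess Y eta2 B2 K (rd om)) <= _).
  rewrite avgD avg_cst avgZ.
  have h : avg (fuel * d + m) (fun om => excess Y eta2 B2 K (rd om)) <=
     delta * threshold d B2 K by apply: le_trans hex.
  have : (threshold d B2 K)^-1 * avg (fuel * d + m) (fun om => excess Y eta2 B2 K (rd om))
     <= (threshold d B2 K)^-1 * (delta * threshold d B2 K).
    by rewrite ler_wpM2l // invr_ge0 ltW.
  have -> : (threshold d B2 K)^-1 * (delta * threshold d B2 K) = delta.
    by field; rewrite gt_eqF.
  lra.
apply: ler_avg => om.
have [vw cw] := rounds_spec K fuel z om SS eN1 B2p vp cp.
have [e0|e0] := eqVneq (excess Y eta2 B2 K (rd om)) 0.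
  rewrite e0 mulr0 addr0 asboolT //; split=> // x.
  apply: (bad_moment_le K0 x SS B2p vw e0).
  (* As [K] is not below itself, [power_ofP] gives [2 d < 2^(2^K)]. *)
  rewrite -natrM -natrX ltr_nat ltnNge power_ofP //.
  by rewrite ltnn.
have hgt : threshold d B2 K <= excess Y eta2 B2 K (rd om).
  by move: e0; rewrite /excess; case: ltP => [/ltW|] //; rewrite eqxx.
apply: le_trans (_ : 0 <= _) => //.
have : (threshold d B2 K)^-1 * threshold d B2 K <=
   (threshold d B2 K)^-1 * excess Y eta2 B2 K (rd om).
  by rewrite ler_wpM2l // invr_ge0 ltW.
rewrite mulVf ?gt_eqF //; lra.
Qed.

(** [norm_cap_le] gives [ratio <= N^2], so each unit of the exponent costs [2 ln N]. A clock at zero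
    has logarithm zero by convention. *)
Lemma ln_clock : stable_sample Y eps eta2 B2 G -> 0 < delta < 1 / 2 ->
  ln z <= (2 ^ K).+1%:R * (2 * ln N%:R) + ln (1 / delta).
Proof.
move=> SS /andP[dl0 dl1]; have [n0 _ _ _ [eta20 B20 _]] := stable_sampleP SS.
have n1 : 1 <= N%:R :> R by rewrite ler1n.
have lN0 : 0 <= ln N%:R :> R by apply: ln_ge0.
have id2 : 1 <= 1 / delta by rewrite ler_pdivlMr //; lra.
have ld : 0 <= ln (1 / delta) by apply: ln_ge0.
have rhs0 : 0 <= (2 ^ K).+1%:R * (2 * ln N%:R) + ln (1 / delta).
  by rewrite addr_ge0 // mulr_ge0 // mulr_ge0.
have [zn|zp] := leP z 0; first by rewrite ln0.
have eN1 : 1 <= eps * N%:R.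
  by move: zp; rewrite /z /clock_init; case: ifP => //; rewrite ltxx.
have zE : z = ratio ^+ (2 ^ K).+1 / delta by rewrite /z /clock_init eN1 -exprSr.
have B2p : 0 < B2.
  rewrite lt_neqAle B20 andbT; apply/eqP => h; move: zp; rewrite zE /ratio -h.
  by rewrite !mulr0 invr0 mulr0 expr0n mul0r ltxx.
have c0 : 0 < 180 * B2 by rewrite mulr_gt0.
have cap0 : 0 < norm_cap N eta2 B2 by rewrite /norm_cap mulr_gt0 //; lra.
have r0 : 0 < ratio by rewrite divr_gt0 //; lra.
have rN : ratio <= N%:R ^+ 2.
  rewrite /ratio ler_pdivrMr //; have := norm_cap_le SS eN1; rewrite -natr1.
  have a1 : 1 * B2 <= N%:R * B2 by rewrite ler_wpM2r.
  have a2 : N%:R * B2 * 1 <= N%:R * B2 * N%:R by rewrite ler_wpM2l // mulr_ge0 // ltW.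
  lra.
rewrite zE lnM ?posrE ?exprn_gt0 ?invr_gt0 // [in leRHS]div1r lerD2r lnXn //.
rewrite -[ln ratio *+ _]mulr_natl ler_wpM2l //.
rewrite mulr_natl -lnXn // ler_ln ?posrE ?exprn_gt0 //.
Qed.

End Success.

Theorem theorem3p5 (R : realType) :
  exists C5 C6 c7 K : R,
  [/\ 5 <= C5, 0 < C6, 0 < c7 < 1 & 0 < K] /\
  exists (P : cmd) (A : R) (k : nat),
  forall (N d : nat) (X : 'M[option R]_(N, d)) (X0 : 'M[R]_(N, d))
         (eps gs eta beta : R) (nu : 'rV[R]_d) (rho delta : R)
         (mu : 'rV[R]_d) (G : {set 'I_N}),
    (0 < N)%N -> (0 < d)%N ->
    completes X X0 ->
    0 < eps < 1 ->
    C5 * eps <= gs <= 1 ->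
    0 <= eta ->
    K * eta ^+ 2 * eps * ln (1 / eps) <= beta ^+ 2 ->
    good_witness X X0 eps gs eta beta mu G ->
    wnorm (obs_frac X G) (nu - mu) <= rho ->
    0 < delta < 1 / 2 ->
    let init := input X X0 nu [:: eps; gs; eta; beta; rho; delta] in
    exists T : nat,
      [/\ T%:R <= softO A k (N%:R * d%:R * ln (1 / delta)),
          halts_within P init T
        & 1 - delta <=
          prob_output P init T (fun s =>
            wnorm (obs_frac X G) (output d s - mu) ^+ 2
            <= C6 * beta ^+ 2 * eps + (1 - c7 * gs) * rho ^+ 2)].
Proof.
(* [C6] is three times the 4000 of [estimate_error]. [C5 = 4 C6] makes the error in [eps rho^2] at
   most [gs rho^2 / 4], half of the gain [gs rho^2 / 2], whence [c7 = 1 / 4]. [K = 4] comes from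
   [ln (1 / eps) >= 1 / 2]. *)
exists (240 * 200), (120 * 100), (1 / 4), 4; split; first by split; lra.
exists program, (50 * 100 * 11 * 226), 3%N.
move=> N d X X0 eps gs eta beta nu rho delta mu G N0 d0 _ he hgs eta0 hK gw hr hd init.
have RG : regime X X0 eps gs eta beta rho nu mu G by split.
have SS := residual_stable N0 RG.
have [e0 _ h2 _ _] := regimeP RG.
have /andP[dl0 dl1] := hd.
set B2 := 3 * (beta * beta + rho * rho) in SS.
have hB : B2 = 0 -> eta * eta = 0.
  rewrite /B2 -!expr2 => h; have r0 := sqr_ge0 rho; have b0 := sqr_ge0 beta.
  have : beta ^+ 2 = 0 by lra.
  move=> hb; rewrite hb in h2; apply/eqP; rewrite eq_le sqr_ge0 andbT.
  by rewrite -(@pmulr_rle0 _ (2 * eps)) // mulr_gt0.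
have hl := ln_clock N0 SS hd.
have ldp : 1 / 2 <= ln (1 / delta).
  have : ln 2 <= ln (1 / delta).
    by rewrite ler_ln ?posrE ?divr_gt0 // ler_pdivlMr //; lra.
  have := ln2_ge R; lra.
have y0 : 0 <= (2 ^ power_of d).+1%:R * (2 * ln N%:R) + ln (1 / delta).
  rewrite addr_ge0 ?mulr_ge0 //; last by lra.
  by apply: ln_ge0; rewrite ler1n.
have [fuel [hz hf]] := exp_fuel y0 hl.
pose T := (5000 * (N * d * (2 ^ (power_of d).-1 + fuel_of N + 1) * fuel.+1))%N.
have hrun om := @program_on_input R N d X X0 eps gs eta beta rho delta nu G om fuel N0 d0 SS hz.
exists T; split; first exact: time_bound.
  by move=> om; have [t [s' [h1 h3 _]]] := hrun om; exists t, s'.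
(* Success is averaged over the at most [fuel * d] tosses that the rounds read; the others up to [T]
   are padding. *)
have hT : (fuel * d <= T)%N.
  rewrite /T; set q := (_ + _ + 1)%N; have q0 : (0 < q)%N by rewrite /q addn1.
  have : (0 < N * q)%N by rewrite muln_gt0 N0.
  have -> : (N * d * q * fuel.+1 = N * q * (d * fuel.+1))%N by ring.
  move=> M0; apply: (@leq_trans (d * fuel.+1)); first by rewrite mulnC leq_mul2l leqnSn orbT.
  by apply: leq_trans (leq_pmull _ M0) _; apply: leq_pmull.
rewrite prob_output_avg -(subnKC hT).
apply: le_trans (success_probability d0 (T - fuel * d)%N SS hB dl0 hz) _.
apply: ler_avg => om; rewrite ler_nat.
case: (asboolP (_ /\ _)) => // -[vw hx].
suff -> : `[< exists t s, exec program (init om) t s /\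
    wnorm (obs_frac X G) (output d s - mu) ^+ 2 <=
    120 * 100 * beta ^+ 2 * eps + (1 - 1 / 4 * gs) * rho ^+ 2 >] by [].
apply/asboolP; have [t [s' [h1 _ h3]]] := hrun om.
exists t, s'; split=> //; rewrite h3.
exact: progress RG vw hx.
Qed.
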